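(* Let $(X_n)_{n\ge 0}$ be a (tenable) Pólya urn process with $s$ colours and real replacement matrix $R=(r_{ij})_{i,j=1}^s$, and suppose that the urn is balanced (with all row sums of $R$ equal to $m>0$), irreducible and critically small. Let $\lambda_1=m$ be the largest real eigenvalue of $R$ and let $v_1$ be the positive left eigenvector of $R$ with eigenvalue $\lambda_1$, normalized by $|v_1|=1$. Let $1+d$ (with $d\ge0$) be the dimension of the largest Jordan block of $R$ corresponding to an eigenvalue $\lambda$ with $\operatorname{Re}\lambda=\lambda_1/2$, and let $\nu=2d+1$. Then there is a covariance matrix $\Sigma$, determined by $R$, such that, as $n\to\infty$, $$\frac{X_n-n\lambda_1 v_1}{\sqrt{n\log^\nu n}}\ \overset{\mathrm d}{\longrightarrow}\ N(0,\Sigma),$$ with convergence of all (mixed) moments: for every multi-index $\alpha\in\mathbb Z_{\ge0}^s$, $\mathbb E\prod_{i=1}^s\big((X_{n}-n\lambda_1v_{1})_i/\sqrt{n\log^\nu n}\big)^{\alpha_i}$ converges to the corresponding moment $\mathbb E\prod_i Z_i^{\alpha_i}$ of $Z\sim N(0,\Sigma)$. In particular, $\mathbb E X_n=n\lambda_1v_1+o\big((n\log^\nu n)^{1/2}\big)$ and the covariance matrix satisfies $\operatorname{Var}(X_n)=(n\log^\nu n)\Sigma+o(n\log^\nu n)$.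
   Context: Pólya urn process (real version): $R=(r_{ij})_{i,j=1}^s$ is a real $s\times s$ matrix and $X_0\in[0,\infty)^s\setminus\{0\}$ is a deterministic vector. Given $X_n=(X_{n1},\dots,X_{ns})\in[0,\infty)^s\setminus\{0\}$, put $X_{n+1}=X_n+(r_{K1},\dots,r_{Ks})$, where the random index $K\in\{1,\dots,s\}$ has conditional distribution (given the past) $\mathbb P(K=k\mid X_n)=X_{nk}/\sum_{j=1}^sX_{nj}$. So $(X_n)$ is a Markov process. Tenability: the process is tenable if always $X_n\in[0,\infty)^s\setminus\{0\}$. Throughout it is assumed that for all $j,k\in\{1,\dots,s\}$: $r_{kj}\ge0$ if $j\ne k$; and either $r_{kk}\ge 0$, or $X_{0k}\mathbb Z+\sum_{i=1}^s r_{ik}\mathbb Z=r_{kk}\mathbb Z$. Balanced: all row sums of $R$ equal a constant $m$; it is assumed that $m>0$. Irreducible: the matrix $R$ is irreducible. Then $\lambda_1:=m$ is a simple eigenvalue of $R$, all other eigenvalues $\lambda$ satisfy $\operatorname{Re}\lambda<\lambda_1$, and there is a unique positive left eigenvector $v_1$ of $R$ with eigenvalue $\lambda_1$ and $|v_1|=1$, where $|(x_1,\dots,x_s)|:=\sum_i|x_i|$. Critically small: $\lambda_1$ is a simple eigenvalue, every other eigenvalue $\lambda$ of $R$ satisfies $\operatorname{Re}\lambda\le\frac12\lambda_1$, and there is at least one eigenvalue with $\operatorname{Re}\lambda=\frac12\lambda_1$. Notation: $\log^\nu n=(\log n)^\nu$. *)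

(* Defs.v *)
(* MathComp + MathComp-Analysis; complex numbers R[i] from real-closed. *)
From HB Require Import structures.
From mathcomp Require Import all_boot all_order all_algebra.
From mathcomp Require Import complex.
From mathcomp Require Import all_classical all_reals all_analysis.

Set Implicit Arguments.
Unset Strict Implicit.
Unset Printing Implicit Defensive.

Import Order.TTheory GRing.Theory Num.Theory.
Import numFieldNormedType.Exports.

Local Open Scope classical_set_scope.
Local Open Scope ring_scope.

(* Colours are 'I_s, vectors of R^s are row vectors, and the k-th row of the
   replacement matrix is added when colour k is drawn. *)

Section replacement_matrix.
Variables (R : realType) (s : nat).
Implicit Types (A : 'M[R]_s) (m : R) (v : 'rV[R]_s).

Definition nonneg_nonzero (x : 'rV[R]_s) : Prop :=
  (forall i, 0 <= x 0 i) /\ x != 0.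

(* The arithmetic condition under which the urn started at x0 stays in
   [0, oo)^s \ {0}.  The set equality is the equality of additive subgroups
   x0_k Z + sum_i r_ik Z = r_kk Z of R. *)
Definition tenable A (x0 : 'rV[R]_s) : Prop :=
  (forall j k, j != k -> 0 <= A k j) /\
  (forall k, 0 <= A k k \/
     [set y : R | exists (c : int) (z : 'I_s -> int),
        y = x0 0 k *~ c + \sum_i (A i k *~ z i)]
     = [set y : R | exists z : int, y = A k k *~ z]).

Definition balanced A m : Prop := forall i, \sum_j A i j = m.

(* No simultaneous permutation of rows and columns makes A block triangular:
   every proper nonempty set of indices has a nonzero entry leaving it. *)
Definition irreducible A : Prop :=
  forall S : {set 'I_s}, S != finset.set0 -> S != [set: 'I_s]%SET ->
    exists i j, [/\ i \in S, j \notin S & A i j != 0].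

Definition complexify A : 'M[R[i]]_s := map_mx (real_complex R) A.

(* Simplicity is algebraic: simple root of the characteristic polynomial. *)
Definition critically_small A (lambda1 : R) : Prop :=
  [/\ mup lambda1 (char_poly A) = 1%N,
      forall lam : R[i], eigenvalue (complexify A) lam ->
        lam != real_complex R lambda1 -> complex.Re lam <= lambda1 / 2
    & exists2 lam : R[i], eigenvalue (complexify A) lam &
        complex.Re lam = lambda1 / 2].

Definition normalized_left_eigenvector A (lambda1 : R) v : Prop :=
  [/\ forall i, 0 < v 0 i, v *m A = lambda1 *: v & \sum_i `|v 0 i| = 1].

Definition covariance_matrix (Sigma : 'M[R]_s) : Prop :=
  Sigma^T = Sigma /\ forall t : 'rV[R]_s, 0 <= (t *m Sigma *m t^T) 0 0.

End replacement_matrix.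

Section jordan.
Variable F : fieldType.

Definition jordan_block (n : nat) (lam : F) : 'M[F]_n :=
  \matrix_(i, j) (lam *+ (i == j) + (i.+1 == j)%:R).

(* The base change V has inverse W; stating this with rectangular types avoids
   casting along \sum_i p i = n. *)
Definition jordan_form (n : nat) (A : 'M[F]_n)
    (k : nat) (p : 'I_k -> nat) (lam : 'I_k -> F) : Prop :=
  (forall i, (0 < p i)%N) /\
  exists (V : 'M[F]_(\sum_i p i, n)) (W : 'M[F]_(n, \sum_i p i)),
    [/\ V *m W = 1%:M, W *m V = 1%:M &
        V *m A *m W = \mxdiag_(i < k) jordan_block (p i) (lam i)].

End jordan.

Definition largest_jordan_block (R : realType) (s : nat) (A : 'M[R]_s)
    (rho : R) (N : nat) : Prop :=
  exists (k : nat) (p : 'I_k -> nat) (lam : 'I_k -> R[i]),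
    [/\ jordan_form (complexify A) p lam,
        forall i, complex.Re (lam i) = rho -> (p i <= N)%N &
        exists2 i, complex.Re (lam i) = rho & p i = N].

Section probability.
Variables (R : realType) (s : nat).
Variables (d : measure_display) (T : measurableType d) (P : probability T R).

(* K n is the colour drawn at time n.  All X n take finitely many values, so
   the conditional law given the past is expressed on the atoms
   {X_0 = x_0, ..., X_n = x_n}. *)
Definition polya_urn (A : 'M[R]_s) (x0 : 'rV[R]_s)
    (X : nat -> T -> 'rV[R]_s) : Prop :=
  exists K : nat -> T -> 'I_s,
    [/\ forall n k, measurable (K n @^-1` [set k]),
        forall w, X 0%N w = x0,
        forall n w, X n.+1 w = X n w + row (K n w) A
      & forall n (x : nat -> 'rV[R]_s) (k : 'I_s),
          let past := [set w | forall i, (i <= n)%N -> X i w = x i] in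
          P (past `&` K n @^-1` [set k]) =
            ((x n 0 k / \sum_j x n 0 j)%:E * P past)%E].

(* normal_prob is not the Dirac mass at the mean when its standard deviation
   is 0, hence the separate case. *)
Definition centered_normal_law (v : R) (B : set R) : \bar R :=
  if v == 0 then \d_(0 : R) B else normal_prob 0 (Num.sqrt v) B.

(* Z ~ N(0, Sigma): every linear combination t . Z is N(0, t Sigma t^T),
   possibly degenerate. *)
Definition centered_gaussian (Sigma : 'M[R]_s) (Z : T -> 'rV[R]_s) : Prop :=
  (forall i, measurable_fun [set: T] (fun w => Z w 0 i)) /\
  forall (t : 'rV[R]_s) (B : set R), measurable B ->
    pushforward P (fun w => \sum_i t 0 i * Z w 0 i) B =
    centered_normal_law ((t *m Sigma *m t^T) 0 0) B.

Definition moment (alpha : 'I_s -> nat) (Y : T -> 'rV[R]_s) : \bar R :=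
  expectation P (fun w => \prod_i Y w 0 i ^+ alpha i).

Definition mean (Y : T -> 'rV[R]_s) (i : 'I_s) : R :=
  fine (expectation P (fun w => Y w 0 i)).

Definition cov (Y : T -> 'rV[R]_s) (i j : 'I_s) : R :=
  fine (covariance P (fun w => Y w 0 i) (fun w => Y w 0 j)).

End probability.

Definition cvg_in_distribution (R : realType) (s : nat)
    (d : measure_display) (T : measurableType d) (P : probability T R)
    (Y : nat -> T -> 'rV[R]_s)
    (d' : measure_display) (T' : measurableType d') (Q : probability T' R)
    (Z : T' -> 'rV[R]_s) : Prop :=
  forall f : 'rV[R]_s -> R, continuous f ->
    (exists M : R, forall x, `|f x| <= M) ->
    expectation P (fun w => f (Y n w))
      @[n --> \oo] --> expectation Q (fun w => f (Z w)).

(* Main.v *)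
Require Import Defs.
From HB Require Import structures.
From mathcomp Require Import all_boot all_order all_algebra.
From mathcomp Require Import complex ring lra.
From mathcomp Require Import all_classical all_reals all_analysis.
From mathcomp Require Import measurable_realfun.

Set Implicit Arguments.
Unset Strict Implicit.
Unset Printing Implicit Defensive.

Import Order.TTheory GRing.Theory Num.Theory.
Import numFieldNormedType.Exports.

Local Open Scope classical_set_scope.
Local Open Scope ring_scope.

(** Let [kappa] be the initial total divided by [m] and [tau n = kappa + n], so
    that the urn contains [m * tau n] at time [n]. A linear statistic [X n.+1 *m
    theta] has conditional mean [X n *m pullback n theta], where [pullback n] is
    multiplication by [1 + A / (m * tau n)]. The normalised statistic of a test vector
    [t] at time [N] is, up to a vanishing shift, the end of the martingale [X j
    *m theta t N j]: one projects [t] along the constant vector to the kernel of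
    [v1], which is what the centring by [n * m * v1] amounts to, divides by the
    square root of [N * ln N ^ nu], and pulls back from time [N] to time [j].

    Lindeberg's method gives the cosine transform of this statistic. One draw
    multiplies the expectation of [cos (X j *m theta + b)] by [exp (- q / 2)],
    where [q] is the conditional variance computed with the limiting colour
    proportions [v1] ([urn_step_cos]); the errors are of third order in [theta]
    or involve the distance between actual and limiting proportions. The same
    computation with exponentials bounds the exponential moments
    ([urn_exp_bound]), and these imply a law of large numbers for the
    proportions ([deviation_cvg0]). So the errors sum to zero, and the cosine
    transform converges as soon as the accumulated variance does
    ([urn_cos_limit]).

    The limit of the variance is a question on a matrix and one real scale, the
    clock [h n], the sum of [1 / tau i] for [i < n], which is [ln n] up to a
    bounded term. On two Jordan chains with eigenvalues [lam] and [mu] of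
    [A / m], the accumulated variance divided by [tau n] satisfies an exact
    linear recursion in the clock with rate [lam + mu - 1] ([naccumS]). If both
    eigenvalues are critical, that is of real part [1 / 2], the rate is zero or
    purely imaginary: in the first case Stolz-Cesaro gains a power of the clock
    at each step up either chain, in the second one oscillation gives the limit
    zero ([naccum_critical_limit]). Chains of smaller real part stay bounded,
    and the eigenvalue [m] disappears with the projection, because by the
    maximum principle its eigenvectors are constant. The largest power, reached
    by two chains of length [d + 1], is [2 * d + 1 = nu] ([raccum_limit]), and
    the limit does not depend on [kappa]: it is the form of [Sigma].

    A Gaussian vector of covariance [Sigma] is built from a factorisation
    [Sigma = B *m B^T] and independent standard normal variables; its cosine
    transform follows from the addition formula ([std_cosE]). To pass from
    cosines to other functions, continuous functions [f] with [f ^ 2] at most a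
    multiple of the weight [expweight], one plus the sum of the exponentials of
    plus and minus the coordinates, are approximated by trigonometric sums, uniformly relative to that weight
    ([trigonometric_approx]). As the weight has bounded expectation, expectations
    of all such [f] converge ([continuous_limit]). Bounded continuous functions
    and monomials are among them, which gives convergence in law and of all
    moments; the mean and the covariance of the urn are obtained by undoing the
    normalisation. *)

(** * Stolz-Cesaro and the logarithmic clock *)

Section cvg_tools.
Variable R : realType.
Implicit Types u v b : nat -> R.

Lemma cvg_sum_seq (I : Type) (r : seq I) (f : I -> nat -> R) (l : I -> R) :
  (forall i, f i n @[n --> \oo] --> l i) ->
  \sum_(i <- r) f i n @[n --> \oo] --> \sum_(i <- r) l i.
Proof.
move=> fl; elim: r => [|i r IH].
  by rewrite big_nil; under eq_fun do rewrite big_nil; exact: cvg_cst.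
rewrite big_cons; under eq_fun do rewrite big_cons.
by apply: cvgD => //; exact: fl.
Qed.

Lemma cvg0_norm_le u v : (\forall n \near \oo, `|u n| <= v n) ->
  v n @[n --> \oo] --> 0 -> u n @[n --> \oo] --> 0.
Proof.
move=> uv v0; apply/cvgrPdist_le => e e0.
move/cvgrPdist_le : v0 => /(_ _ e0) v0; near=> n.
rewrite sub0r normrN; apply: (@le_trans _ _ (v n)); first by near: n.
rewrite (le_trans (ler_norm _))//.
have : `|0 - v n| <= e by near: n.
by rewrite sub0r normrN.
Unshelve. all: by end_near. Qed.

(** One half of the Stolz-Cesaro theorem, for increments controlled from above
    only; [stolz] applies it to both signs. *)
Lemma stolz0 b u : (forall n, b n <= b n.+1) -> b n @[n --> \oo] --> +oo ->
  (forall e, 0 < e -> \forall n \near \oo,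
     u n.+1 <= u n + e * (b n.+1 - b n)) ->
  forall e, 0 < e -> \forall n \near \oo, u n <= e * b n.
Proof.
move=> bnd binfty H e e0.
have e20 : 0 < e / 2 by rewrite divr_gt0.
have [N _ HN] := H _ e20.
have uN n : (N <= n)%N -> u n <= u N + e / 2 * (b n - b N).
  elim: n => [|n IH]; first by rewrite leqn0 => /eqP ->; rewrite subrr mulr0 addr0.
  rewrite leq_eqVlt => /predU1P[<-|Nn]; first by rewrite subrr mulr0 addr0.
  apply: (le_trans (HN n Nn)); have := IH Nn.
  by lra.
move/cvgryPge : binfty => binfty.
near=> n.
have Nn : (N <= n)%N by near: n; exact: nbhs_infty_ge.
apply: (le_trans (uN n Nn)).
have : (u N - e / 2 * b N) / (e / 2) <= b n by near: n; exact: binfty.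
by rewrite ler_pdivrMr//; lra.
Unshelve. all: by end_near. Qed.

(** Stolz-Cesaro, with the hypothesis on the ratio of increments written
    without division, so that [b] may have vanishing increments. *)
Lemma stolz b u l : (forall n, b n <= b n.+1) -> b n @[n --> \oo] --> +oo ->
  (forall e, 0 < e -> \forall n \near \oo,
     `|(u n.+1 - u n) - l * (b n.+1 - b n)| <= e * (b n.+1 - b n)) ->
  u n / b n @[n --> \oo] --> l.
Proof.
move=> bnd binfty H; apply/cvgrPdist_le => e e0.
have H1 : \forall n \near \oo, u n - l * b n <= e * b n.
  apply: (@stolz0 b (fun n => u n - l * b n)) => //.
  move=> d d0; apply: filterS (H d d0) => n; rewrite ler_norml => /andP[_].
  by lra.
have H2 : \forall n \near \oo, l * b n - u n <= e * b n.
  apply: (@stolz0 b (fun n => l * b n - u n)) => //.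
  move=> d d0; apply: filterS (H d d0) => n; rewrite ler_norml => /andP[+ _].
  by lra.
move/cvgryPgt : binfty => /(_ 0) b0.
near=> n.
have bn0 : 0 < b n by near: n; exact: b0.
have -> : l - u n / b n = (l * b n - u n) / b n.
  by rewrite mulrBl mulfK ?gt_eqF.
rewrite normrM [`|(b n)^-1|]gtr0_norm ?invr_gt0// ler_pdivrMr//.
rewrite ler_norml; apply/andP; split; last by near: n.
have : u n - l * b n <= e * b n by near: n.
by lra.
Unshelve. all: by end_near. Qed.

End cvg_tools.

Section harmonic.
Variables (R : realType) (kappa : R).
Hypothesis kappa_gt0 : 0 < kappa.

(** With [kappa] the initial total divided by [m], the urn holds [m * tau n]
    units at time [n]. *)
Definition tau (n : nat) : R := kappa + n%:R.
(** The clock of all growth rates: [harm 0 n] is [ln n] up to a bounded error,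
    and its increments are the step sizes of the recursions below. *)
Definition harm (j n : nat) : R := \sum_(j <= i < n) (tau i)^-1.

Lemma tau_gt0 n : 0 < tau n.
Proof. by rewrite /tau ltr_pwDl. Qed.

Lemma tau_neq0 n : tau n != 0.
Proof. by rewrite gt_eqF ?tau_gt0. Qed.

Lemma tau_ge0 n : 0 <= tau n.
Proof. exact: ltW (tau_gt0 n). Qed.

Lemma tauV_ge0 n : 0 <= (tau n)^-1.
Proof. by rewrite invr_ge0 tau_ge0. Qed.

Lemma tauS n : tau n.+1 = tau n + 1.
Proof. by rewrite /tau -natr1 addrA. Qed.

Lemma tau_ge n : kappa <= tau n.
Proof. by rewrite /tau lerDl. Qed.

Lemma ler_tau : {homo tau : i j / (i <= j)%N >-> i <= j}.
Proof. by move=> i j ij; rewrite /tau lerD2l ler_nat. Qed.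

Lemma harmnn n : harm n n = 0. Proof. by rewrite /harm big_geq. Qed.

Lemma harmS j n : (j <= n)%N -> harm j n.+1 = harm j n + (tau n)^-1.
Proof. by move=> jn; rewrite /harm big_nat_recr. Qed.

Lemma harm_recl j n : (j < n)%N -> harm j n = (tau j)^-1 + harm j.+1 n.
Proof. by move=> jn; rewrite /harm big_ltn. Qed.

Lemma harm_ge0 j n : 0 <= harm j n.
Proof. by apply: sumr_ge0 => i _; rewrite invr_ge0 ltW ?tau_gt0. Qed.

Lemma harm_cat i j n : (i <= j <= n)%N -> harm i n = harm i j + harm j n.
Proof. by case/andP=> ij jn; rewrite /harm (big_cat_nat ij jn). Qed.

Lemma harm_le i j n : (i <= j)%N -> harm j n <= harm i n.
Proof.
move=> ij; have [jn|nj] := leqP j n.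
  by rewrite (harm_cat (i := i) (j := j)) ?ij// lerDr harm_ge0.
by rewrite {1}/harm big_geq ?harm_ge0// ltnW.
Qed.

Lemma expR_harm_ge j n : (j <= n)%N -> tau n / tau j <= expR (harm j n).
Proof.
move=> jn; rewrite -(subnKC jn); elim: (n - j)%N => [|k IH].
  by rewrite addn0 harmnn expR0 divff ?tau_neq0.
rewrite addnS harmS ?leq_addr// expRD.
have -> : tau (j + k).+1 / tau j = tau (j + k) / tau j * (1 + (tau (j + k))^-1).
  by rewrite tauS; field; rewrite !tau_neq0.
apply: ler_pM => //; last exact: expR_ge1Dx.
  by rewrite divr_ge0 ?ltW ?tau_gt0.
by rewrite addr_ge0// invr_ge0 ltW ?tau_gt0.
Qed.

(** The comparison opposite to [expR_harm_ge] holds with both ends shifted, by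
    [1 - x <= exp (- x)]; [expR_harm_le] pays for the shift with a constant
    factor. *)
Lemma expR_harmS_le j n : (j <= n)%N -> expR (harm j.+1 n.+1) <= tau n / tau j.
Proof.
move=> jn; rewrite -(subnKC jn); elim: (n - j)%N => [|k IH].
  by rewrite addn0 harmnn expR0 divff ?tau_neq0.
rewrite addnS harmS ?ltnS ?leq_addr// expRD.
have -> : tau (j + k).+1 / tau j = tau (j + k) / tau j * (1 - (tau (j + k).+1)^-1)^-1.
  have -> : 1 - (tau (j + k).+1)^-1 = tau (j + k) / tau (j + k).+1.
    by rewrite tauS; field; rewrite -tauS tau_neq0.
  by field; rewrite !tau_neq0.
have t1 : 0 < 1 - (tau (j + k).+1)^-1.
  have -> : 1 - (tau (j + k).+1)^-1 = tau (j + k) / tau (j + k).+1.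
    by rewrite tauS; field; rewrite -tauS tau_neq0.
  by rewrite divr_gt0 ?tau_gt0.
apply: ler_pM => //; rewrite ?expR_ge0//.
rewrite -[X in expR X]opprK expRN lef_pV2 ?posrE ?expR_gt0//.
exact: expR_ge1Dx.
Qed.

Lemma expR_harm_le j n : (j <= n)%N ->
  expR (harm j n) <= expR kappa^-1 * (tau n / tau j).
Proof.
move=> jn; apply: le_trans (_ : expR ((tau j)^-1 + harm j.+1 n.+1) <= _).
  rewrite ler_expR -harm_recl ?ltnS// (harmS jn) lerDl.
  by rewrite invr_ge0 ltW ?tau_gt0.
rewrite expRD ler_pM ?expR_ge0// ?expR_harmS_le// ler_expR.
by rewrite lef_pV2 ?posrE ?tau_gt0// tau_ge.
Qed.

Lemma tau_cvgy : tau n @[n --> \oo] --> +oo.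
Proof.
apply/cvgryPge => A; have /cvgryPge/(_ A) := @cvgr_idn R.
by apply: filterS => n An; rewrite /tau (le_trans An)// lerDr ltW.
Qed.

Lemma ln_le_harm n : ln (tau n / kappa) <= harm 0 n.
Proof.
rewrite -(@expRK R (harm 0 n)) ler_ln ?posrE ?expR_gt0 ?divr_gt0 ?tau_gt0//.
by have := expR_harm_ge (leq0n n); rewrite {2}/tau addr0.
Qed.

Lemma harm_le_ln n : harm 0 n <= kappa^-1 + ln (tau n / kappa).
Proof.
have e0 : 0 < tau n / kappa by rewrite divr_gt0 ?tau_gt0.
rewrite -ler_expR expRD lnK ?posrE//.
by have := expR_harm_le (leq0n n); rewrite {2}/tau addr0.
Qed.

Lemma ln_tau_cvgy : ln (tau n / kappa) @[n --> \oo] --> +oo.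
Proof.
apply/cvgryPge => A; have /cvgryPge/(_ (expR A * kappa)) := tau_cvgy.
apply: filterS => n; rewrite -ler_pdivlMr// => An.
by rewrite -(expRK A) ler_ln ?posrE ?expR_gt0// (lt_le_trans _ An)// expR_gt0.
Qed.

Lemma harm_cvgy : harm 0 n @[n --> \oo] --> +oo.
Proof.
apply/cvgryPge => A; have /cvgryPge/(_ A) := ln_tau_cvgy.
by apply: filterS => n /le_trans; apply; exact: ln_le_harm.
Qed.

Lemma harm_incr n : harm 0 n <= harm 0 n.+1.
Proof. by rewrite harmS// lerDl invr_ge0 ltW ?tau_gt0. Qed.

Lemma harm_gt0_near : \forall n \near \oo, 0 < harm 0 n.
Proof. by have /cvgryPgt/(_ 0) := harm_cvgy. Qed.

Lemma inv_harm_cvg0 : (harm 0 n)^-1 @[n --> \oo] --> (0 : R).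
Proof.
apply/cvgrPdist_le => e e0; have /cvgryPge/(_ e^-1) := harm_cvgy.
apply: filterS => n en; rewrite sub0r normrN ger0_norm ?invr_ge0 ?harm_ge0//.
by rewrite -[leRHS]invrK lef_pV2// posrE ?invr_gt0// (lt_le_trans _ en)// invr_gt0.
Qed.

(** Powers of the clock are negligible against [tau], because [exp (harm 0 n)]
    is at most of order [tau n]. *)
Lemma pow_harm_tau_cvg0 D : (1 + harm 0 n) ^+ D / tau n @[n --> \oo] --> (0 : R).
Proof.
apply: (@cvg0_norm_le _ _ (fun n => expR 1 * expR kappa^-1 / kappa * D.+1`!%:R * (harm 0 n)^-1)).
  near=> n.
  have h0 : 0 < harm 0 n by near: n; exact: harm_gt0_near.
  have h1 : 0 < 1 + harm 0 n by rewrite addr_gt0.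
  rewrite ger0_norm ?divr_ge0 ?exprn_ge0 ?(ltW h1) ?tau_ge0//.
  rewrite ler_pdivrMr ?tau_gt0//.
  have := @expR_ge1Dxn _ (1 + harm 0 n) D (ltW h1).
  have := expR_harm_le (leq0n n); rewrite /(tau 0) addr0 => Ht He.
  have : (1 + harm 0 n) ^+ D.+1 / D.+1`!%:R <= expR 1 * (expR kappa^-1 * (tau n / kappa)).
    apply: le_trans (_ : expR (1 + harm 0 n) <= _); first by lra.
    by rewrite expRD ler_pM2l ?expR_gt0.
  rewrite ler_pdivrMr ?ltr0n ?fact_gt0// exprS => H.
  rewrite mulrAC ler_pdivlMr//.
  apply: (@le_trans _ _ ((1 + harm 0 n) * (1 + harm 0 n) ^+ D)).
    by rewrite mulrC ler_wpM2r ?exprn_ge0 ?ltW// ltrDr.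
  apply: (le_trans H); rewrite le_eqVlt; apply/orP; left; apply/eqP; ring.
by rewrite -[X in _ --> X](mulr0 (expR 1 * expR kappa^-1 / kappa * D.+1`!%:R)); apply: cvgM; [exact: cvg_cst|exact: inv_harm_cvg0].
Unshelve. all: by end_near. Qed.

Lemma harm_ratio_cvg1 : harm 0 n.+1 / harm 0 n @[n --> \oo] --> (1 : R).
Proof.
have -> : (1 : R) = 1 + kappa^-1 * 0 by rewrite mulr0 addr0.
apply: (@squeeze_cvgr _ _ _ _ (cst 1) (fun n => 1 + kappa^-1 * (harm 0 n)^-1)).
- near=> n.
  have h0 : 0 < harm 0 n by near: n; exact: harm_gt0_near.
  rewrite harmS// mulrDl divff ?gt_eqF//= lerDl lerD2l.
  rewrite mulr_ge0 ?tauV_ge0 ?invr_ge0 ?(ltW h0)//=.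
  by rewrite ler_pM2r ?invr_gt0// lef_pV2 ?posrE ?tau_gt0// tau_ge.
- by rewrite mulr0 addr0; exact: cvg_cst.
- apply: cvgD; first exact: cvg_cst.
  by apply: cvgM; [exact: cvg_cst|exact: inv_harm_cvg0].
Unshelve. all: by end_near. Qed.

(** Summing [u n / tau n] with [u] of order [h ^+ q] is the discrete integral
    of [h ^ q dh]: the power goes up by one and the constant is divided by [q
    + 1]. *)
Lemma stolz_harm (v u : nat -> R) q (c : R) :
  (forall n, v n.+1 = v n + (tau n)^-1 * u n) ->
  u n / harm 0 n ^+ q @[n --> \oo] --> c ->
  v n / harm 0 n ^+ q.+1 @[n --> \oo] --> c / q.+1%:R.
Proof.
move=> vS uc; apply: stolz.
- by move=> n; rewrite lerXn2r ?nnegrE ?harm_ge0 ?harm_incr.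
- apply/cvgryPge => A; have /cvgryPge/(_ (Num.max A 1)) := harm_cvgy.
  apply: filterS => n; rewrite ge_max => /andP[An h1].
  by rewrite (le_trans An)// exprS ler_peMr ?harm_ge0// exprn_ege1.
have rq : \sum_(i < q.+1) (harm 0 n.+1 / harm 0 n) ^+ (q.+1.-1 - i) @[n --> \oo] --> (q.+1%:R : R).
  have -> : (q.+1%:R : R) = \sum_(i < q.+1) 1 ^+ (q.+1.-1 - i).
    under eq_bigr do rewrite expr1n.
    by rewrite sumr_const card_ord.
  apply: cvg_sum_seq => i; apply: (@cvg_comp _ _ _ _ (fun x : R => x ^+ (q.+1.-1 - i)) _ _ _ harm_ratio_cvg1).
  exact: exprn_continuous.
have : u n / harm 0 n ^+ q - c / q.+1%:R * \sum_(i < q.+1) (harm 0 n.+1 / harm 0 n) ^+ (q.+1.-1 - i) @[n --> \oo] --> c - c / q.+1%:R * q.+1%:R.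
  by apply: cvgB => //; apply: cvgM => //; exact: cvg_cst.
rewrite divfK ?pnatr_eq0// subrr => /cvgrPdist_le H e e0.
near=> n.
have h0 : 0 < harm 0 n by near: n; exact: harm_gt0_near.
have Hn : `|0 - (u n / harm 0 n ^+ q - c / q.+1%:R *
    \sum_(i < q.+1) (harm 0 n.+1 / harm 0 n) ^+ (q.+1.-1 - i))| <= e.
  by near: n; exact: H.
have -> : harm 0 n.+1 ^+ q.+1 - harm 0 n ^+ q.+1 = (tau n)^-1 * harm 0 n ^+ q *
    \sum_(i < q.+1) (harm 0 n.+1 / harm 0 n) ^+ (q.+1.-1 - i).
  rewrite subrXX {1}harmS// addrC addKr -mulrA; congr (_ * _).
  rewrite big_distrr/=; apply: eq_bigr => i _.
  have iq : (i <= q)%N by rewrite -ltnS.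
  have -> : harm 0 n ^+ q = harm 0 n ^+ i * harm 0 n ^+ (q - i) by rewrite -exprD subnKC.
  rewrite expr_div_n; field.
  by rewrite expf_neq0// gt_eqF.
have -> : v n.+1 - v n = (tau n)^-1 * u n by rewrite vS addrC addKr.
set s := \sum_(i < q.+1) _.
have s1 : 1 <= s.
  rewrite /s big_ord_recr/= subnn expr0 lerDr sumr_ge0// => i _.
  by rewrite exprn_ge0// divr_ge0 ?harm_ge0.
have -> : (tau n)^-1 * u n - c / q.+1%:R * ((tau n)^-1 * harm 0 n ^+ q * s)
   = (tau n)^-1 * harm 0 n ^+ q * (u n / harm 0 n ^+ q - c / q.+1%:R * s).
  by field; rewrite tau_neq0 expf_neq0 ?gt_eqF// pnatr_eq0.
have t0 : 0 < (tau n)^-1 * harm 0 n ^+ q by rewrite mulr_gt0 ?invr_gt0 ?tau_gt0 ?exprn_gt0.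
rewrite normrM (gtr0_norm t0) mulrCA ler_pM2l//.
apply: (@le_trans _ _ e); last by rewrite ler_peMr// ltW.
by have := Hn; rewrite sub0r normrN.
Unshelve. all: by end_near. Qed.

End harmonic.

(** * Limits and recursions in the complex numbers *)

Section complex_modulus.
Variable R : realType.
Implicit Types (z : R[i]) (x : R).

(** The modulus with values in [R], so that every estimate and every limit
    below is real. *)
Definition cmod z : R := Normc.normc z.

Lemma cmod_sqr z : cmod z ^+ 2 = complex.Re z ^+ 2 + complex.Im z ^+ 2.
Proof. by case: z => a b; rewrite /cmod /= sqr_sqrtr// addr_ge0 ?sqr_ge0. Qed.

Lemma cmod_ge0 z : 0 <= cmod z.
Proof. by case: z => a b; rewrite /cmod /= sqrtr_ge0. Qed.

Lemma cmod0 : cmod 0 = 0. Proof. exact: Normc.normc0. Qed.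

Lemma cmodM z1 z2 : cmod (z1 * z2) = cmod z1 * cmod z2. Proof. exact: Normc.normcM. Qed.

Lemma cmodD z1 z2 : cmod (z1 + z2) <= cmod z1 + cmod z2.
Proof. exact: (@le_normcD R z1 z2). Qed.

Lemma cmodN z : cmod (- z) = cmod z. Proof. exact: (@normcN R z). Qed.

Lemma cmod_real x : cmod (real_complex R x) = `|x|.
Proof. by rewrite /cmod /= expr0n addr0 sqrtr_sqr. Qed.

Lemma cmod_sum (I : Type) (r : seq I) (P : pred I) (F : I -> R[i]) :
  cmod (\sum_(i <- r | P i) F i) <= \sum_(i <- r | P i) cmod (F i).
Proof.
elim/big_ind2 : _ => [|x1 x2 y1 y2 H1 H2|//]; first by rewrite cmod0.
by apply: (le_trans (cmodD _ _)); exact: lerD.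
Qed.

Lemma Re_le_cmod z : `|complex.Re z| <= cmod z.
Proof.
rewrite -[leRHS]ger0_norm ?cmod_ge0// -ler_sqr ?nnegrE// -!normrX.
by rewrite !ger0_norm ?sqr_ge0// cmod_sqr lerDl sqr_ge0.
Qed.

Lemma Im_le_cmod z : `|complex.Im z| <= cmod z.
Proof.
rewrite -[leRHS]ger0_norm ?cmod_ge0// -ler_sqr ?nnegrE// -!normrX.
by rewrite !ger0_norm ?sqr_ge0// cmod_sqr lerDr sqr_ge0.
Qed.

Lemma cmod_le_ReIm z : cmod z <= `|complex.Re z| + `|complex.Im z|.
Proof.
rewrite -ler_sqr ?nnegrE ?cmod_ge0 ?addr_ge0// cmod_sqr sqrrD !real_normK ?num_real//.
by rewrite addrAC lerDl mulrn_wge0// mulr_ge0.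
Qed.

Lemma ReD z1 z2 : complex.Re (z1 + z2) = complex.Re z1 + complex.Re z2.
Proof. by case: z1; case: z2. Qed.
Lemma ImD z1 z2 : complex.Im (z1 + z2) = complex.Im z1 + complex.Im z2.
Proof. by case: z1; case: z2. Qed.
Lemma ReN z : complex.Re (- z) = - complex.Re z. Proof. by case: z. Qed.
Lemma ImN z : complex.Im (- z) = - complex.Im z. Proof. by case: z. Qed.
Lemma ReZ x z : complex.Re (real_complex R x * z) = x * complex.Re z.
Proof. by case: z => a b /=; rewrite mul0r subr0. Qed.
Lemma ImZ x z : complex.Im (real_complex R x * z) = x * complex.Im z.
Proof. by case: z => a b /=; rewrite mul0r addr0. Qed.

(** Exact to first order in the real part: a product of factors [1 + lam / tau
    i] has modulus at most [exp (Re lam * harm)] up to a constant, because the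
    squares of [1 / tau i] are summable. *)
Lemma cmod_1D_le_expR z : cmod (1 + z) <= expR (complex.Re z + cmod z ^+ 2 / 2).
Proof.
apply: (@le_trans _ _ (1 + (complex.Re z + cmod z ^+ 2 / 2))); last exact: expR_ge1Dx.
have p0 : 0 <= 1 + (complex.Re z + cmod z ^+ 2 / 2).
  by rewrite cmod_sqr; nra.
rewrite -ler_sqr ?nnegrE ?cmod_ge0// [leLHS]cmod_sqr.
rewrite (ReD 1 z) (ImD 1 z) /= add0r.
have := cmod_sqr z; set n2 := cmod z ^+ 2 => E.
have := sqr_ge0 (complex.Re z + n2 / 2).
have -> : complex.Im z ^+ 2 = n2 - complex.Re z ^+ 2 by rewrite E addrC addKr.
by lra.
Qed.

Definition cvgC (u : nat -> R[i]) (l : R[i]) : Prop :=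
  cmod (u n - l) @[n --> \oo] --> 0.

Lemma cvgC_Re u l : cvgC u l -> complex.Re (u n) @[n --> \oo] --> complex.Re l.
Proof.
move=> H; apply/cvgrPdist_le => e e0; move/cvgrPdist_le : H => /(_ _ e0).
apply: filterS => n; rewrite sub0r normrN ger0_norm ?cmod_ge0// => H.
rewrite distrC; apply: le_trans H.
by rewrite -ReN -ReD Re_le_cmod.
Qed.

Lemma cvgC_Im u l : cvgC u l -> complex.Im (u n) @[n --> \oo] --> complex.Im l.
Proof.
move=> H; apply/cvgrPdist_le => e e0; move/cvgrPdist_le : H => /(_ _ e0).
apply: filterS => n; rewrite sub0r normrN ger0_norm ?cmod_ge0// => H.
rewrite distrC; apply: le_trans H.
by rewrite -ImN -ImD Im_le_cmod.
Qed.

Lemma cvgC_ReIm u l : complex.Re (u n) @[n --> \oo] --> complex.Re l ->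
  complex.Im (u n) @[n --> \oo] --> complex.Im l -> cvgC u l.
Proof.
move=> Hr Hi; apply: (@cvg0_norm_le _ _ (fun n => `|complex.Re (u n) - complex.Re l| + `|complex.Im (u n) - complex.Im l|)).
  apply: nearW => n; rewrite ger0_norm ?cmod_ge0//.
  by rewrite (le_trans (cmod_le_ReIm _))// ReD ImD ReN ImN.
rewrite -[X in _ --> X]addr0; apply: cvgD.
- rewrite -[X in _ --> X](@normr0 R R); apply: cvg_norm.
  by rewrite -(subrr (complex.Re l)); apply: cvgB => //; exact: cvg_cst.
- rewrite -[X in _ --> X](@normr0 R R); apply: cvg_norm.
  by rewrite -(subrr (complex.Im l)); apply: cvgB => //; exact: cvg_cst.
Qed.

Lemma cvgC_cst l : cvgC (fun=> l) l.
Proof. by rewrite /cvgC; under eq_fun do rewrite subrr cmod0; exact: cvg_cst. Qed.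

Lemma cvgC_eq u v l : (\forall n \near \oo, u n = v n) -> cvgC u l -> cvgC v l.
Proof.
move=> uv; rewrite /cvgC => /cvgrPdist_le ul; apply/cvgrPdist_le => e e0.
near=> n.
have <- : u n = v n by near: n.
by near: n; exact: ul.
Unshelve. all: by end_near. Qed.

Lemma cvgCD u v a b : cvgC u a -> cvgC v b -> cvgC (fun n => u n + v n) (a + b).
Proof.
move=> ua vb; apply: (@cvg0_norm_le _ _ (fun n => cmod (u n - a) + cmod (v n - b))).
  apply: nearW => n; rewrite ger0_norm ?cmod_ge0//.
  by rewrite (le_trans _ (cmodD _ _))// opprD addrACA.
by rewrite -[X in _ --> X]addr0; apply: cvgD.
Qed.

Lemma cvgCZ u a c : cvgC u a -> cvgC (fun n => c * u n) (c * a).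
Proof.
move=> ua; rewrite /cvgC.
have -> : (fun n => cmod (c * u n - c * a)) = (fun n => cmod c * cmod (u n - a)).
  by apply/funext => n; rewrite -mulrBr cmodM.
by rewrite -(mulr0 (cmod c)); apply: cvgM => //; exact: cvg_cst.
Qed.

Lemma cvgC_sum (I : Type) (r : seq I) (f : I -> nat -> R[i]) (l : I -> R[i]) :
  (forall i, cvgC (f i) (l i)) ->
  cvgC (fun n => \sum_(i <- r) f i n) (\sum_(i <- r) l i).
Proof.
move=> fl; elim: r => [|i r IH].
  apply: (@cvgC_eq (fun=> 0)); first by apply: nearW => n; rewrite big_nil.
  by rewrite big_nil; exact: cvgC_cst.
apply: (@cvgC_eq (fun n => f i n + \sum_(i <- r) f i n)).
  by apply: nearW => n; rewrite big_cons.
by rewrite big_cons; exact: cvgCD.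
Qed.

Lemma cvgC0 u : cvgC u 0 <-> cmod (u n) @[n --> \oo] --> 0.
Proof. by rewrite /cvgC; under eq_fun do rewrite subr0. Qed.

Lemma cvgC0_le u (v : nat -> R) : (\forall n \near \oo, cmod (u n) <= v n) ->
  v n @[n --> \oo] --> 0 -> cvgC u 0.
Proof.
move=> uv v0; apply/cvgC0; apply: (@cvg0_norm_le _ _ v) => //.
by apply: filterS uv => n H; rewrite ger0_norm ?cmod_ge0.
Qed.

End complex_modulus.

Section complex_recursions.
Variables (R : realType) (kappa : R).
Hypothesis kappa_gt0 : 0 < kappa.
Local Notation h := (harm kappa 0).
Local Notation tau := (tau kappa).
Local Notation "x %:c" := (real_complex R x) (at level 2).

(** The recursion is linear over [R], so real and imaginary parts are summed
    separately. *)
Lemma stolz_harmC (v u : nat -> R[i]) q c :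
  (forall n, v n.+1 = v n + ((tau n)^-1)%:c * u n) ->
  cvgC (fun n => ((h n ^+ q)^-1)%:c * u n) c ->
  cvgC (fun n => ((h n ^+ q.+1)^-1)%:c * v n) ((q.+1%:R^-1)%:c * c).
Proof.
move=> vS uc; apply: cvgC_ReIm.
- under eq_fun do rewrite ReZ mulrC.
  rewrite ReZ mulrC.
  apply: (@stolz_harm _ _ kappa_gt0 _ (fun n => complex.Re (u n))).
    by move=> n; rewrite vS ReD ReZ.
  by have := cvgC_Re uc; under eq_fun do rewrite ReZ mulrC.
- under eq_fun do rewrite ImZ mulrC.
  rewrite ImZ mulrC.
  apply: (@stolz_harm _ _ kappa_gt0 _ (fun n => complex.Im (u n))).
    by move=> n; rewrite vS ImD ImZ.
  by have := cvgC_Im uc; under eq_fun do rewrite ImZ mulrC.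
Qed.

(** A purely imaginary rate only rotates: [1 + zeta / tau n] has modulus [1 +
    O(1 / tau n ^ 2)], so that [v] grows through its forcing [u] alone. The
    last hypothesis makes the second order term negligible. *)
Lemma rotation_harmC (v u : nat -> R[i]) q zeta : complex.Re zeta = 0 ->
  (forall n, v n.+1 = v n + ((tau n)^-1)%:c * (zeta * v n + u n)) ->
  cvgC (fun n => ((h n ^+ q)^-1)%:c * u n) 0 ->
  cvgC (fun n => ((h n ^+ q)^-1 * (tau n)^-1)%:c * v n) 0 ->
  cvgC (fun n => ((h n ^+ q.+1)^-1)%:c * v n) 0.
Proof.
move=> z0 vS u0 v0.
pose g n := cmod (u n) + cmod zeta ^+ 2 * ((tau n)^-1 * cmod (v n)).
pose w n := cmod (v 0%N) + \sum_(0 <= i < n) (tau i)^-1 * g i.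
have wS n : w n.+1 = w n + (tau n)^-1 * g n by rewrite /w big_nat_recr//= addrA.
have step n : cmod (v n.+1) <= cmod (v n) + (tau n)^-1 * g n.
  have -> : v n.+1 = (1 + ((tau n)^-1)%:c * zeta) * v n + ((tau n)^-1)%:c * u n.
    by rewrite vS; ring.
  rewrite (le_trans (cmodD _ _))// !cmodM cmod_real ger0_norm ?tauV_ge0//.
  rewrite /g mulrDr addrA addrAC lerD2r.
  have H : cmod (1 + ((tau n)^-1)%:c * zeta) <= 1 + ((tau n)^-1 * cmod zeta) ^+ 2.
    rewrite -ler_sqr ?nnegrE ?cmod_ge0 ?addr_ge0 ?sqr_ge0// [leLHS]cmod_sqr.
    rewrite (ReD 1) (ImD 1) ReZ ImZ /= z0 mulr0 addr0 add0r expr1n.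
    have := cmod_sqr zeta; rewrite z0 expr0n add0r => E.
    rewrite exprMn -E -exprMn; set y := (_ * _) ^+ 2.
    have : 0 <= y by exact: sqr_ge0.
    by nra.
  apply: (le_trans (ler_wpM2r (cmod_ge0 _) H)).
  by rewrite le_eqVlt; apply/orP; left; apply/eqP; ring.
have vw n : cmod (v n) <= w n.
  elim: n => [|n IH]; first by rewrite /w big_geq// addr0.
  by rewrite (le_trans (step n))// wS lerD2r.
have gq : g n / h n ^+ q @[n --> \oo] --> (0 : R).
  have -> : (0 : R) = 0 + cmod zeta ^+ 2 * 0 by rewrite mulr0 addr0.
  have -> : (fun n => g n / h n ^+ q) = (fun n => cmod (((h n ^+ q)^-1)%:c * u n) +
      cmod zeta ^+ 2 * cmod (((h n ^+ q)^-1 * (tau n)^-1)%:c * v n)).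
    apply/funext => n; rewrite !cmodM !cmod_real !ger0_norm ?mulr_ge0 ?tauV_ge0 ?invr_ge0 ?exprn_ge0 ?harm_ge0//.
    by rewrite /g; ring.
  apply: cvgD; first exact/cvgC0.
  by apply: cvgM; [exact: cvg_cst|exact/cvgC0].
have := @stolz_harm _ _ kappa_gt0 w g q 0 wS gq; rewrite mul0r => wq.
apply: (cvgC0_le _ wq); apply: nearW => n.
rewrite cmodM cmod_real ger0_norm ?invr_ge0 ?exprn_ge0 ?harm_ge0// mulrC.
by rewrite ler_wpM2r ?invr_ge0 ?exprn_ge0 ?harm_ge0.
Qed.

End complex_recursions.

(** * Products of one-step matrices along Jordan chains *)

Section flow.
Variables (F : fieldType) (s : nat).
Implicit Types (A M : 'M[F]_s) (t : nat -> F) (v : 'rV[F]_s) (w x y : 'cV[F]_s).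

(** For [M = A / m] and [t i = 1 / tau i] this carries the conditional mean of
    the urn from time [j] to time [n]: [E (X n | X j) = X j *m flow M t j n].
    *)
Definition flow M t j n : 'M[F]_s := \prod_(j <= i < n) (1 + t i *: M).

Lemma flownn M t n : flow M t n n = 1%:M.
Proof. by rewrite /flow big_geq. Qed.

Lemma flowS M t j n : (j <= n)%N ->
  flow M t j n.+1 = flow M t j n *m (1%:M + t n *: M).
Proof. by move=> jn; rewrite /flow big_nat_recr. Qed.

Lemma flow_recl M t j n : (j < n)%N ->
  flow M t j n = (1%:M + t j *: M) *m flow M t j.+1 n.
Proof. by move=> jn; rewrite /flow big_ltn. Qed.

(** Second moment form of the increments that one draw causes in the linear
    statistics [x] and [y], when colour [k] has weight [v k]. *)
Definition drawform v A x y : F := \sum_k v 0 k * (A *m x) k 0 * (A *m y) k 0.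

Lemma drawformDl v A x1 x2 y :
  drawform v A (x1 + x2) y = drawform v A x1 y + drawform v A x2 y.
Proof.
rewrite /drawform -big_split/=; apply: eq_bigr => k _.
by rewrite mulmxDr mxE mulrDr mulrDl.
Qed.

Lemma drawformZl v A c x y : drawform v A (c *: x) y = c * drawform v A x y.
Proof.
rewrite /drawform big_distrr/=; apply: eq_bigr => k _.
by rewrite -scalemxAr mxE; ring.
Qed.

Lemma drawformC v A x y : drawform v A x y = drawform v A y x.
Proof. by apply: eq_bigr => k _; ring. Qed.

(** Covariance that [n] draws with the fixed weights [v] accumulate in the
    statistics [x] and [y]: the increment made by draw [j] is transported from
    time [j + 1] to time [n] by the flow. *)
Definition accum v A M t n x y : F :=
  \sum_(0 <= j < n) drawform v A (flow M t j.+1 n *m x) (flow M t j.+1 n *m y).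

Lemma accumC v A M t n x y : accum v A M t n x y = accum v A M t n y x.
Proof. by apply: eq_bigr => j _; rewrite drawformC. Qed.

Lemma accumDl v A M t n x1 x2 y :
  accum v A M t n (x1 + x2) y = accum v A M t n x1 y + accum v A M t n x2 y.
Proof.
rewrite /accum -big_split/=; apply: eq_bigr => j _.
by rewrite mulmxDr drawformDl.
Qed.

Lemma accumZl v A M t n c x y :
  accum v A M t n (c *: x) y = c * accum v A M t n x y.
Proof.
rewrite /accum big_distrr/=; apply: eq_bigr => j _.
by rewrite -scalemxAr drawformZl.
Qed.

Lemma accumDr v A M t n x y1 y2 :
  accum v A M t n x (y1 + y2) = accum v A M t n x y1 + accum v A M t n x y2.
Proof. by rewrite accumC accumDl !(accumC _ _ _ _ _ x). Qed.

Lemma accumZr v A M t n c x y :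
  accum v A M t n x (c *: y) = c * accum v A M t n x y.
Proof. by rewrite accumC accumZl accumC. Qed.

Lemma accum0l v A M t n y : accum v A M t n 0 y = 0.
Proof. by rewrite -(scale0r 0) accumZl mul0r. Qed.

Lemma accum0r v A M t n x : accum v A M t n x 0 = 0.
Proof. by rewrite accumC accum0l. Qed.

Lemma accum_suml v A M t n (I : Type) (r : seq I) (f : I -> 'cV[F]_s) y :
  accum v A M t n (\sum_(i <- r) f i) y = \sum_(i <- r) accum v A M t n (f i) y.
Proof.
elim: r => [|i r IH]; first by rewrite !big_nil accum0l.
by rewrite !big_cons accumDl IH.
Qed.

Lemma accumS v A M t n x y : accum v A M t n.+1 x y =
  accum v A M t n ((1%:M + t n *: M) *m x) ((1%:M + t n *: M) *m y) +
  drawform v A x y.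
Proof.
rewrite /accum big_nat_recr//= flownn !mul1mx; congr (_ + _).
by apply: eq_big_nat => j /andP[_ jn]; rewrite flowS// !mulmxA.
Qed.

End flow.

Section chains.
Variables (R : realType) (s : nat).
Local Notation C := R[i].
Local Notation "x %:c" := (real_complex R x) (at level 2).
Implicit Types (M A : 'M[C]_s) (lam : C) (w : nat -> 'cV[C]_s).

(** The predecessor in a Jordan chain, zero for its first vector. *)
Definition chain_pred w k : 'cV[C]_s := if k is k'.+1 then w k' else 0.

(** A Jordan chain of length [p], stored as a sequence of which the first [p]
    terms are constrained; this keeps lengths out of the types. *)
Definition chain M lam w (p : nat) : Prop :=
  forall k, (k < p)%N -> M *m w k = lam *: w k + chain_pred w k.

Definition cnorm1 (z : 'cV[C]_s) : R := \sum_i cmod (z i 0).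

Lemma cnorm1_ge0 z : 0 <= cnorm1 z.
Proof. by apply: sumr_ge0 => i _; exact: cmod_ge0. Qed.

Lemma cnorm10 : cnorm1 0 = 0.
Proof. by rewrite /cnorm1 big1// => i _; rewrite mxE cmod0. Qed.

Lemma cnorm1D z1 z2 : cnorm1 (z1 + z2) <= cnorm1 z1 + cnorm1 z2.
Proof. by rewrite /cnorm1 -big_split ler_sum// => i _; rewrite mxE cmodD. Qed.

Lemma cnorm1Z c z : cnorm1 (c *: z) = cmod c * cnorm1 z.
Proof. by rewrite /cnorm1 big_distrr/=; apply: eq_bigr => i _; rewrite mxE cmodM. Qed.

Lemma cmod_le_cnorm1 (z : 'cV[C]_s) i : cmod (z i 0) <= cnorm1 z.
Proof. by rewrite /cnorm1 (bigD1 i)//= lerDl sumr_ge0// => j _; exact: cmod_ge0. Qed.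

Lemma cnorm1_mulmx M z : cnorm1 (M *m z) <= (\sum_i \sum_j cmod (M i j)) * cnorm1 z.
Proof.
rewrite /cnorm1 mulr_suml ler_sum// => i _; rewrite mxE.
rewrite (le_trans (cmod_sum _ _ _))// mulr_suml ler_sum// => j _.
by rewrite cmodM ler_wpM2l ?cmod_ge0// cmod_le_cnorm1.
Qed.

Lemma cmod_drawform (v : 'rV[C]_s) A : exists K, 0 <= K /\
  forall x y, cmod (drawform v A x y) <= K * (cnorm1 x * cnorm1 y).
Proof.
pose a := \sum_i \sum_j cmod (A i j); exists ((\sum_k cmod (v 0 k)) * a ^+ 2).
split.
  by rewrite mulr_ge0 ?sqr_ge0// sumr_ge0// => k _; exact: cmod_ge0.
move=> x y; rewrite (le_trans (cmod_sum _ _ _))// -mulrA mulr_suml ler_sum// => k _.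
rewrite !cmodM -mulrA ler_wpM2l ?cmod_ge0//.
have -> : a ^+ 2 * (cnorm1 x * cnorm1 y) = (a * cnorm1 x) * (a * cnorm1 y) by ring.
by apply: ler_pM; rewrite ?cmod_ge0// (le_trans (cmod_le_cnorm1 _ k)) ?cnorm1_mulmx.
Qed.

Section growth.
Variable kappa : R.
Hypothesis kappa_gt0 : 0 < kappa.
Local Notation tau := (tau kappa).
Local Notation harm := (harm kappa).
Let t n : C := ((tau n)^-1)%:c.

(** Comparison with the telescoping sum of [1 / tau i - 1 / tau i.+1]. *)
Lemma sum_invtau_sqr j n : (j <= n)%N ->
  \sum_(j <= i < n) (tau i)^-1 ^+ 2 <= (1 + kappa^-1) * kappa^-1.
Proof.
move=> jn; apply: (@le_trans _ _ ((1 + kappa^-1) * ((tau j)^-1 - (tau n)^-1))); last first.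
  rewrite ler_wpM2l ?addr_ge0 ?invr_ge0 ?(ltW kappa_gt0)//.
  apply: (@le_trans _ _ (tau j)^-1); first by rewrite lerBlDr lerDl tauV_ge0.
  by rewrite lef_pV2 ?posrE ?tau_gt0// tau_ge.
rewrite -(subnKC jn); elim: (n - j)%N => [|k IH].
  by rewrite addn0 big_geq// subrr mulr0.
rewrite addnS big_nat_recr ?leq_addr//=; apply: (le_trans (lerD IH (lexx _))).
rewrite -lerBrDl -mulrBr.
have -> : (tau j)^-1 - (tau (j + k).+1)^-1 - ((tau j)^-1 - (tau (j + k))^-1) =
   (tau (j + k))^-1 * (tau (j + k).+1)^-1.
  by rewrite tauS; field; rewrite -tauS !tau_neq0.
rewrite expr2 mulrCA ler_wpM2l ?tauV_ge0//.
rewrite ler_pdivlMr ?tau_gt0// tauS mulrDr mulVf ?tau_neq0// mulr1 lerD2l.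
by rewrite lef_pV2 ?posrE ?tau_gt0// tau_ge.
Qed.

(** By induction on [n]: each step multiplies the coefficient of [w k] by [1 +
    lam / tau n] and adds [1 / tau n] times the next lower vector of the
    chain, which integrates to one more power of the clock. *)
Lemma chain_bound M lam w p rho : chain M lam w p ->
  complex.Re lam <= rho -> 0 <= rho -> exists K, 0 <= K /\
  forall j n k, (k < p)%N -> (j <= n)%N ->
    cnorm1 (flow M t j n *m w k) <= K * expR (rho * harm j n) * (1 + harm j n) ^+ k.
Proof.
move=> Mw lr r0.
pose N := \sum_(k < p) cnorm1 (w k).
pose q j n := \sum_(j <= i < n) (tau i)^-1 ^+ 2.
pose c := cmod lam ^+ 2 / 2.
have c0 : 0 <= c by rewrite divr_ge0 ?sqr_ge0.
have N0 : 0 <= N by apply: sumr_ge0 => k _; exact: cnorm1_ge0.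
exists (N * expR (c * ((1 + kappa^-1) * kappa^-1))); split.
  by rewrite mulr_ge0 ?expR_ge0.
move=> j n k kp jn.
suff : cnorm1 (flow M t j n *m w k) <=
    N * expR (rho * harm j n + c * q j n) * (1 + harm j n) ^+ k.
  move=> /le_trans; apply; rewrite ler_wpM2r ?exprn_ge0 ?addr_ge0 ?harm_ge0//.
  rewrite expRD -[leRHS]mulrA ler_wpM2l// [leRHS]mulrC ler_wpM2l ?expR_ge0//.
  by rewrite ler_expR ler_wpM2l// sum_invtau_sqr.
rewrite -(subnKC jn); elim: (n - j)%N k kp => [|m IH] k kp.
  rewrite addn0 flownn mul1mx harmnn /q big_geq// !mulr0 addr0 expR0 addr0 expr1n !mulr1.
  rewrite /N (bigD1 (Ordinal kp))//= lerDl sumr_ge0// => i _; exact: cnorm1_ge0.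
rewrite addnS; set n' := (j + m)%N; have jn' : (j <= n')%N by rewrite leq_addr.
rewrite flowS// -mulmxA mulmxDl mul1mx -scalemxAl Mw//.
have -> : w k + t n' *: (lam *: w k + chain_pred w k) =
    (1 + t n' * lam) *: w k + t n' *: chain_pred w k.
  by rewrite scalerDr scalerDl scale1r scalerA addrA.
rewrite mulmxDr -!scalemxAr.
set E := expR (rho * harm j n' + c * q j n').
set g := expR (rho * (tau n')^-1 + c * (tau n')^-1 ^+ 2).
have g1 : 1 <= g.
  rewrite -expR0 ler_expR addr_ge0// mulr_ge0 ?tauV_ge0//.
  by rewrite exprn_ge0 ?tauV_ge0.
have -> : rho * harm j n'.+1 + c * q j n'.+1 = (rho * harm j n' + c * q j n') +
    (rho * (tau n')^-1 + c * (tau n')^-1 ^+ 2).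
  by rewrite harmS// /q big_nat_recr//=; ring.
rewrite expRD -/E -/g.
have E0 : 0 <= E by rewrite expR_ge0.
have g0 : 0 <= g by rewrite expR_ge0.
have h0 : 0 <= 1 + harm j n' by rewrite addr_ge0 ?harm_ge0.
have lamg : cmod (1 + t n' * lam) <= g.
  apply: (le_trans (cmod_1D_le_expR _)); rewrite ler_expR /t ReZ cmodM cmod_real.
  rewrite ger0_norm ?tauV_ge0// mulrC exprMn /c -mulrA.
  apply: lerD; first by rewrite ler_wpM2r ?tauV_ge0.
  by rewrite le_eqVlt; apply/orP; left; apply/eqP; ring.
apply: (@le_trans _ _ (g * (N * E * (1 + harm j n') ^+ k) +
   (tau n')^-1 * cnorm1 (flow M t j n' *m chain_pred w k))).
  rewrite (le_trans (cnorm1D _ _))// !cnorm1Z.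
  rewrite {2}/t cmod_real (ger0_norm (tauV_ge0 _ _))//.
  by rewrite lerD2r ler_pM ?cmod_ge0 ?cnorm1_ge0// IH.
have -> : N * (E * g) * (1 + harm j n'.+1) ^+ k = g * (N * E * (1 + harm j n'.+1) ^+ k) by ring.
rewrite harmS// addrA; case: k kp => [|k] kp /=.
  by rewrite mulmx0 cnorm10 mulr0 addr0 !expr0.
have kp' : (k < p)%N by exact: ltnW.
apply: (@le_trans _ _ (g * (N * E * (1 + harm j n') ^+ k.+1) +
   (tau n')^-1 * (g * (N * E * (1 + harm j n') ^+ k)))).
  rewrite lerD2l ler_wpM2l ?tauV_ge0// (le_trans (IH _ kp'))//.
  by rewrite ler_peMl// mulr_ge0 ?exprn_ge0 ?mulr_ge0.
have -> : g * (N * E * (1 + harm j n') ^+ k.+1) +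
   (tau n')^-1 * (g * (N * E * (1 + harm j n') ^+ k)) =
   g * (N * E * ((1 + harm j n' + (tau n')^-1) * (1 + harm j n') ^+ k)).
  by rewrite exprS; ring.
rewrite ler_wpM2l// ler_wpM2l ?mulr_ge0// exprS ler_wpM2l ?addr_ge0 ?tauV_ge0 ?harm_ge0//.
by rewrite lerXn2r ?nnegrE ?addr_ge0 ?tauV_ge0 ?harm_ge0// lerDl tauV_ge0.
Qed.

Lemma poly_le_expR (c : R) D : 0 < c -> exists K, 0 <= K /\
  forall x, 0 <= x -> (1 + x) ^+ D <= K * expR (c * x).
Proof.
move=> c0; exists (expR c * (D.+1`!%:R / c ^+ D.+1)); split.
  by rewrite mulr_ge0 ?expR_ge0// divr_ge0 ?exprn_ge0// ltW.
move=> x x0; have x1 : 0 <= 1 + x by rewrite addr_ge0.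
apply: (@le_trans _ _ ((1 + x) ^+ D.+1)).
  by rewrite exprS ler_peMl ?exprn_ge0// lerDl.
have := @expR_ge1Dxn _ (c * (1 + x)) D (mulr_ge0 (ltW c0) x1).
move=> H.
have {}H : (c * (1 + x)) ^+ D.+1 <= D.+1`!%:R * expR (c * (1 + x)).
  rewrite [leRHS]mulrC -ler_pdivrMr ?ltr0n ?fact_gt0//.
  by apply: le_trans H; rewrite lerDr.
have -> : expR c * (D.+1`!%:R / c ^+ D.+1) * expR (c * x) =
   D.+1`!%:R * expR (c * (1 + x)) / c ^+ D.+1.
  by rewrite mulrDr mulr1 expRD; ring.
by rewrite ler_pdivlMr ?exprn_gt0// [leLHS]mulrC -exprMn.
Qed.

(** Strictly below the critical real part [1 / 2] there is exponential room in
    the clock, which absorbs all powers of it. *)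
Lemma chain_bound_sub M lam w p q : chain M lam w p ->
  complex.Re lam < 1 / 2 -> exists K, 0 <= K /\
  forall j n k, (k < p)%N -> (j <= n)%N ->
    cnorm1 (flow M t j n *m w k) * (1 + harm j n) ^+ q <= K * expR (harm j n / 2).
Proof.
move=> Mw l12; pose rho := Num.max (complex.Re lam) 0.
have r12 : rho < 1 / 2 by rewrite /rho gt_max l12 divr_gt0.
have [||K [K0 HK]] := @chain_bound M lam w p rho Mw.
- by rewrite /rho le_max lexx.
- by rewrite /rho le_max lexx orbT.
have c0 : 0 < 1 / 2 - rho by rewrite subr_gt0.
have [K2 [K20 HK2]] := poly_le_expR (p + q) c0.
exists (K * K2); split; first by rewrite mulr_ge0.
move=> j n k kp jn.
have h0 : 1 <= 1 + harm j n by rewrite lerDl harm_ge0.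
have h0' : 0 <= 1 + harm j n by rewrite (le_trans _ h0).
apply: (@le_trans _ _ (K * expR (rho * harm j n) * (1 + harm j n) ^+ (p + q))).
  rewrite exprD mulrA ler_wpM2r ?exprn_ge0// (le_trans (HK _ _ _ kp jn))//.
  by rewrite ler_wpM2l ?mulr_ge0 ?expR_ge0// ler_weXn2l// ltnW.
rewrite -!mulrA ler_wpM2l//.
apply: (le_trans (ler_wpM2l (expR_ge0 _) (HK2 _ (harm_ge0 kappa_gt0 j n)))).
rewrite mulrCA -expRD ler_wpM2l// ler_expR.
by rewrite le_eqVlt; apply/orP; left; apply/eqP; field.
Qed.

End growth.
End chains.

(** * Accumulated variance of a pair of Jordan chains *)

(** The recursion of [naccumS] as an identity between field elements: [T]
    stands for [tau n], and [z], [z1], [z2], [z3] for the normalised forms at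
    the four pairs of chain vectors. *)
Lemma naccum_step_identity (F : fieldType) (T lam mu z z1 z2 z3 g : F) :
  T != 0 -> T + 1 != 0 ->
  (T + 1)^-1 * ((1 + T^-1 * lam) * ((1 + T^-1 * mu) * (T * z)) +
     (1 + T^-1 * lam) * (T^-1 * (T * z1)) +
     (T^-1 * ((1 + T^-1 * mu) * (T * z2)) + T^-1 * (T^-1 * (T * z3))) + g) =
  z + T^-1 * ((lam + mu - 1) * z + (z1 + z2 + g + (T + 1)^-1 *
     (lam * mu * z + lam * z1 + mu * z2 + z3 -
      ((lam + mu - 1) * z + z1 + z2 + g)))).
Proof. by move=> T0 T1; field; rewrite T1. Qed.

Lemma mulr_sum4 (F : comPzRingType) (t c1 c2 c3 c4 f1 f2 f3 f4 : F) :
  c1 * (t * f1) + c2 * (t * f2) + c3 * (t * f3) + c4 * (t * f4) =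
  t * (c1 * f1 + c2 * f2 + c3 * f3 + c4 * f4).
Proof. by ring. Qed.

Lemma naccum_err_identity (F : comPzRingType) (lam mu z z1 z2 z3 g : F) :
  lam * mu * z + lam * z1 + mu * z2 + z3 - ((lam + mu - 1) * z + z1 + z2 + g) =
  (lam * mu - (lam + mu - 1)) * z + (lam - 1) * z1 + (mu - 1) * z2 + 1 * z3 - g.
Proof. by ring. Qed.

Lemma rotation_shift_identity (F : fieldType) (z t zeta a b g e : F) : zeta != 0 ->
  z + t * (zeta * z + (a + b + g + e)) + g / zeta =
  z + g / zeta + t * (zeta * (z + g / zeta) + (a + b + e)).
Proof. by move=> z0; field. Qed.

Section pairs.
Variables (R : realType) (s : nat).
Local Notation C := R[i].
Local Notation "x %:c" := (real_complex R x) (at level 2).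
Variables (v : 'rV[C]_s) (A M : 'M[C]_s).
Implicit Types (lam mu : C) (w u : nat -> 'cV[C]_s).

Definition ctime (kappa : R) (n : nat) : C := ((tau kappa n)^-1)%:c.

(** Divided by [tau n], the accumulated form of two critical chains neither
    grows nor decays exponentially in the clock, since [1 / 2 + 1 / 2 - 1 =
    0]. *)
Definition naccum (kappa : R) n x y : C :=
  ctime kappa n * accum v A M (ctime kappa) n x y.

Section fixed_kappa.
Variable kappa : R.
Hypothesis kappa_gt0 : 0 < kappa.
Local Notation tau := (tau kappa).
Local Notation harm := (harm kappa).
Local Notation h := (harm 0).
Local Notation t := (ctime kappa).
Local Notation Z := (naccum kappa).

Lemma real_complexV (x : R) : (x^-1)%:c = (x%:c)^-1.
Proof. exact: (fmorphV (real_complex R)). Qed.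

Lemma ctime_neq0 n : (tau n)%:c != 0 :> C.
Proof. by rewrite (inj_eq (@complexI R)) tau_neq0. Qed.

Lemma naccum0l n y : Z n 0 y = 0. Proof. by rewrite /naccum accum0l mulr0. Qed.
Lemma naccum0r n x : Z n x 0 = 0. Proof. by rewrite /naccum accum0r mulr0. Qed.
Lemma naccumC n x y : Z n x y = Z n y x. Proof. by rewrite /naccum accumC. Qed.

(** What the exact recursion of [naccum] leaves beyond the first order in the
    step size; it is [1 / tau n.+1] times a combination of values of [naccum].
    *)
Definition naccum_err lam mu n x y x1 y1 : C := t n.+1 *
  (lam * mu * Z n x y + lam * Z n x y1 + mu * Z n x1 y + Z n x1 y1 -
   ((lam + mu - 1) * Z n x y + Z n x y1 + Z n x1 y + drawform v A x y)).

(** The exact recursion along two Jordan chains. Its rate is [lam + mu - 1]: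
    zero when [lam] and [mu] are critical and conjugate, purely imaginary when
    they are any two critical eigenvalues. *)
Lemma naccumS lam mu n (x y x1 y1 : 'cV[C]_s) :
  M *m x = lam *: x + x1 -> M *m y = mu *: y + y1 ->
  Z n.+1 x y = Z n x y + t n * ((lam + mu - 1) * Z n x y +
    (Z n x y1 + Z n x1 y + drawform v A x y + naccum_err lam mu n x y x1 y1)).
Proof.
move=> Mx My.
have ex (lam' : C) (z z1 : 'cV[C]_s) : M *m z = lam' *: z + z1 ->
    (1%:M + t n *: M) *m z = (1 + t n * lam') *: z + t n *: z1.
  by move=> Mz; rewrite mulmxDl mul1mx -scalemxAl Mz scalerDr scalerA addrA scalerDl scale1r.
have acE x' y' : accum v A M t n x' y' = (tau n)%:c * Z n x' y'.
  by rewrite /naccum /ctime mulrA real_complexV mulfV ?ctime_neq0// mul1r.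
rewrite [LHS]/naccum accumS (ex _ _ _ Mx) (ex _ _ _ My).
rewrite !accumDl !accumDr !accumZl !accumZr !acE /naccum_err.
rewrite /ctime tauS !real_complexV.
have -> : (tau n + 1)%:c = (tau n)%:c + 1 by rewrite (rmorphD (real_complex R)) rmorph1.
apply: naccum_step_identity; first exact: ctime_neq0.
by rewrite -(rmorph1 (real_complex R)) -rmorphD -tauS ctime_neq0.
Qed.

Lemma cmod_naccum_le x y (K : R) (f : nat -> nat -> R) n :
  (forall j, (j < n)%N ->
    cnorm1 (flow M t j.+1 n *m x) * cnorm1 (flow M t j.+1 n *m y) <= f j.+1 n) ->
  (forall x y, cmod (drawform v A x y) <= K * (cnorm1 x * cnorm1 y)) -> 0 <= K ->
  cmod (Z n x y) <= K * ((tau n)^-1 * \sum_(1 <= i < n.+1) f i n).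
Proof.
move=> Hf HK K0; rewrite /naccum cmodM /ctime cmod_real ger0_norm ?tauV_ge0// mulrCA.
rewrite ler_wpM2l ?tauV_ge0// (le_trans (cmod_sum _ _ _))//.
rewrite big_distrr/= big_add1/= big_nat_cond [leRHS]big_nat_cond ler_sum// => j.
rewrite andbT => /andP[_ jn].
by rewrite (le_trans (HK _ _))// ler_wpM2l// Hf.
Qed.

(** A priori bound of the right order: the two flows contribute [exp (harm j
    n)], which is of order [tau n / tau j], and powers of the clock; the sum
    of [1 / tau j] gives the extra power. *)
Lemma naccum_bound lam mu w u p q : chain M lam w p -> chain M mu u q ->
  complex.Re lam = 1 / 2 -> complex.Re mu = 1 / 2 ->
  exists K, 0 <= K /\ forall n k l, (k < p)%N -> (l < q)%N ->
    cmod (Z n (w k) (u l)) <= K * (1 + h n) ^+ (k + l).+1.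
Proof.
move=> cw cu lamE muE.
have h12 : 0 <= 1 / 2 :> R by rewrite divr_ge0.
have [||K1 [K10 H1]] := @chain_bound R s kappa kappa_gt0 M lam w p (1 / 2) cw.
  by rewrite lamE. by [].
have [||K2 [K20 H2]] := @chain_bound R s kappa kappa_gt0 M mu u q (1 / 2) cu.
  by rewrite muE. by [].
have [K [K0 HK]] := cmod_drawform v A.
exists (K * (K1 * K2 * expR kappa^-1)); split; first by rewrite !mulr_ge0 ?expR_ge0.
move=> n k l kp lq.
pose f j n := K1 * K2 * (expR kappa^-1 * (tau n / tau j)) * (1 + h n) ^+ (k + l).
apply: (@le_trans _ _ (K * ((tau n)^-1 * \sum_(1 <= i < n.+1) f i n))).
  apply: cmod_naccum_le => // j jn.
  apply: (@le_trans _ _ ((K1 * expR (1 / 2 * harm j.+1 n) * (1 + harm j.+1 n) ^+ k) *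
       (K2 * expR (1 / 2 * harm j.+1 n) * (1 + harm j.+1 n) ^+ l))).
    by rewrite ler_pM ?cnorm1_ge0 ?H1 ?H2.
  rewrite (_ : _ * _ = K1 * K2 * expR (harm j.+1 n) * (1 + harm j.+1 n) ^+ (k + l)); last first.
    have -> : expR (harm j.+1 n) = expR (1 / 2 * harm j.+1 n) * expR (1 / 2 * harm j.+1 n).
      by rewrite -expRD; congr expR; field.
    by rewrite exprD; ring.
  have hh : 0 <= 1 + harm j.+1 n by rewrite addr_ge0 ?harm_ge0.
  apply: ler_pM; rewrite ?mulr_ge0 ?expR_ge0 ?exprn_ge0//.
    by rewrite ler_wpM2l ?mulr_ge0// expR_harm_le.
  by rewrite lerXn2r ?nnegrE ?addr_ge0 ?harm_ge0// lerD2l harm_le.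
rewrite -mulrA ler_wpM2l//.
have -> : \sum_(1 <= i < n.+1) f i n =
   K1 * K2 * expR kappa^-1 * (1 + h n) ^+ (k + l) * tau n * \sum_(1 <= i < n.+1) (tau i)^-1.
  by rewrite big_distrr/=; apply: eq_bigr => i _; rewrite /f; ring.
rewrite mulrA [(tau n)^-1 * _]mulrC mulfK ?tau_neq0//.
rewrite exprSr !mulrA ler_wpM2l//.
  by rewrite !mulr_ge0 ?expR_ge0 ?exprn_ge0 ?addr_ge0 ?harm_ge0.
apply: (@le_trans _ _ (h n)); last by rewrite lerDr.
rewrite big_add1/= /harm big_nat_cond [leRHS]big_nat_cond ler_sum// => i _.
by rewrite lef_pV2 ?posrE ?tau_gt0// ler_tau.
Qed.

(** If one of the two chains is strictly subcritical, its spare decay makes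
    the sum converge: the terms are dominated by increments of [1 / (1 + harm
    i n)]. *)
Lemma naccum_bound_sub lam mu w u p q : chain M lam w p -> chain M mu u q ->
  complex.Re lam < 1 / 2 -> complex.Re mu <= 1 / 2 ->
  exists K, 0 <= K /\ forall n k l, (k < p)%N -> (l < q)%N ->
    cmod (Z n (w k) (u l)) <= K.
Proof.
move=> cw cu lamE muE.
have h12 : 0 <= 1 / 2 :> R by rewrite divr_ge0.
have [||K2 [K20 H2]] := @chain_bound R s kappa kappa_gt0 M mu u q (1 / 2) cu.
  by []. by [].
have [|K1 [K10 H1]] := @chain_bound_sub R s kappa kappa_gt0 M lam w p (q + 2)%N cw.
  by [].
have [K [K0 HK]] := cmod_drawform v A.
exists (K * (K1 * K2 * expR kappa^-1 * (1 + kappa^-1))); split.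
  by rewrite !mulr_ge0 ?expR_ge0 ?addr_ge0 ?invr_ge0 ?(ltW kappa_gt0).
move=> n k l kp lq.
pose f j n := K1 * K2 * (expR kappa^-1 * (tau n / tau j)) / (1 + harm j n) ^+ 2.
apply: (@le_trans _ _ (K * ((tau n)^-1 * \sum_(1 <= i < n.+1) f i n))).
  apply: cmod_naccum_le => // j jn.
  have hh : 1 <= 1 + harm j.+1 n by rewrite lerDl harm_ge0.
  have hh0 : 0 < 1 + harm j.+1 n by rewrite (lt_le_trans _ hh).
  have h2 : cnorm1 (flow M t j.+1 n *m u l) <= K2 * expR (1 / 2 * harm j.+1 n) * (1 + harm j.+1 n) ^+ q.
    rewrite (le_trans (H2 _ _ _ lq jn))// ler_wpM2l ?mulr_ge0 ?expR_ge0//.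
    by rewrite ler_weXn2l// ltnW.
  have h1 := H1 _ _ _ kp jn.
  rewrite /f ler_pdivlMr ?exprn_gt0//.
  apply: (@le_trans _ _ ((cnorm1 (flow M t j.+1 n *m w k) * (1 + harm j.+1 n) ^+ (q + 2)) *
     (K2 * expR (1 / 2 * harm j.+1 n)))).
    set a := cnorm1 _; set b := cnorm1 _ in h2 *.
    set e := K2 * _ in h2 *; set c := 1 + harm _ _ in hh hh0 h2 *.
    have -> : a * b * c ^+ 2 = (a * c ^+ 2) * b by rewrite mulrAC.
    have -> : a * c ^+ (q + 2) * e = (a * c ^+ 2) * (e * c ^+ q).
      by rewrite exprD; set cq := c ^+ q; ring.
    by rewrite ler_wpM2l ?mulr_ge0 ?cnorm1_ge0 ?exprn_ge0 ?(ltW hh0).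
  apply: (@le_trans _ _ (K1 * expR (harm j.+1 n / 2) * (K2 * expR (1 / 2 * harm j.+1 n)))).
    by rewrite ler_wpM2r ?mulr_ge0 ?expR_ge0.
  rewrite (_ : _ * _ = K1 * K2 * expR (harm j.+1 n)); last first.
    have -> : expR (harm j.+1 n) = expR (harm j.+1 n / 2) * expR (1 / 2 * harm j.+1 n).
      by rewrite -expRD; congr expR; field.
    by ring.
  by rewrite ler_wpM2l ?mulr_ge0// expR_harm_le.
rewrite ler_wpM2l//.
have -> : \sum_(1 <= i < n.+1) f i n =
   K1 * K2 * expR kappa^-1 * tau n * \sum_(1 <= i < n.+1) (tau i)^-1 / (1 + harm i n) ^+ 2.
  by rewrite big_distrr/=; apply: eq_bigr => i _; rewrite /f; ring.
rewrite mulrA [(tau n)^-1 * _]mulrC mulfK ?tau_neq0// ler_wpM2l ?mulr_ge0 ?expR_ge0//.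
have [->|n0] := posnP n.
  by rewrite big_geq// addr_ge0 ?invr_ge0 ?(ltW kappa_gt0).
rewrite big_nat_recr//= lerD//; last first.
  by rewrite harmnn addr0 expr1n divr1 lef_pV2 ?posrE ?tau_gt0// tau_ge.
apply: (@le_trans _ _ (\sum_(1 <= i < n) ((1 + harm i.+1 n)^-1 - (1 + harm i n)^-1))).
  rewrite big_nat_cond [leRHS]big_nat_cond ler_sum// => i /andP[/andP[_ iN] _].
  have a0 : 0 < 1 + harm i n by rewrite ltr_pwDl ?harm_ge0.
  have b0 : 0 < 1 + harm i.+1 n by rewrite ltr_pwDl ?harm_ge0.
  have -> : (1 + harm i.+1 n)^-1 - (1 + harm i n)^-1 =
      (tau i)^-1 * (((1 + harm i n))^-1 * (1 + harm i.+1 n)^-1).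
    have -> : (tau i)^-1 = (1 + harm i n) - (1 + harm i.+1 n) by rewrite (harm_recl _ iN); ring.
    by field; rewrite !gt_eqF.
  rewrite ler_wpM2l ?tauV_ge0// expr2 invfM ler_wpM2l ?invr_ge0 ?(ltW a0)//.
  by rewrite lef_pV2 ?posrE// lerD2l harm_le.
rewrite telescope_sumr// harmnn addr0 invr1 lerBlDr lerDl invr_ge0.
by rewrite addr_ge0 ?harm_ge0.
Qed.

Lemma harm_ge1_near : \forall n \near \oo, 1 <= h n.
Proof. by have /cvgryPge/(_ 1) := harm_cvgy kappa_gt0. Qed.

Lemma cvgC0_div_harm q (f : nat -> C) : cvgC f 0 ->
  cvgC (fun n => ((h n ^+ q)^-1)%:c * f n) 0.
Proof.
move=> /cvgC0 f0; apply: (cvgC0_le _ f0); apply: filterS harm_ge1_near => n h1.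
rewrite cmodM cmod_real ger0_norm ?invr_ge0 ?exprn_ge0 ?harm_ge0//.
by rewrite ler_piMl ?cmod_ge0// invf_le1 ?exprn_ege1// exprn_gt0// (lt_le_trans _ h1).
Qed.

(** The constant forcing is visible at the power zero of the clock only. *)
Lemma cvgC_cst_div_harm q (a : C) :
  cvgC (fun n => ((h n ^+ q)^-1)%:c * a) (if q == 0%N then a else 0).
Proof.
case: q => [|q] /=.
  apply: (cvgC_eq _ (cvgC_cst a)); apply: nearW => n.
  by rewrite expr0 invr1 rmorph1 mul1r.
have : cvgC (fun n => a * (((h n)^-1)%:c)) (a * 0).
  apply: cvgCZ; apply: (cvgC0_le _ (inv_harm_cvg0 kappa_gt0)); apply: nearW => n.
  by rewrite cmod_real ger0_norm ?invr_ge0 ?harm_ge0.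
rewrite mulr0 => /(@cvgC0_div_harm q); apply: cvgC_eq; apply: nearW => n.
by rewrite exprSr invfM rmorphM/= -mulrA; congr (_ * _); rewrite mulrC.
Qed.

Lemma cvgC0_tau (f : nat -> C) (K : R) D :
  (forall n, cmod (f n) <= K * (1 + h n) ^+ D) -> cvgC (fun n => t n * f n) 0.
Proof.
move=> Hf; apply: (@cvgC0_le _ _ (fun n => K * ((1 + h n) ^+ D / tau n))).
  apply: nearW => n; rewrite cmodM cmod_real ger0_norm ?tauV_ge0// mulrC mulrA.
  by rewrite ler_wpM2r ?tauV_ge0.
rewrite -[X in _ --> X](mulr0 K); apply: cvgM; first exact: cvg_cst.
exact: pow_harm_tau_cvg0.
Qed.

(** By the a priori bound, [naccum] is a power of the clock at most, which is
    negligible against [tau]. *)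
Lemma naccum_err_cvg0 lam mu w u p q k l : chain M lam w p -> chain M mu u q ->
  complex.Re lam = 1 / 2 -> complex.Re mu = 1 / 2 -> (k < p)%N -> (l < q)%N ->
  cvgC (fun n => t n * Z n (w k) (u l)) 0 /\
  cvgC (fun n => naccum_err lam mu n (w k) (u l) (chain_pred w k) (chain_pred u l)) 0.
Proof.
move=> cw cu lamE muE kp lq.
have [K [K0 HK]] := naccum_bound cw cu lamE muE.
pose D := (k + l).+1.
have HD n i : (i <= D)%N -> K * (1 + h n) ^+ i <= K * (1 + h n) ^+ D.
  by move=> iD; rewrite ler_wpM2l// ler_weXn2l// lerDl harm_ge0.
have KD n : 0 <= K * (1 + h n) ^+ D by rewrite mulr_ge0 ?exprn_ge0 ?addr_ge0 ?harm_ge0.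
have b0 n : cmod (Z n (w k) (u l)) <= K * (1 + h n) ^+ D by exact: HK.
have b1 n : cmod (Z n (w k) (chain_pred u l)) <= K * (1 + h n) ^+ D.
  case: l @D lq HD KD {b0} => [|l] D lq HD KD /=; first by rewrite naccum0r cmod0.
  by rewrite (le_trans (HK _ _ _ kp (ltnW lq)))// HD// /D addnS.
have b2 n : cmod (Z n (chain_pred w k) (u l)) <= K * (1 + h n) ^+ D.
  case: k @D kp HD KD {b0 b1} => [|k] D kp HD KD /=; first by rewrite naccum0l cmod0.
  by rewrite (le_trans (HK _ _ _ (ltnW kp) lq))// HD// /D addSn.
have b3 n : cmod (Z n (chain_pred w k) (chain_pred u l)) <= K * (1 + h n) ^+ D.
  case: k @D kp HD KD {b0 b1 b2} => [|k] D kp HD KD /=; first by rewrite naccum0l cmod0.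
  case: l @D lq HD KD => [|l] D lq HD KD /=; first by rewrite naccum0r cmod0.
  by rewrite (le_trans (HK _ _ _ (ltnW kp) (ltnW lq)))// HD// /D addSn addnS ltnW.
have E (c1 c2 c3 c4 : C) (f1 f2 f3 f4 : nat -> C) :
  (forall n, cmod (f1 n) <= K * (1 + h n) ^+ D) ->
  (forall n, cmod (f2 n) <= K * (1 + h n) ^+ D) ->
  (forall n, cmod (f3 n) <= K * (1 + h n) ^+ D) ->
  (forall n, cmod (f4 n) <= K * (1 + h n) ^+ D) ->
  cvgC (fun n => t n * (c1 * f1 n + c2 * f2 n + c3 * f3 n + c4 * f4 n)) 0.
  move=> H1 H2 H3 H4.
  have Z0 c f : (forall n, cmod (f n) <= K * (1 + h n) ^+ D) ->
      cvgC (fun n => c * (t n * f n)) 0.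
    by move=> Hf; rewrite -(mulr0 c); apply: cvgCZ; exact: (cvgC0_tau Hf).
  have := cvgCD (cvgCD (cvgCD (Z0 c1 _ H1) (Z0 c2 _ H2)) (Z0 c3 _ H3)) (Z0 c4 _ H4).
  by rewrite !addr0; apply: cvgC_eq; apply: nearW => n; exact: mulr_sum4.
split; first exact: (cvgC0_tau b0).
have e1 := @E (lam * mu - (lam + mu - 1)) (lam - 1) (mu - 1) 1 _ _ _ _ b0 b1 b2 b3.
have e2 : cvgC (fun n => t n * (- drawform v A (w k) (u l))) 0.
  apply: (@cvgC0_tau _ (cmod (drawform v A (w k) (u l))) 0%N) => n.
  by rewrite cmodN expr0 mulr1.
have e3 : cvgC (fun n => t n * ((lam * mu - (lam + mu - 1)) * Z n (w k) (u l) +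
    (lam - 1) * Z n (w k) (chain_pred u l) + (mu - 1) * Z n (chain_pred w k) (u l) +
    1 * Z n (chain_pred w k) (chain_pred u l)) + t n * (- drawform v A (w k) (u l))) 0.
  by have := cvgCD e1 e2; rewrite addr0.
move/cvgC0 : e3 => e3.
apply: (@cvgC0_le _ _ (fun n => cmod (t n * ((lam * mu - (lam + mu - 1)) * Z n (w k) (u l) +
    (lam - 1) * Z n (w k) (chain_pred u l) + (mu - 1) * Z n (chain_pred w k) (u l) +
    1 * Z n (chain_pred w k) (chain_pred u l)) + t n * (- drawform v A (w k) (u l))))) => //.
apply: nearW => n.
set X := (X in _ <= cmod X).
have -> : naccum_err lam mu n (w k) (u l) (chain_pred w k) (chain_pred u l) =
    t n.+1 * ((tau n)%:c * X).
  rewrite /naccum_err /X -mulrDr [(tau n)%:c * _]mulrA /ctime -rmorphM/= mulfV ?tau_neq0//.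
  by rewrite (_ : 1%:c = 1)// mul1r naccum_err_identity.
rewrite mulrA [leLHS]cmodM -[leRHS]mul1r ler_wpM2r ?cmod_ge0//.
rewrite /ctime cmodM !cmod_real !ger0_norm ?tauV_ge0 ?tau_ge0//.
by rewrite mulrC ler_pdivrMr ?tau_gt0// mul1r ler_tau.
Qed.

End fixed_kappa.

(** Quantified over [kappa]: the limit must not depend on the initial
    composition of the urn. *)
Definition naccum_limit (q : nat) x y (sigma : C) : Prop := forall kappa, 0 < kappa ->
  cvgC (fun n => ((harm kappa 0 n ^+ q)^-1)%:c * naccum kappa n x y) sigma.

(** Induction on [k + l]. When [lam + mu = 1], the two lower pairs enter
    through Stolz-Cesaro, and each step up a chain gains one power of the
    clock. Otherwise the rotation of rate [lam + mu - 1] averages everything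
    out; there the constant forcing [G] is first removed by the shift [G /
    (lam + mu - 1)]. *)
Lemma naccum_critical_limit lam mu w u p q : chain M lam w p -> chain M mu u q ->
  complex.Re lam = 1 / 2 -> complex.Re mu = 1 / 2 ->
  forall k l, (k < p)%N -> (l < q)%N -> exists sigma,
    (lam + mu - 1 != 0 -> sigma = 0) /\ naccum_limit (k + l).+1 (w k) (u l) sigma.
Proof.
move=> cw cu lamE muE k l; have [N] := ubnP (k + l)%N.
elim: N k l => // N IH k l klN kp lq.
have [s1 [s10 Hs1]] : exists s1, (lam + mu - 1 != 0 -> s1 = 0) /\
    naccum_limit (k + l) (w k) (chain_pred u l) s1.
  case: l lq klN => [|l] lq klN.
    exists 0; split => // kappa k0; apply: cvgC_eq (cvgC_cst 0).
    by apply: nearW => n; rewrite naccum0r mulr0.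
  by rewrite addnS; apply: IH => //; [rewrite -ltnS -addnS|exact: ltnW].
have [s2 [s20 Hs2]] : exists s2, (lam + mu - 1 != 0 -> s2 = 0) /\
    naccum_limit (k + l) (chain_pred w k) (u l) s2.
  case: k kp klN Hs1 => [|k] kp klN _.
    exists 0; split => // kappa k0; apply: cvgC_eq (cvgC_cst 0).
    by apply: nearW => n; rewrite naccum0l mulr0.
  by rewrite addSn; apply: IH => //; exact: ltnW.
pose G := drawform v A (w k) (u l).
pose g := if (k + l == 0)%N then G else 0.
have [z0|z0] := eqVneq (lam + mu - 1) 0.
  exists (((k + l).+1%:R^-1)%:c * (s1 + s2 + g + 0)); split => // kappa k0.
  have [_ err0] := naccum_err_cvg0 k0 cw cu lamE muE kp lq.
  apply: (@stolz_harmC _ _ k0 _ (fun n => naccum kappa n (w k) (chain_pred u l) +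
     naccum kappa n (chain_pred w k) (u l) + G + naccum_err kappa lam mu n (w k) (u l) (chain_pred w k) (chain_pred u l))).
    by move=> n; rewrite (naccumS k0 n (cw _ kp) (cu _ lq)) z0 mul0r add0r.
  have := cvgCD (cvgCD (cvgCD (Hs1 _ k0) (Hs2 _ k0)) (cvgC_cst_div_harm k0 (k + l) G))
    (cvgC0_div_harm k0 (k + l) err0).
  by apply: cvgC_eq; apply: nearW => n; rewrite -!mulrDr.
exists 0; split => // kappa k0.
have [tZ0 err0] := naccum_err_cvg0 k0 cw cu lamE muE kp lq.
pose V n := naccum kappa n (w k) (u l) + G / (lam + mu - 1).
have HV : cvgC (fun n => ((harm kappa 0 n ^+ (k + l).+1)^-1)%:c * V n) 0.
  apply: (@rotation_harmC _ _ k0 V (fun n => naccum kappa n (w k) (chain_pred u l) +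
     naccum kappa n (chain_pred w k) (u l) + naccum_err kappa lam mu n (w k) (u l) (chain_pred w k) (chain_pred u l)) _ (lam + mu - 1)).
  - by rewrite !ReD ReN lamE muE /=; field.
  - move=> n; rewrite /V (naccumS k0 n (cw _ kp) (cu _ lq)) -/G.
    exact: rotation_shift_identity.
  - have := cvgCD (cvgCD (Hs1 _ k0) (Hs2 _ k0)) (cvgC0_div_harm k0 (k + l) err0).
    rewrite s10// s20// !addr0.
    by apply: cvgC_eq; apply: nearW => n; rewrite -!mulrDr.
  - have tG : cvgC (fun n => ctime kappa n * (G / (lam + mu - 1))) 0.
      by apply: (@cvgC0_tau _ k0 _ (cmod (G / (lam + mu - 1))) 0%N) => n; rewrite expr0 mulr1.
    have tV := cvgCD tZ0 tG; rewrite addr0 in tV.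
    apply: cvgC_eq (cvgC0_div_harm k0 (k + l) tV); apply: nearW => n.
    by rewrite -mulrDr mulrA /ctime -(rmorphM (real_complex R)).
have := cvgCD HV (cvgC_cst_div_harm k0 (k + l).+1 (- (G / (lam + mu - 1)))).
rewrite addr0; apply: cvgC_eq; apply: nearW => n.
by rewrite -mulrDr /V addrK.
Qed.

Lemma naccum_subcritical_limit lam mu w u p q d : chain M lam w p -> chain M mu u q ->
  complex.Re lam < 1 / 2 -> complex.Re mu <= 1 / 2 ->
  forall k l, (k < p)%N -> (l < q)%N -> naccum_limit d.+1 (w k) (u l) 0.
Proof.
move=> cw cu lamE muE k l kp lq kappa k0.
have [K [K0 HK]] := naccum_bound_sub k0 cw cu lamE muE.
suff /(cvgC0_div_harm k0 d) : cvgC (fun n => ((harm kappa 0 n)^-1)%:c * naccum kappa n (w k) (u l)) 0.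
  apply: cvgC_eq; apply: nearW => n.
  by rewrite exprSr invfM rmorphM/= -mulrA.
apply: (@cvgC0_le _ _ (fun n => (harm kappa 0 n)^-1 * K)).
  apply: nearW => n; rewrite cmodM cmod_real ger0_norm ?invr_ge0 ?harm_ge0//.
  by rewrite ler_wpM2l ?invr_ge0 ?harm_ge0// HK.
rewrite -[X in _ --> X](mul0r K); apply: cvgM; last exact: cvg_cst.
exact: inv_harm_cvg0.
Qed.

End pairs.

(** * The limiting covariance matrix *)

Section perron.
Variables (R : realType) (s : nat) (A : 'M[R]_s) (m : R).
Hypotheses (hbal : balanced A m) (hirr : irreducible A).
Hypothesis offdiag : forall j k, j != k -> 0 <= A k j.

(** Maximum principle: where [x] is maximal, the equation is an average of
    nonnegative differences [x i - x k] equal to zero. So the set where [x] is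
    maximal cannot be left along a nonzero entry of [A], and irreducibility
    makes it everything. *)
Lemma balanced_eigenvector_constant (x : 'cV[R]_s) :
  A *m x = m *: x -> forall i j, x i 0 = x j 0.
Proof.
move=> Ax i0 j0.
pose S := [set i | [forall k, x k 0 <= x i 0]]%SET.
suff ST : S = [set: 'I_s]%SET.
  have : i0 \in S by rewrite ST inE.
  have : j0 \in S by rewrite ST inE.
  rewrite !inE => /forallP Hj /forallP Hi.
  by apply/eqP; rewrite eq_le Hi Hj.
apply/eqP; apply/negPn/negP => SnT.
have S0 : S != finset.set0.
  apply/set0Pn; case: (@arg_maxP _ R 'I_s i0 xpredT (fun i => x i 0) isT) => i _ Hi.
  by exists i; rewrite inE; apply/forallP => k; exact: Hi.
have [i [j [iS jS Aij]]] := hirr S0 SnT.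
move: iS; rewrite inE => /forallP iS.
have E : \sum_k A i k * (x i 0 - x k 0) = 0.
  have := congr1 (fun y : 'cV[R]_s => y i 0) Ax; rewrite !mxE => Hx.
  under eq_bigr do rewrite mulrBr.
  by rewrite sumrB Hx -mulr_suml hbal subrr.
have P0 k : 0 <= A i k * (x i 0 - x k 0).
  have [->|ik] := eqVneq k i; first by rewrite subrr mulr0.
  by rewrite mulr_ge0 ?subr_ge0// offdiag.
have Ej : A i j * (x i 0 - x j 0) = 0.
  apply/eqP; rewrite eq_le P0 andbT.
  by rewrite -E (bigD1 j)//= lerDl sumr_ge0.
move: jS; rewrite inE => /forallP; apply => k.
move/eqP : Ej; rewrite mulf_eq0 (negbTE Aij)/= subr_eq0 => /eqP <-.
exact: iS.
Qed.

End perron.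

(** [eigenvalue] is defined by row vectors. *)
Lemma right_eigenvalue (F : fieldType) (n : nat) (B : 'M[F]_n) (x : 'cV[F]_n) a :
  B *m x = a *: x -> x != 0 -> eigenvalue B a.
Proof.
move=> Bx; apply: contraNT => /negPn; rewrite /eigenvalue /eigenspace kermx_eq0.
rewrite row_free_unit => U; rewrite -[x]mul1mx -(mulVmx U) -mulmxA.
by rewrite mulmxBl Bx mul_scalar_mx subrr mulmx0.
Qed.

Section jordan_chains.
Variables (R : realType) (s : nat) (A : 'M[R]_s) (m : R) (v1 : 'rV[R]_s) (d : nat).
Local Notation C := R[i].
Local Notation "x %:c" := (real_complex R x) (at level 2).
Hypothesis hm : 0 < m.
Hypotheses (hbal : balanced A m) (hirr : irreducible A).
Hypothesis hcrit : critically_small A m.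
Hypothesis hv1 : normalized_left_eigenvector A m v1.
Hypothesis hd : largest_jordan_block A (m / 2) d.+1.
Hypothesis offdiag : forall j k, j != k -> 0 <= A k j.

Local Notation cA := (complexify A).
Local Notation one := (const_mx 1 : 'cV[R]_s).

(** The projection along the right eigenvector [1] onto the kernel of [v1]; it
    commutes with [A] and removes the eigenvalue [m]. *)
Definition kproj : 'M[R]_s := 1%:M - one *m v1.

Lemma mulmx_one : A *m one = m *: one.
Proof.
apply/matrixP => i j; rewrite !mxE mulr1 -(hbal i).
by apply: eq_bigr => k _; rewrite mxE mulr1.
Qed.

Lemma mulv1A : v1 *m A = m *: v1. Proof. by case: hv1. Qed.

Lemma mulv1_one : v1 *m one = 1%:M.
Proof.
have [v0 _ v1E] := hv1; rewrite [RHS]mx11_scalar [LHS]mx11_scalar; congr (_%:M).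
rewrite !mxE -[RHS]v1E; apply: eq_bigr => k _; rewrite mxE mulr1.
by rewrite ger0_norm// ltW.
Qed.

Lemma mulv1_kproj : v1 *m kproj = 0.
Proof. by rewrite /kproj mulmxBr mulmx1 mulmxA mulv1_one mul1mx subrr. Qed.

Lemma kproj_comm : A *m kproj = kproj *m A.
Proof.
rewrite /kproj mulmxBr mulmxBl mulmx1 mul1mx mulmxA mulmx_one -mulmxA mulv1A.
by rewrite -scalemxAl -scalemxAr.
Qed.

Lemma kproj_const (c : R) : kproj *m (c *: one) = 0.
Proof.
by rewrite -scalemxAr /kproj mulmxBl mul1mx -mulmxA mulv1_one mulmx1 subrr scaler0.
Qed.

Local Notation cproj := (map_mx (real_complex R) kproj).
Local Notation cM := ((m^-1)%:c *: cA).

(** Real and imaginary parts of an eigenvector for the real eigenvalue [m] are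
    real eigenvectors, hence constant. *)
Lemma top_eigenvector_kproj (w : 'cV[C]_s) : cA *m w = m%:c *: w -> cproj *m w = 0.
Proof.
move=> Aw.
pose re := map_mx (@complex.Re R) w; pose im := map_mx (@complex.Im R) w.
have ReS (f : 'I_s -> C) : complex.Re (\sum_k f k) = \sum_k complex.Re (f k).
  by elim/big_rec2 : _ => // k y1 y2 _ <-; rewrite ReD.
have ImS (f : 'I_s -> C) : complex.Im (\sum_k f k) = \sum_k complex.Im (f k).
  by elim/big_rec2 : _ => // k y1 y2 _ <-; rewrite ImD.
have Are : A *m re = m *: re.
  apply/colP => i; have := congr1 (fun y : 'cV[C]_s => complex.Re (y i 0)) Aw.
  rewrite !mxE ReZ ReS => <-; apply: eq_bigr => k _; by rewrite !mxE ReZ.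
have Aim : A *m im = m *: im.
  apply/colP => i; have := congr1 (fun y : 'cV[C]_s => complex.Im (y i 0)) Aw.
  rewrite !mxE ImZ ImS => <-; apply: eq_bigr => k _; by rewrite !mxE ImZ.
have cst (x : 'cV[R]_s) : A *m x = m *: x -> kproj *m x = 0.
  move=> Ax; have [i0|s0] := pickP 'I_s; last first.
    by apply/matrixP => i; have := s0 i.
  rewrite (_ : x = x i0 0 *: one) ?kproj_const//.
  by apply/matrixP => i j; rewrite ord1 !mxE mulr1; exact: (balanced_eigenvector_constant hbal hirr offdiag Ax).
apply/colP => i.
have := congr1 (fun y : 'cV[R]_s => y i 0) (cst _ Are).
have := congr1 (fun y : 'cV[R]_s => y i 0) (cst _ Aim).
rewrite !mxE => Hi Hr; apply/eqP; rewrite eq_complex ReS ImS /=.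
under eq_bigr do rewrite !mxE ReZ.
under [X in _ && (X == _)]eq_bigr do rewrite !mxE ImZ.
apply/andP; split; apply/eqP.
- by rewrite -[RHS]Hr; apply: eq_bigr => k _; rewrite !mxE.
- by rewrite -[RHS]Hi; apply: eq_bigr => k _; rewrite !mxE.
Qed.

Lemma cproj_comm : cA *m cproj = cproj *m cA.
Proof. by rewrite /complexify -!map_mxM kproj_comm. Qed.

(** The columns of the base change to a Jordan form are chains of [A]; powers
    of [m] rescale them to chains of [A / m]. A block of the eigenvalue [m]
    has size one, since a second vector would force [v1] to vanish on the
    first one, which is constant; the projection kills that vector, and the
    block enters with length zero. *)
Lemma jordan_chains : exists (k : nat) (p : 'I_k -> nat) (mu : 'I_k -> C)
    (w : 'I_k -> nat -> 'cV[C]_s) (cf : 'I_k -> nat -> 'cV[C]_s -> C),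
  [/\ forall i, chain cM (mu i) (w i) (p i),
      forall i, complex.Re (mu i) < 1 / 2 \/
                (complex.Re (mu i) = 1 / 2 /\ (p i <= d.+1)%N) &
      forall x, cproj *m x = \sum_i \sum_(a < p i) cf i a x *: w i a].
Proof.
have [k [p [lam [[p_gt0 [V [W [VW WV VAW]]]] crit_size _]]]] := hd.
pose col_ i (a : nat) : 'cV[C]_s :=
  if @insub nat (fun a => a < p i)%N 'I_(p i) a is Some a' then col a' (submxrow W i) else 0.
have col_inE i a (ap : (a < p i)%N) : col_ i a = col (Ordinal ap) (submxrow W i).
  by rewrite /col_ insubT.
have AW : cA *m W = W *m (\mxdiag_i jordan_block (p i) (lam i)).
  by rewrite -VAW !mulmxA WV mul1mx.
have AWi i : cA *m submxrow W i = submxrow W i *m jordan_block (p i) (lam i).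
  by rewrite mul_submxrow AW -{1}(submxrowK W) mul_mxrow_mxdiag mxrowK.
have Acol i a : (a < p i)%N -> cA *m col_ i a = lam i *: col_ i a + chain_pred (col_ i) a.
  move=> ap; rewrite (col_inE _ _ ap).
  have -> : cA *m col (Ordinal ap) (submxrow W i) = col (Ordinal ap) (submxrow W i *m jordan_block (p i) (lam i)).
    by rewrite -AWi !colE mulmxA.
  apply/matrixP => r c; rewrite ord1 [LHS]mxE [LHS]mxE.
  under eq_bigr do rewrite [X in _ * X]mxE mulrDr.
  rewrite big_split/= 3![in RHS]mxE; congr (_ + _).
    rewrite (bigD1 (Ordinal ap))//= eqxx mulr1n mulrC big1 ?addr0// => b.
    by rewrite -val_eqE/= => /negbTE ->; rewrite mulr0n mulr0.
  case: a ap => [|a] ap /=; first by rewrite mxE big1// => b _; rewrite mulr0.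
  rewrite (col_inE _ _ (ltnW ap)) (bigD1 (Ordinal (ltnW ap)))//= eqxx mulr1 !mxE.
  rewrite [X in _ + X = _]big1 ?addr0// => b; rewrite -val_eqE/= eqSS => /negbTE ->.
  by rewrite mulr0.
have col0 i : col_ i 0%N != 0.
  apply/eqP => c0; have := congr1 (mulmx V) c0.
  rewrite mulmx0 (col_inE _ _ (p_gt0 i)) colE mulmxA mul_submxrow VW -colE.
  move=> /matrixP/(_ (tagnat.Rank i (Ordinal (p_gt0 i))) 0).
  by rewrite !mxE eqxx => /eqP; rewrite oner_eq0.
have eig i : eigenvalue cA (lam i).
  apply: (@right_eigenvalue _ _ _ (col_ i 0%N)) => //.
  by rewrite Acol//= addr0.
have projcol i a : lam i = m%:c -> (a < p i)%N -> cproj *m col_ i a = 0.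
  move=> lm ap; have A0 := Acol i 0%N (p_gt0 i); rewrite lm /= addr0 in A0.
  have c00 := top_eigenvector_kproj A0.
  case: a ap => [//|a] ap.
  have A1 := Acol i 1%N (leq_ltn_trans (ltn0Sn a) ap); rewrite lm /= in A1.
  have := congr1 (mulmx (map_mx (real_complex R) v1)) A1.
  rewrite mulmxA /complexify -map_mxM mulv1A map_mxZ mulmxDr -scalemxAl -scalemxAr.
  rewrite -{1}[_ *: _]addr0 => /addrI/esym v10.
  have := col0 i; rewrite -[col_ i 0%N]mul1mx.
  have -> : 1%:M = cproj + map_mx (real_complex R) one *m map_mx (real_complex R) v1.
    by rewrite /kproj map_mxB map_mxM map_mx1 subrK.
  by rewrite mulmxDl c00 -mulmxA v10 mulmx0 addr0 eqxx.
pose p' i := if lam i == m%:c then 0%N else p i.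
pose mu i := if lam i == m%:c then 0 else (m^-1)%:c * lam i.
pose cf i (a : nat) (x : 'cV[C]_s) : C := (m ^- a)%:c *
  (if @insub nat (fun a => a < p i)%N 'I_(p i) a is Some a' then (submxcol (V *m x) i) a' 0 else 0).
exists k, p', mu, (fun i a => (m ^+ a)%:c *: (cproj *m col_ i a)), cf; split.
- move=> i a; rewrite /p' /mu; case: ifP => // _ ap.
  rewrite -scalemxAr mulmxA -scalemxAl cproj_comm -scalemxAl -mulmxA Acol//.
  rewrite mulmxDr -scalemxAr !scalerDr !scalerA; congr (_ + _).
    by congr (_ *: _); rewrite -mulrA mulrC.
  case: a ap => [|a] ap /=; first by rewrite mulmx0 scaler0.
  rewrite -(rmorphM (real_complex R)); congr (_%:c *: _).
  by rewrite exprSr mulfK ?gt_eqF.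
- move=> i; rewrite /p' /mu; case: ifPn => [_|lm].
    by left; rewrite divr_gt0.
  have [_ /(_ _ (eig i) lm) le2 _] := hcrit.
  rewrite ReZ; move: le2; rewrite le_eqVlt => /predU1P[E|lt2].
    by right; split; [rewrite E; field; rewrite gt_eqF|exact: crit_size].
  left; rewrite mulrC ltr_pdivrMr//; apply: (lt_le_trans lt2).
  by rewrite le_eqVlt; apply/orP; left; apply/eqP; field.
- move=> x; rewrite -{1}[x]mul1mx -WV -mulmxA -{1}(submxrowK W) -(submxcolK (V *m x)).
  rewrite mul_mxrow_mxcol mulmx_sumr; apply: eq_bigr => i _.
  have -> : submxrow W i *m submxcol (V *m x) i =
     \sum_(a < p i) (submxcol (V *m x) i) a 0 *: col_ i a.
    apply/matrixP => r c; rewrite ord1 mxE summxE; apply: eq_bigr => a _.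
    rewrite (col_inE _ _ (ltn_ord a)).
    have -> : Ordinal (ltn_ord a) = a by exact: val_inj.
    by rewrite !mxE mulrC.
  rewrite mulmx_sumr /p'; have [lm|lm] := eqVneq (lam i) m%:c.
    rewrite big_ord0 big1// => a _.
    by rewrite -scalemxAr projcol// scaler0.
  apply: eq_bigr => a _; rewrite -scalemxAr scalerA /cf valK.
  by rewrite mulrAC -(rmorphM (real_complex R)) mulVf ?expf_neq0 ?gt_eqF// rmorph1 mul1r.
Qed.

Definition rnorm1 (x : 'cV[R]_s) : R := \sum_i `|x i 0|.
Definition rflow kappa j n : 'M[R]_s :=
  flow (m^-1 *: A) (fun n => (tau kappa n)^-1) j n.
Definition raccum kappa n x y : R :=
  accum v1 A (m^-1 *: A) (fun n => (tau kappa n)^-1) n x y.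

Local Notation rc := (map_mx (real_complex R)).

Lemma cnorm1_map x : cnorm1 (rc x) = rnorm1 x.
Proof. by apply: eq_bigr => i _; rewrite mxE cmod_real. Qed.

Lemma map_rflow kappa j n : (j <= n)%N ->
  rc (rflow kappa j n) = flow cM (ctime kappa) j n.
Proof.
move=> jn; rewrite -(subnKC jn); elim: (n - j)%N => [|k IH].
  by rewrite addn0 /rflow !flownn map_mx1.
rewrite addnS /rflow !flowS ?leq_addr// map_mxM; congr (_ *m _) => //.
by rewrite map_mxD map_mx1 !map_mxZ.
Qed.

Lemma map_drawform x y :
  (drawform v1 A x y)%:c = drawform (rc v1) cA (rc x) (rc y).
Proof.
rewrite /drawform rmorph_sum; apply: eq_bigr => k _.
by rewrite /complexify -!map_mxM !rmorphM !mxE.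
Qed.

Lemma map_raccum kappa n x y :
  (raccum kappa n x y)%:c = accum (rc v1) cA cM (ctime kappa) n (rc x) (rc y).
Proof.
rewrite /raccum /accum rmorph_sum; apply: eq_big_nat => j /andP[_ jn].
rewrite -(map_rflow kappa jn) -!map_mxM; exact: map_drawform.
Qed.

Lemma cnorm1_sum (I : Type) (r : seq I) (f : I -> 'cV[C]_s) :
  cnorm1 (\sum_(i <- r) f i) <= \sum_(i <- r) cnorm1 (f i).
Proof.
elim/big_ind2 : _ => [|x1 x2 y1 y2 H1 H2|//]; first by rewrite cnorm10.
by apply: (le_trans (cnorm1D _ _)); exact: lerD.
Qed.

(** Critical chains have length at most [d + 1], hence at most [d] powers of
    the clock; the other chains are smaller. *)
Lemma rflow_growth kappa x : 0 < kappa -> exists K, 0 <= K /\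
  forall j n, (j <= n)%N -> rnorm1 (rflow kappa j n *m (kproj *m x)) <=
    K * (expR (harm kappa j n / 2) * (1 + harm kappa j n) ^+ d).
Proof.
move=> k0; have [k [p [mu [w [cf [cw re_mu dec]]]]]] := jordan_chains.
have /choice[Ki HKi] : forall i, exists K, 0 <= K /\
    forall j n a, (a < p i)%N -> (j <= n)%N ->
    cnorm1 (flow cM (ctime kappa) j n *m w i a) <=
    K * (expR (harm kappa j n / 2) * (1 + harm kappa j n) ^+ d).
  move=> i; case: (re_mu i) => [lt2|[eq2 pd]].
    have [K [K0 HK]] := chain_bound_sub k0 0 (cw i) lt2.
    exists K; split => // j n a ap jn; have := HK j n a ap jn.
    rewrite expr0 mulr1 => /le_trans; apply; rewrite ler_wpM2l//.
    by rewrite ler_peMr ?expR_ge0// exprn_ege1// lerDl harm_ge0.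
  have [||K [K0 HK]] := @chain_bound _ _ _ k0 _ _ _ _ (1 / 2) (cw i).
  - by rewrite eq2.
  - by rewrite divr_ge0.
  exists K; split => // j n a ap jn; apply: (le_trans (HK j n a ap jn)).
  rewrite -mulrA ler_wpM2l// (_ : 1 / 2 * _ = harm kappa j n / 2); last by field.
  rewrite ler_wpM2l ?expR_ge0// ler_weXn2l ?lerDl ?harm_ge0//.
  by rewrite -ltnS (leq_trans ap).
exists (\sum_i \sum_(a < p i) cmod (cf i a (rc x)) * Ki i); split.
  by apply: sumr_ge0 => i _; apply: sumr_ge0 => a _; rewrite mulr_ge0 ?cmod_ge0//; have [] := HKi i.
move=> j n jn; rewrite -cnorm1_map map_mxM map_rflow// map_mxM dec mulmx_sumr.
rewrite (le_trans (cnorm1_sum _ _))// mulr_suml ler_sum// => i _.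
rewrite mulmx_sumr (le_trans (cnorm1_sum _ _))// mulr_suml ler_sum// => a _.
rewrite -scalemxAr cnorm1Z -mulrA ler_wpM2l ?cmod_ge0//.
by have [_] := HKi i; apply.
Qed.

Lemma naccum_limit_raise (v : 'rV[C]_s) (B M : 'M[C]_s) q q' x y sigma :
  naccum_limit v B M q x y sigma -> (q < q')%N -> naccum_limit v B M q' x y 0.
Proof.
move=> H qq' kappa k0; have := H _ k0 => {}H.
have Hh : cvgC (fun n => ((harm kappa 0 n)^-1)%:c) 0.
  apply: (@cvgC0_le _ _ (fun n => (harm kappa 0 n)^-1)); last exact: inv_harm_cvg0.
  by apply: nearW => n; rewrite cmod_real ger0_norm ?invr_ge0 ?harm_ge0.
pose f n := ((harm kappa 0 n)^-1)%:c * (((harm kappa 0 n ^+ q)^-1)%:c * naccum v B M kappa n x y).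
have f0 : cvgC f 0.
  apply: (@cvgC0_le _ _ (fun n => (harm kappa 0 n)^-1 *
     (cmod (((harm kappa 0 n ^+ q)^-1)%:c * naccum v B M kappa n x y - sigma) + cmod sigma))).
    apply: nearW => n; rewrite /f cmodM cmod_real ger0_norm ?invr_ge0 ?harm_ge0//.
    rewrite ler_wpM2l ?invr_ge0 ?harm_ge0// (le_trans _ (cmodD _ _))//.
    by rewrite subrK.
  rewrite -[X in _ --> X](mul0r (0 + cmod sigma)); apply: cvgM; first exact: inv_harm_cvg0.
  by apply: cvgD; [exact: H|exact: cvg_cst].
apply: cvgC_eq (cvgC0_div_harm k0 (q' - q.+1) f0); apply: nearW => n.
rewrite /f !mulrA -!(rmorphM (real_complex R)); congr (_%:c * _).
by rewrite -!invfM -exprSr -exprD addSnnS subnK.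
Qed.

(** Expanded on pairs of chain vectors, only the last vectors of two critical
    chains of the maximal length [d + 1] reach the power [2 * d + 1] of the
    clock. *)
Lemma raccum_bilinear_limit x y : exists sigma : R, forall kappa, 0 < kappa ->
  (harm kappa 0 n ^+ (2 * d + 1))^-1 * ((tau kappa n)^-1 *
     raccum kappa n (kproj *m x) (kproj *m y)) @[n --> \oo] --> sigma.
Proof.
have [k [p [mu [w [cf [cw re_mu dec]]]]]] := jordan_chains.
have H (i : 'I_k) (a : nat) (j : 'I_k) (b : nat) : exists sigma,
    (a < p i)%N -> (b < p j)%N ->
    naccum_limit (rc v1) cA cM (2 * d).+1 (w i a) (w j b) sigma.
  case: (ltnP a (p i)) => ai; last by exists 0.
  case: (ltnP b (p j)) => bj; last by exists 0.
  case: (re_mu i) => [lti|[eqi pi]].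
    exists 0 => _ _; apply: (naccum_subcritical_limit _ _ _ (cw i) (cw j)) => //.
    by case: (re_mu j) => [/ltW//|[->]].
  case: (re_mu j) => [ltj|[eqj pj]].
    exists 0 => _ _ kappa k0.
    apply: cvgC_eq (naccum_subcritical_limit (rc v1) cA (2 * d) (cw j) (cw i) ltj _ bj ai k0).
      by apply: nearW => n; rewrite naccumC.
    by rewrite eqi.
  have [sg [_ Hsg]] := naccum_critical_limit (rc v1) cA (cw i) (cw j) eqi eqj ai bj.
  have ad : (a <= d)%N by rewrite -ltnS (leq_trans ai).
  have bd : (b <= d)%N by rewrite -ltnS (leq_trans bj).
  have : (a + b <= 2 * d)%N by rewrite mul2n -addnn leq_add.
  rewrite leq_eqVlt => /predU1P[E|lt]; first by exists sg; rewrite -E.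
  by exists 0 => _ _; exact: (naccum_limit_raise Hsg).
have /choice[sg Hsg] : forall q : ('I_k * nat) * ('I_k * nat), exists sigma,
    (q.1.2 < p q.1.1)%N -> (q.2.2 < p q.2.1)%N ->
    naccum_limit (rc v1) cA cM (2 * d).+1 (w q.1.1 q.1.2) (w q.2.1 q.2.2) sigma.
  by move=> [[i a] [j b]]; exact: H.
pose S := \sum_i \sum_(a < p i) \sum_j \sum_(b < p j)
   cf i a (rc x) * (cf j b (rc y) * sg ((i, val a), (j, val b))).
exists (complex.Re S) => kappa k0.
have cS : cvgC (fun n => ((harm kappa 0 n ^+ (2 * d).+1)^-1)%:c *
   naccum (rc v1) cA cM kappa n (cproj *m rc x) (cproj *m rc y)) S.
  have : cvgC (fun n => \sum_i \sum_(a < p i) \sum_j \sum_(b < p j)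
     cf i a (rc x) * (cf j b (rc y) * (((harm kappa 0 n ^+ (2 * d).+1)^-1)%:c *
       naccum (rc v1) cA cM kappa n (w i a) (w j b)))) S.
    apply: cvgC_sum => i; apply: cvgC_sum => a; apply: cvgC_sum => j; apply: cvgC_sum => b.
    apply: cvgCZ; apply: cvgCZ; exact: (Hsg ((i, val a), (j, val b)) (ltn_ord a) (ltn_ord b) _ k0).
  apply: cvgC_eq; apply: nearW => n.
  rewrite !dec /naccum accum_suml !mulr_sumr; apply: eq_bigr => i _.
  rewrite accum_suml !mulr_sumr; apply: eq_bigr => a _.
  rewrite accumZl accumC accum_suml !mulr_sumr; apply: eq_bigr => j _.
  rewrite accum_suml !mulr_sumr; apply: eq_bigr => b _.
  rewrite accumZl (accumC _ _ _ _ _ (w j b)).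
  by rewrite (mulrCA (ctime _ _) (cf i a _)) (mulrCA (ctime _ _) (cf j b _))
    (mulrCA _ (cf i a _)) (mulrCA _ (cf j b _)).
have := cvgC_Re cS.
have -> : (fun n => complex.Re (((harm kappa 0 n ^+ (2 * d).+1)^-1)%:c *
   naccum (rc v1) cA cM kappa n (cproj *m rc x) (cproj *m rc y))) =
   (fun n => (harm kappa 0 n ^+ (2 * d + 1))^-1 * ((tau kappa n)^-1 *
     raccum kappa n (kproj *m x) (kproj *m y))) => //.
apply/funext => n.
by rewrite ReZ /naccum -!map_mxM -map_raccum /ctime ReZ /= addn1.
Qed.

(** The entries are the bilinear limits on the canonical basis. Symmetry and
    positivity hold before the limit and pass to it. *)
Lemma raccum_limit : exists Sigma : 'M[R]_s, covariance_matrix Sigma /\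
  forall kappa (x : 'cV[R]_s), 0 < kappa ->
  (harm kappa 0 n ^+ (2 * d + 1))^-1 * ((tau kappa n)^-1 *
     raccum kappa n (kproj *m x) (kproj *m x)) @[n --> \oo] -->
  (x^T *m Sigma *m x) 0 0.
Proof.
have /choice[sg Hsg] : forall q : 'I_s * 'I_s, exists sigma : R, forall kappa, 0 < kappa ->
  (harm kappa 0 n ^+ (2 * d + 1))^-1 * ((tau kappa n)^-1 *
     raccum kappa n (kproj *m delta_mx q.1 0) (kproj *m delta_mx q.2 0)) @[n --> \oo] --> sigma.
  by move=> q; exact: raccum_bilinear_limit.
pose Sigma : 'M[R]_s := \matrix_(i, j) sg (i, j).
have H kappa (x : 'cV[R]_s) : 0 < kappa ->
  (harm kappa 0 n ^+ (2 * d + 1))^-1 * ((tau kappa n)^-1 *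
     raccum kappa n (kproj *m x) (kproj *m x)) @[n --> \oo] -->
  (x^T *m Sigma *m x) 0 0.
  move=> k0.
  have -> : (x^T *m Sigma *m x) 0 0 = \sum_i \sum_j x i 0 * (x j 0 * sg (i, j)).
    rewrite mxE exchange_big/=; apply: eq_bigr => j _.
    rewrite mxE mulr_suml; apply: eq_bigr => i _; rewrite !mxE.
    by rewrite mulrAC mulrA.
  have : \sum_i \sum_j x i 0 * (x j 0 * ((harm kappa 0 n ^+ (2 * d + 1))^-1 *
     ((tau kappa n)^-1 * raccum kappa n (kproj *m delta_mx i 0) (kproj *m delta_mx j 0)))) @[n --> \oo]
     --> \sum_i \sum_j x i 0 * (x j 0 * sg (i, j)).
    apply: cvg_sum_seq => i; apply: cvg_sum_seq => j.
    apply: cvgM; first exact: cvg_cst.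
    apply: cvgM; first exact: cvg_cst.
    exact: (Hsg (i, j) _ k0).
  apply: cvg_trans; apply: near_eq_cvg; apply: nearW => n /=.
  have px : kproj *m x = \sum_i x i 0 *: (kproj *m delta_mx i 0).
    apply/matrixP => r c; rewrite ord1 mxE summxE; apply: eq_bigr => i _.
    by rewrite -colE !mxE mulrC.
  rewrite px /raccum accum_suml !mulr_sumr; apply: eq_bigr => i _.
  rewrite accumZl accumC accum_suml !mulr_sumr; apply: eq_bigr => j _.
  by rewrite accumZl [in RHS]accumC; ring.
exists Sigma; split => //; split.
  apply/matrixP => i j; rewrite !mxE.
  have h1 := Hsg (i, j) 1 ltr01; have h2 := Hsg (j, i) 1 ltr01.
  have E : (fun n => (harm 1 0 n ^+ (2 * d + 1))^-1 * ((tau 1 n)^-1 *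
     raccum 1 n (kproj *m delta_mx i 0) (kproj *m delta_mx j 0))) =
     (fun n => (harm 1 0 n ^+ (2 * d + 1))^-1 * ((tau 1 n)^-1 *
     raccum 1 n (kproj *m delta_mx j 0) (kproj *m delta_mx i 0))).
    by apply/funext => n; rewrite /raccum accumC.
  rewrite /= E in h1.
  exact: (cvg_unique _ h2 h1).
move=> t; have Ht := H 1 t^T ltr01; rewrite trmxK in Ht.
apply: (ler_cvg_to (@cvg_cst _ 0 _ _ _) Ht); apply: nearW => n /=.
rewrite mulr_ge0 ?invr_ge0 ?exprn_ge0 ?harm_ge0// mulr_ge0 ?tauV_ge0//.
apply: sumr_ge0 => j _; apply: sumr_ge0 => k _.
by rewrite -mulrA mulr_ge0 -?expr2 ?sqr_ge0//; case: hv1 => v0 _ _; exact: ltW.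
Qed.

End jordan_chains.

(** * Elementary inequalities *)

Section elementary.
Variable R : realType.
Implicit Types x h z : R.

(** The trigonometric inequalities below follow by applying this to their
    successive derivatives. *)
Lemma ge0_of_derive (f f' : R -> R) : (forall x, is_derive x (1 : R) f (f' x)) ->
  (forall x, 0 <= x -> 0 <= f' x) -> 0 <= f 0 -> forall x, 0 <= x -> 0 <= f x.
Proof.
move=> df f'0 f0 x x0; apply: (le_trans f0).
apply: (@ger0_derive1_le R f 0 x _ _ true false) => //.
- move=> y; rewrite in_itv/= => /andP[y0 _]; rewrite derive1E.
  by have [_ ->] := df y; exact/f'0/ltW.
- apply: derivable_within_continuous => y _; by case: (df y).
- by rewrite in_itv/= lexx.
- by rewrite in_itv/= lexx x0.
Qed.

Lemma sin_le x : 0 <= x -> 0 <= x - sin x.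
Proof.
apply: (@ge0_of_derive (fun x => x - sin x) (fun x => 1 - cos x)).
- by move=> y _; rewrite subr_ge0 cos_le1.
- by rewrite /= sin0 subr0.
Qed.

Lemma cos_ge x : 0 <= x -> 0 <= cos x - 1 + x ^+ 2 / 2.
Proof.
apply: (@ge0_of_derive (fun x => cos x - 1 + x ^+ 2 / 2) (fun x => x - sin x)).
- move=> y; apply: is_derive_eq; rewrite /GRing.scale/=; by field.
- exact: sin_le.
- by rewrite /= cos0 expr0n/= mul0r subrr addr0.
Qed.

Lemma sin_ge x : 0 <= x -> 0 <= sin x - x + x ^+ 3 / 6.
Proof.
apply: (@ge0_of_derive (fun x => sin x - x + x ^+ 3 / 6) (fun x => cos x - 1 + x ^+ 2 / 2)).
- move=> y; apply: is_derive_eq; rewrite /GRing.scale/=; by field.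
- exact: cos_ge.
- by rewrite /= sin0 expr0n/= mul0r subrr addr0.
Qed.

Lemma cos_le4 x : 0 <= x -> 0 <= 1 - x ^+ 2 / 2 + x ^+ 4 / 24 - cos x.
Proof.
apply: (@ge0_of_derive (fun x => 1 - x ^+ 2 / 2 + x ^+ 4 / 24 - cos x) (fun x => sin x - x + x ^+ 3 / 6)).
- move=> y; apply: is_derive_eq; rewrite /GRing.scale/=; by field.
- exact: sin_ge.
- by rewrite /= cos0 !expr0n/= !mul0r subr0 addr0 subrr.
Qed.

Lemma cos_le1D x : 0 <= x -> 0 <= x + cos x - 1.
Proof.
apply: (@ge0_of_derive (fun x => x + cos x - 1) (fun x => 1 - sin x)).
- by move=> y; apply: is_derive_eq; rewrite subr0.
- by move=> y _; rewrite subr_ge0 sin_le1.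
- by rewrite /= cos0 add0r subrr.
Qed.

Lemma sin_ge2 x : 0 <= x -> 0 <= x ^+ 2 / 2 + sin x - x.
Proof.
apply: (@ge0_of_derive (fun x => x ^+ 2 / 2 + sin x - x) (fun x => x + cos x - 1)).
- move=> y; apply: is_derive_eq; rewrite /GRing.scale/=; by field.
- exact: cos_le1D.
- by rewrite /= sin0 expr0n/= mul0r subr0 addr0.
Qed.

Lemma cos_le3 x : 0 <= x -> 0 <= x ^+ 3 / 6 - (cos x - 1 + x ^+ 2 / 2).
Proof.
apply: (@ge0_of_derive (fun x => x ^+ 3 / 6 - (cos x - 1 + x ^+ 2 / 2)) (fun x => x ^+ 2 / 2 + sin x - x)).
- move=> y; apply: is_derive_eq; rewrite /GRing.scale/=; by field.
- exact: sin_ge2.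
- by rewrite /= cos0 !expr0n/= !mul0r subrr addr0 subr0.
Qed.

Lemma cos_taylor2 x : `|cos x - 1 + x ^+ 2 / 2| <= `|x| ^+ 3 / 6.
Proof.
wlog x0 : x / 0 <= x.
  move=> H; have [/H//|x0] := leP 0 x.
  by have := H (- x); rewrite oppr_ge0 cosN sqrrN normrN; apply; exact: ltW.
rewrite (ger0_norm x0) ger0_norm ?cos_ge//.
by rewrite -subr_ge0 cos_le3.
Qed.

Lemma sin_taylor1 x : `|sin x - x| <= `|x| ^+ 3 / 6.
Proof.
wlog x0 : x / 0 <= x.
  move=> H; have [/H//|x0] := leP 0 x.
  have := H (- x); rewrite oppr_ge0 sinN normrN -opprD normrN; apply; exact: ltW.
rewrite (ger0_norm x0) ler0_norm; last by have := sin_le x0; lra.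
by have := sin_ge x0; lra.
Qed.

Lemma cosD_taylor z h :
  `|cos (z + h) - (cos z - h * sin z - h ^+ 2 / 2 * cos z)| <= `|h| ^+ 3.
Proof.
rewrite cosD.
have -> : cos z * cos h - sin z * sin h - (cos z - h * sin z - h ^+ 2 / 2 * cos z) =
   cos z * (cos h - 1 + h ^+ 2 / 2) - sin z * (sin h - h) by ring.
have c1 : `|cos z| <= 1 by exact: cos_max.
have s1 : `|sin z| <= 1 by exact: sin_max.
rewrite (le_trans (ler_normB _ _))// !normrM.
have h3 : 0 <= `|h| ^+ 3 by rewrite exprn_ge0.
apply: (@le_trans _ _ (1 * (`|h| ^+ 3 / 6) + 1 * (`|h| ^+ 3 / 6))); last by lra.
by apply: lerD; apply: ler_pM => //; [exact: cos_taylor2|exact: sin_taylor1].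
Qed.

Lemma cos_taylor4 x : `|cos x - 1 + x ^+ 2 / 2| <= x ^+ 4 / 24.
Proof.
wlog x0 : x / 0 <= x.
  move=> H; have [/H//|x0] := leP 0 x.
  have := H (- x); rewrite oppr_ge0 cosN !sqrrN.
  rewrite (_ : (- x) ^+ 4 = x ^+ 4); last by ring.
  by apply; exact: ltW.
rewrite ger0_norm ?cos_ge//.
by have := cos_le4 x0; lra.
Qed.

Lemma expR_le_quad h : expR h <= 1 + h + h ^+ 2 * expR `|h|.
Proof.
have [h0|h0] := leP 0 h.
  rewrite ger0_norm//.
  have H : expR h <= 1 + h * expR h.
    have := expR_ge1Dx (- h); rewrite expRN => H.
    have : (1 - h) * expR h <= (expR h)^-1 * expR h by rewrite ler_wpM2r ?expR_ge0.
    rewrite mulVf ?gt_eqF ?expR_gt0//; lra.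
  have : h * expR h <= h * (1 + h * expR h) by rewrite ler_wpM2l.
  by rewrite expr2; lra.
pose y := - h; have y0 : 0 < y by rewrite oppr_gt0.
have -> : h = - y by rewrite opprK.
rewrite normrN gtr0_norm// sqrrN.
have e1 := expR_ge1Dx y.
have : expR (- y) * (1 + y) <= 1.
  rewrite expRN mulrC ler_pdivrMr ?expR_gt0// mul1r//.
have e0 : 0 < expR (- y) by exact: expR_gt0.
have : y ^+ 2 * 1 <= y ^+ 2 * expR y.
  rewrite ler_wpM2l ?sqr_ge0//; lra.
rewrite mulr1 expr2.
set E := expR (- y) in e0 *; set F := y * y * expR y; move=> HF HE.
suff : E <= 1 - y + y * y by lra.
have : 0 < 1 + y by lra.
nra.
Qed.

End elementary.

(** * One draw, and arrays of linear statistics *)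

Section finite_mean.
Variables (R : realType) (I : finType) (p h : I -> R).
Hypotheses (p_ge0 : forall k, 0 <= p k) (p_sum1 : \sum_k p k = 1).
Hypothesis mean0 : \sum_k p k * h k = 0.

(** The linear term of the Taylor expansion cancels because [h] has mean zero.
    *)
Lemma mean_cos_taylor z :
  `|\sum_k p k * cos (z + h k) - (1 - (\sum_k p k * h k ^+ 2) / 2) * cos z|
    <= \sum_k p k * `|h k| ^+ 3.
Proof.
have -> : \sum_k p k * cos (z + h k) - (1 - (\sum_k p k * h k ^+ 2) / 2) * cos z =
    \sum_k p k * (cos (z + h k) - (cos z - h k * sin z - h k ^+ 2 / 2 * cos z)).
  have -> : \sum_k p k * (cos (z + h k) - (cos z - h k * sin z - h k ^+ 2 / 2 * cos z)) =
     \sum_k p k * cos (z + h k) - ((\sum_k p k) * cos z - (\sum_k p k * h k) * sin z -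
       (\sum_k p k * h k ^+ 2) / 2 * cos z).
    rewrite !mulr_suml -!sumrB; apply: eq_bigr => k _; by field.
  by rewrite p_sum1 mean0; field.
rewrite (le_trans (ler_norm_sum _ _ _))// ler_sum// => k _.
by rewrite normrM ger0_norm// ler_wpM2l// cosD_taylor.
Qed.

Lemma mean_expR_quad z B : (forall k, `|h k| <= B) ->
  \sum_k p k * expR (z + h k) <=
  expR z * (1 + expR B * \sum_k p k * h k ^+ 2).
Proof.
move=> hB.
have -> : expR z * (1 + expR B * \sum_k p k * h k ^+ 2) =
   \sum_k p k * (expR z * (1 + h k + h k ^+ 2 * expR B)).
  have -> : \sum_k p k * (expR z * (1 + h k + h k ^+ 2 * expR B)) =
     expR z * ((\sum_k p k) + (\sum_k p k * h k) + expR B * \sum_k p k * h k ^+ 2).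
    rewrite !mulrDr !mulr_sumr -!big_split; apply: eq_bigr => k _ /=; by ring.
  by rewrite p_sum1 mean0 addr0.
rewrite ler_sum// => k _; rewrite ler_wpM2l// expRD ler_wpM2l ?expR_ge0//.
by rewrite (le_trans (expR_le_quad _))// lerD2l ler_wpM2l ?sqr_ge0// ler_expR.
Qed.

End finite_mean.

Lemma expRN_taylor1 (R : realType) (y : R) : 0 <= y ->
  `|1 - y - expR (- y)| <= y ^+ 2.
Proof.
move=> y0.
have e1 := expR_ge1Dx y; have e2 := expR_ge1Dx (- y).
have : expR (- y) * (1 + y) <= 1.
  by rewrite expRN mulrC ler_pdivrMr ?expR_gt0// mul1r.
rewrite ler0_norm; last by lra.
by set E := expR (- y) => H; nra.
Qed.

Section urn.
Variables (R : realType) (s : nat) (A : 'M[R]_s) (m : R) (x0 : 'rV[R]_s).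
Hypotheses (hm : 0 < m) (hbal : balanced A m).
Hypotheses (hx0 : nonneg_nonzero x0) (hten : tenable A x0).
Implicit Types (x : 'rV[R]_s) (g f : 'rV[R]_s -> R) (theta : 'cV[R]_s).

(** The conditional expectation of [g (X n.+1)] given [X n = x]. *)
Definition urn_step g x : R := \sum_k x 0 k / (\sum_j x 0 j) * g (x + row k A).

(** Expectations are computed by iterating the transition operator, so that
    the asymptotic analysis takes place on functions; [expectation_urn] makes
    the link with the process. *)
Definition urn_exp n g : R := iter n urn_step g x0.

Definition urn_total n : R := \sum_j x0 0 j + n%:R * m.

(** The invariant that keeps the urn in the positive orthant. By its last
    clause a negative diagonal entry divides the content of its colour, so
    that a nonempty colour contains at least one such portion. *)
Definition reachable n x : Prop :=
  [/\ forall k, 0 <= x 0 k, \sum_j x 0 j = urn_total n &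
      forall k, 0 <= A k k \/ exists z : int, x 0 k = A k k *~ z].

Lemma sum_x0_gt0 : 0 < \sum_j x0 0 j.
Proof.
have [x00 xn0] := hx0; rewrite lt_neqAle sumr_ge0// andbT eq_sym.
apply: contra xn0; rewrite psumr_eq0// => /allP H.
apply/eqP/matrixP => i j; rewrite ord1 mxE; apply/eqP/H.
by rewrite mem_index_enum.
Qed.

Lemma urn_total_gt0 n : 0 < urn_total n.
Proof. by rewrite ltr_wpDr ?sum_x0_gt0// mulr_ge0// ltW. Qed.

Lemma tenable_mulz k : A k k < 0 ->
  (exists z : int, x0 0 k = A k k *~ z) /\
  forall i, exists z : int, A i k = A k k *~ z.
Proof.
move=> Ak; have [_ /(_ k)[|E]] := hten; first by rewrite leNgt Ak.
have H y : [set y : R | exists (c : int) (z : 'I_s -> int),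
        y = x0 0 k *~ c + \sum_i (A i k *~ z i)] y -> exists z : int, y = A k k *~ z.
  by rewrite E.
split; first by apply: H; exists 1, (fun=> 0); rewrite big1 ?addr0.
move=> i; apply: H; exists 0, (fun j => (j == i)%:R).
rewrite mulr0z add0r (bigD1 i)//= eqxx mulr1z big1 ?addr0// => j /negbTE ->.
by rewrite mulr0z.
Qed.

Lemma reachable0 : reachable 0 x0.
Proof.
split; first by have [] := hx0.
  by rewrite /urn_total mul0r addr0.
move=> k; have [|/tenable_mulz[H _]] := leP 0 (A k k); [by left|by right].
Qed.

Lemma reachableS n x k : reachable n x -> 0 < x 0 k -> reachable n.+1 (x + row k A).
Proof.
move=> [xge0 xsum xz] xk0; split.
- move=> i; rewrite !mxE; have [<-{i}|ik] := eqVneq k i; last first.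
    by rewrite addr_ge0//; have [H _] := hten; apply: H; rewrite eq_sym.
  have [Akk|Akk] := leP 0 (A k k); first by rewrite addr_ge0.
  case: (xz k) => [|[z E]]; first by rewrite leNgt Akk.
  move: xk0; rewrite E => xk0.
  have z0 : z < 0 by rewrite ltNge; apply/negP => z0; move: xk0; rewrite ltNge mulrz_le0_ge0// ltW.
  rewrite -{2}[A k k]mulr1z -mulrzDr mulrz_le0 ?(ltW Akk)//.
  by rewrite lezD1.
- have -> : \sum_j (x + row k A) 0 j = \sum_j x 0 j + \sum_j A k j.
    by rewrite -big_split; apply: eq_bigr => j _; rewrite !mxE.
  by rewrite xsum hbal /urn_total -natr1; ring.
- move=> i; case: (leP 0 (A i i)) => [|Ai]; [by left|right].
  have [_ /(_ k)[z' Ez']] := tenable_mulz Ai.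
  case: (xz i) => [|[z E]]; first by rewrite leNgt Ai.
  by exists (z + z'); rewrite !mxE E Ez' mulrzDr.
Qed.

Lemma urn_stepE n g x : reachable n x ->
  urn_step g x = \sum_k x 0 k / urn_total n * g (x + row k A).
Proof. by case=> _ xs _; rewrite /urn_step xs. Qed.

(** Transitions through an empty colour have weight zero, so that only
    reachable states matter. *)
Lemma iter_urn_ge0 n j g : (forall x, reachable (n + j) x -> 0 <= g x) ->
  forall x, reachable j x -> 0 <= iter n urn_step g x.
Proof.
elim: n j => [|n IH] j Hg x xj; first exact: Hg.
rewrite iterS (urn_stepE _ xj) sumr_ge0// => k _.
have [xge0 _ _] := xj.
have := xge0 k; rewrite le_eqVlt => /predU1P[<-|xk0]; first by rewrite !mul0r.
rewrite mulr_ge0 ?divr_ge0 ?(ltW (urn_total_gt0 _))//.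
by apply: (IH j.+1); [rewrite addnS|exact: reachableS].
Qed.

Lemma iter_urn_lin n (a b : R) f g x :
  iter n urn_step (fun x => a * f x + b * g x) x =
  a * iter n urn_step f x + b * iter n urn_step g x.
Proof.
elim: n x => [//|n IH] x; rewrite !iterS /urn_step !mulr_sumr -big_split.
by apply: eq_bigr => k _ /=; rewrite IH; ring.
Qed.

Lemma iter_urn_cst n j (c : R) x : reachable j x -> iter n urn_step (fun=> c) x = c.
Proof.
elim: n j x => [//|n IH] j x xj; rewrite iterS (urn_stepE _ xj).
have [xge0 xs _] := xj.
rewrite (eq_bigr (fun k => x 0 k / urn_total j * c)).
  by rewrite -!mulr_suml xs divff ?mul1r// gt_eqF ?urn_total_gt0.
move=> k _; have := xge0 k; rewrite le_eqVlt => /predU1P[<-|xk0].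
  by rewrite !mul0r.
by rewrite (IH j.+1)//; exact: reachableS.
Qed.

Lemma urn_exp0 g : urn_exp 0 g = g x0. Proof. by []. Qed.

Lemma urn_expS n g : urn_exp n.+1 g = urn_exp n (urn_step g).
Proof. by rewrite /urn_exp iterSr. Qed.

Lemma urn_exp_lin n a b f g :
  urn_exp n (fun x => a * f x + b * g x) = a * urn_exp n f + b * urn_exp n g.
Proof. exact: iter_urn_lin. Qed.

Lemma urn_expZ n a f : urn_exp n (fun x => a * f x) = a * urn_exp n f.
Proof.
have := urn_exp_lin n a 0 f f; rewrite mul0r addr0 => <-.
by congr urn_exp; apply/funext => x; rewrite mul0r addr0.
Qed.

Lemma urn_expD n f g : urn_exp n (fun x => f x + g x) = urn_exp n f + urn_exp n g.
Proof.
have := urn_exp_lin n 1 1 f g; rewrite !mul1r => <-.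
by congr urn_exp; apply/funext => x; rewrite !mul1r.
Qed.

Lemma urn_expB n f g : urn_exp n (fun x => f x - g x) = urn_exp n f - urn_exp n g.
Proof.
have := urn_exp_lin n 1 (-1) f g; rewrite mul1r mulN1r => <-.
by congr urn_exp; apply/funext => x; rewrite mul1r mulN1r.
Qed.

Lemma urn_exp_cst n (c : R) : urn_exp n (fun=> c) = c.
Proof. exact: (iter_urn_cst _ _ reachable0). Qed.

Lemma urn_exp_sum n (I : Type) (r : seq I) (f : I -> 'rV[R]_s -> R) :
  urn_exp n (fun x => \sum_(i <- r) f i x) = \sum_(i <- r) urn_exp n (f i).
Proof.
elim: r => [|i r IH].
  rewrite big_nil -[RHS](urn_exp_cst n 0).
  by congr urn_exp; apply/funext => x; rewrite big_nil.
rewrite big_cons -IH -urn_expD.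
by congr urn_exp; apply/funext => x; rewrite big_cons.
Qed.

Lemma urn_exp_le n f g : (forall x, reachable n x -> f x <= g x) ->
  urn_exp n f <= urn_exp n g.
Proof.
move=> fg; rewrite -subr_ge0 -urn_expB; apply: (@iter_urn_ge0 n 0).
  by move=> x; rewrite addn0 => /fg; rewrite subr_ge0.
exact: reachable0.
Qed.

Lemma urn_exp_eq n f g : (forall x, reachable n x -> f x = g x) ->
  urn_exp n f = urn_exp n g.
Proof.
by move=> fg; apply/eqP; rewrite eq_le !urn_exp_le// => x /fg ->.
Qed.

Lemma urn_exp_norm n f : `|urn_exp n f| <= urn_exp n (fun x => `|f x|).
Proof.
rewrite ler_norml; apply/andP; split; last by apply: urn_exp_le => x _; exact: ler_norm.
rewrite lerNl -mulN1r -urn_expZ; apply: urn_exp_le => x _.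
by rewrite mulN1r lerNl lerNnormlW.
Qed.

Section one_step.
Variable v1 : 'rV[R]_s.
Hypothesis hv1 : normalized_left_eigenvector A m v1.

Definition dot x theta : R := (x *m theta) 0 0.
(** Distance of the colour proportions to their limit [v1]. *)
Definition deviation n x : R := \sum_k `|x 0 k / urn_total n - v1 0 k|.
(** The conditional mean of [X n.+1 *m theta] given [X n] is [X n *m pullback
    n theta]. *)
Definition pullback n theta : 'cV[R]_s := (1%:M + (urn_total n)^-1 *: A) *m theta.

Let a : R := \sum_i \sum_j `|A i j|.

Lemma abs_mulA_le theta k : `|(A *m theta) k 0| <= a * rnorm1 theta.
Proof.
rewrite mxE (le_trans (ler_norm_sum _ _ _))//.
have ak : \sum_j `|A k j| <= a.
  by rewrite /a [leRHS](bigD1 k)//= lerDl sumr_ge0// => i _; rewrite sumr_ge0.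
apply: (@le_trans _ _ ((\sum_j `|A k j|) * rnorm1 theta)); last first.
  by rewrite ler_wpM2r// sumr_ge0.
rewrite mulr_suml ler_sum// => j _; rewrite normrM ler_wpM2l//.
by rewrite /rnorm1 (bigD1 j)//= lerDl sumr_ge0.
Qed.

Lemma rnorm1_ge0 theta : 0 <= rnorm1 theta. Proof. exact: sumr_ge0. Qed.
Lemma sum_entries_ge0 : 0 <= a. Proof. by apply: sumr_ge0 => i _; exact: sumr_ge0. Qed.

Section at_x.
Variables (n : nat) (x : 'rV[R]_s) (theta : 'cV[R]_s).
Hypothesis xn : reachable n x.
Let p k : R := x 0 k / urn_total n.
Let al k : R := (A *m theta) k 0.
Let mu : R := \sum_k p k * al k.

Lemma draw_prob_ge0 k : 0 <= p k.
Proof. by have [H _ _] := xn; rewrite divr_ge0 ?(ltW (urn_total_gt0 _)). Qed.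

Lemma draw_prob_sum : \sum_k p k = 1.
Proof. by have [_ H _] := xn; rewrite -mulr_suml H divff// gt_eqF ?urn_total_gt0. Qed.

Lemma dot_draw k : dot (x + row k A) theta = dot x theta + al k.
Proof. by rewrite /dot /al mulmxDl mxE -row_mul [in X in _ + X]mxE. Qed.

Lemma dot_pullback : dot x (pullback n theta) = dot x theta + mu.
Proof.
rewrite /dot /pullback mulmxDl mul1mx mulmxDr mxE; congr (_ + _).
rewrite mxE; apply: eq_bigr => k _.
by rewrite -scalemxAl mxE /p -mulrA.
Qed.

Lemma drift_le : `|mu| <= a * rnorm1 theta.
Proof.
rewrite (le_trans (ler_norm_sum _ _ _))//.
apply: (@le_trans _ _ (\sum_k p k * (a * rnorm1 theta))).
  by rewrite ler_sum// => k _; rewrite normrM ger0_norm ?draw_prob_ge0// ler_wpM2l ?draw_prob_ge0// abs_mulA_le.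
by rewrite -mulr_suml draw_prob_sum mul1r.
Qed.

Let h k : R := al k - mu.

Lemma centered_mean0 : \sum_k p k * h k = 0.
Proof.
rewrite /h; under eq_bigr do rewrite mulrBr.
by rewrite sumrB -mulr_suml draw_prob_sum mul1r subrr.
Qed.

Lemma centered_le k : `|h k| <= 2 * (a * rnorm1 theta).
Proof.
by rewrite (le_trans (ler_normB _ _))// mulrDl mul1r lerD ?abs_mulA_le ?drift_le.
Qed.

Lemma centered_pow_le q : \sum_k p k * `|h k| ^+ q <= (2 * (a * rnorm1 theta)) ^+ q.
Proof.
apply: (@le_trans _ _ (\sum_k p k * (2 * (a * rnorm1 theta)) ^+ q)).
  rewrite ler_sum// => k _; rewrite ler_wpM2l ?draw_prob_ge0// lerXn2r ?nnegrE ?centered_le//.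
  by rewrite mulr_ge0// mulr_ge0 ?rnorm1_ge0 ?sum_entries_ge0.
by rewrite -mulr_suml draw_prob_sum mul1r.
Qed.

Lemma centered_varE : \sum_k p k * h k ^+ 2 = \sum_k p k * al k ^+ 2 - mu ^+ 2.
Proof.
have -> : \sum_k p k * h k ^+ 2 =
   \sum_k p k * al k ^+ 2 - 2 * mu * (\sum_k p k * al k) + (\sum_k p k) * mu ^+ 2.
  rewrite mulr_sumr mulr_suml -sumrB -big_split; apply: eq_bigr => k _ /=.
  by rewrite /h; ring.
by rewrite draw_prob_sum -/mu; ring.
Qed.

(** The proportions are replaced by [v1] in the conditional variance. The
    square of the conditional drift is of the same order as the error, because
    [v1] annihilates [theta]. *)
Lemma centered_var_dev : v1 *m theta = 0 ->
  `|\sum_k p k * h k ^+ 2 - drawform v1 A theta theta| <=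
  3 * (a * rnorm1 theta) ^+ 2 * deviation n x.
Proof.
move=> v1t.
have [v0 v1A v1s] := hv1.
have muE : mu = \sum_k (p k - v1 0 k) * al k.
  under eq_bigr do rewrite mulrBl.
  rewrite sumrB -/mu (_ : \sum_k v1 0 k * al k = 0) ?subr0//.
  have : (v1 *m (A *m theta)) 0 0 = 0 by rewrite mulmxA v1A -scalemxAl v1t scaler0 mxE.
  by rewrite mxE.
set B := a * rnorm1 theta; have B0 : 0 <= B by rewrite mulr_ge0 ?rnorm1_ge0 ?sum_entries_ge0.
have muD : `|mu| <= B * deviation n x.
  rewrite muE (le_trans (ler_norm_sum _ _ _))// mulr_sumr ler_sum// => k _.
  by rewrite normrM mulrC ler_wpM2r// abs_mulA_le.
have muB := drift_le; rewrite -/B in muB.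
have mu2 : mu ^+ 2 <= B * (B * deviation n x).
  by rewrite -real_normK ?num_real// expr2 ler_pM.
have D2 : `|\sum_k p k * al k ^+ 2 - drawform v1 A theta theta| <= B ^+ 2 * deviation n x.
  rewrite /drawform -sumrB (le_trans (ler_norm_sum _ _ _))// mulr_sumr ler_sum// => k _.
  rewrite -/(al k) (_ : _ - _ = (p k - v1 0 k) * al k ^+ 2); last by ring.
  rewrite normrM mulrC ler_wpM2r// ger0_norm ?sqr_ge0// -real_normK ?num_real//.
  by rewrite lerXn2r ?nnegrE// abs_mulA_le.
rewrite centered_varE.
have -> : \sum_k p k * al k ^+ 2 - mu ^+ 2 - drawform v1 A theta theta =
  (\sum_k p k * al k ^+ 2 - drawform v1 A theta theta) - mu ^+ 2 by ring.
rewrite (le_trans (ler_normB _ _))// [`|mu ^+ 2|]ger0_norm ?sqr_ge0//.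
have D0 : 0 <= deviation n x by apply: sumr_ge0.
have : 0 <= B ^+ 2 * deviation n x by rewrite mulr_ge0 ?sqr_ge0.
rewrite (_ : 3 * B ^+ 2 * _ = 3 * (B ^+ 2 * deviation n x)); last by ring.
rewrite (_ : B * (B * _) = B ^+ 2 * deviation n x) in mu2; last by ring.
by lra.
Qed.

Lemma drawform_le : `|drawform v1 A theta theta| <= (a * rnorm1 theta) ^+ 2.
Proof.
have [v0 v1A v1s] := hv1.
rewrite /drawform (le_trans (ler_norm_sum _ _ _))//.
rewrite -[leRHS]mul1r -v1s mulr_suml ler_sum// => k _.
rewrite -mulrA normrM ler_wpM2l// -expr2 ger0_norm ?sqr_ge0// -real_normK ?num_real//.
by rewrite lerXn2r ?nnegrE ?abs_mulA_le// mulr_ge0 ?rnorm1_ge0 ?sum_entries_ge0.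
Qed.

Lemma drawform_ge0 : 0 <= drawform v1 A theta theta.
Proof.
have [v0 v1A v1s] := hv1.
by apply: sumr_ge0 => k _; rewrite -mulrA mulr_ge0 -?expr2 ?sqr_ge0 ?ltW.
Qed.

(** One step of Lindeberg's method: a draw multiplies the cosine by the
    Gaussian factor of its variance, up to terms of third order in [theta] and
    the cost of replacing the proportions by [v1]. *)
Lemma urn_step_cos b : v1 *m theta = 0 ->
  `|urn_step (fun y => cos (dot y theta + b)) x -
    expR (- (drawform v1 A theta theta / 2)) * cos (dot x (pullback n theta) + b)|
  <= (8 * a ^+ 3 + a ^+ 4 + 3 * a ^+ 2) *
     (rnorm1 theta ^+ 3 + rnorm1 theta ^+ 4 + rnorm1 theta ^+ 2 * deviation n x).
Proof.
move=> v1t; rewrite (urn_stepE _ xn) dot_pullback.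
set z := dot x theta + mu + b.
have -> : \sum_k x 0 k / urn_total n * cos (dot (x + row k A) theta + b) =
   \sum_k p k * cos (z + h k).
  apply: eq_bigr => k _; rewrite dot_draw; congr (_ * cos _).
  by rewrite /z /h; ring.
have H1 := mean_cos_taylor draw_prob_ge0 draw_prob_sum centered_mean0 z.
have H1' := le_trans H1 (centered_pow_le 3).
have H2 := centered_var_dev v1t.
set V := \sum_k p k * h k ^+ 2 in H1 H1' H2.
set G := drawform v1 A theta theta in H2 *.
have G0 : 0 <= G by exact: drawform_ge0.
have H3 : `|1 - G / 2 - expR (- (G / 2))| <= (G / 2) ^+ 2.
  by apply: expRN_taylor1; rewrite divr_ge0.
have G2 : (G / 2) ^+ 2 <= (a * rnorm1 theta) ^+ 4.
  have := drawform_le; rewrite -/G ger0_norm// => GB.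
  have -> : (a * rnorm1 theta) ^+ 4 = ((a * rnorm1 theta) ^+ 2) ^+ 2 by rewrite -exprM.
  rewrite lerXn2r ?nnegrE ?divr_ge0 ?sqr_ge0//.
  by apply: le_trans GB; lra.
have c1 : `|cos z| <= 1 by exact: cos_max.
set S := \sum_k p k * cos (z + h k) in H1' *.
have -> : S - expR (- (G / 2)) * cos z =
   (S - (1 - V / 2) * cos z) + ((1 - G / 2 - expR (- (G / 2))) - (V - G) / 2) * cos z.
  by field.
rewrite (le_trans (ler_normD _ _))// normrM.
have H4 : `|1 - G / 2 - expR (- (G / 2)) - (V - G) / 2| <=
    (a * rnorm1 theta) ^+ 4 + 3 * (a * rnorm1 theta) ^+ 2 * deviation n x.
  rewrite (le_trans (ler_normB _ _))// lerD//; first exact: (le_trans H3).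
  rewrite normrM (ger0_norm (_ : 0 <= 2^-1)) ?invr_ge0//.
  apply: le_trans H2; have := normr_ge0 (V - G); lra.
have H5 : `|1 - G / 2 - expR (- (G / 2)) - (V - G) / 2| * `|cos z| <=
    (a * rnorm1 theta) ^+ 4 + 3 * (a * rnorm1 theta) ^+ 2 * deviation n x.
  apply: le_trans H4; by rewrite ler_piMr.
apply: (le_trans (lerD H1' H5)).
have a0 := sum_entries_ge0; have t0 := rnorm1_ge0 theta.
have D0 : 0 <= deviation n x by apply: sumr_ge0.
have e1 : 0 <= 8 * a ^+ 3 by rewrite mulr_ge0 ?exprn_ge0.
have e2 : 0 <= a ^+ 4 by rewrite exprn_ge0.
have e3 : 0 <= 3 * a ^+ 2 by rewrite mulr_ge0 ?exprn_ge0.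
have f1 : 0 <= rnorm1 theta ^+ 3 by rewrite exprn_ge0.
have f2 : 0 <= rnorm1 theta ^+ 4 by rewrite exprn_ge0.
have f3 : 0 <= rnorm1 theta ^+ 2 * deviation n x by rewrite mulr_ge0 ?exprn_ge0.
rewrite (_ : (2 * (a * rnorm1 theta)) ^+ 3 = 8 * a ^+ 3 * rnorm1 theta ^+ 3); last by ring.
rewrite exprMn (_ : 3 * (a * rnorm1 theta) ^+ 2 * _ = 3 * a ^+ 2 * (rnorm1 theta ^+ 2 * deviation n x)); last by ring.
move: (8 * a ^+ 3) (a ^+ 4) (3 * a ^+ 2) (rnorm1 theta ^+ 3) (rnorm1 theta ^+ 4) (rnorm1 theta ^+ 2 * deviation n x) e1 e2 e3 f1 f2 f3 => u1 u2 u3 w1 w2 w3.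
move=> *; nra.
Qed.

(** The same step for exponentials, where an upper bound of second order is
    enough. *)
Lemma urn_step_exp B : rnorm1 theta <= B ->
  urn_step (fun y => expR (dot y theta)) x <=
  expR (4 * a ^+ 2 * expR (2 * (a * B)) * rnorm1 theta ^+ 2) * expR (dot x (pullback n theta)).
Proof.
move=> tB; rewrite (urn_stepE _ xn) dot_pullback.
have -> : \sum_k x 0 k / urn_total n * expR (dot (x + row k A) theta) =
   \sum_k p k * expR (dot x theta + mu + h k).
  apply: eq_bigr => k _; rewrite dot_draw; congr (_ * expR _).
  by rewrite /h; ring.
have hB k : `|h k| <= 2 * (a * B).
  by rewrite (le_trans (centered_le k))// ler_wpM2l// ler_wpM2l ?sum_entries_ge0.
rewrite (le_trans (mean_expR_quad draw_prob_ge0 draw_prob_sum centered_mean0 _ hB))//.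
rewrite mulrC ler_wpM2r ?expR_ge0//.
apply: le_trans (expR_ge1Dx _); rewrite lerD2l.
apply: (@le_trans _ _ (expR (2 * (a * B)) * (2 * (a * rnorm1 theta)) ^+ 2)).
  rewrite ler_wpM2l ?expR_ge0//.
  apply: le_trans (centered_pow_le 2); rewrite ler_sum// => k _.
  by rewrite real_normK ?num_real.
by rewrite le_eqVlt; apply/orP; left; apply/eqP; ring.
Qed.

End at_x.

Lemma urn_exp_cos_step : exists K, 0 <= K /\ forall n theta b, v1 *m theta = 0 ->
  `|urn_exp n.+1 (fun y => cos (dot y theta + b)) -
    expR (- (drawform v1 A theta theta / 2)) *
      urn_exp n (fun y => cos (dot y (pullback n theta) + b))|
  <= K * (rnorm1 theta ^+ 3 + rnorm1 theta ^+ 4 +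
          rnorm1 theta ^+ 2 * urn_exp n (deviation n)).
Proof.
exists (8 * a ^+ 3 + a ^+ 4 + 3 * a ^+ 2); split.
  by rewrite !addr_ge0 ?mulr_ge0 ?exprn_ge0 ?sum_entries_ge0.
move=> n theta b v1t; rewrite urn_expS -urn_expZ -urn_expB.
rewrite (le_trans (urn_exp_norm _ _))//.
rewrite (le_trans (urn_exp_le (fun x xn => urn_step_cos xn b v1t)))//.
by rewrite urn_expZ urn_expD urn_exp_cst urn_expZ.
Qed.

Lemma urn_exp_exp_step B : exists K, 0 <= K /\ forall n theta, rnorm1 theta <= B ->
  urn_exp n.+1 (fun y => expR (dot y theta)) <=
  expR (K * rnorm1 theta ^+ 2) * urn_exp n (fun y => expR (dot y (pullback n theta))).
Proof.
exists (4 * a ^+ 2 * expR (2 * (a * B))); split.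
  by rewrite !mulr_ge0 ?exprn_ge0 ?sum_entries_ge0 ?expR_ge0.
move=> n theta tB; rewrite urn_expS -urn_expZ.
by apply: urn_exp_le => x xn; exact: urn_step_exp.
Qed.

(** Iteration of the one-step estimate along an array that is carried
    backwards in time by [pullback]. *)
Lemma urn_exp_cos_array : exists K, 0 <= K /\
  forall N (theta : nat -> 'cV[R]_s) b, (forall j, (j < N)%N -> theta j = pullback j (theta j.+1)) ->
  (forall j, (j <= N)%N -> v1 *m theta j = 0) ->
  `|urn_exp N (fun y => cos (dot y (theta N) + b)) -
    expR (- ((\sum_(0 <= j < N) drawform v1 A (theta j.+1) (theta j.+1)) / 2)) *
      cos (dot x0 (theta 0%N) + b)|
  <= K * \sum_(0 <= j < N) (rnorm1 (theta j.+1) ^+ 3 + rnorm1 (theta j.+1) ^+ 4 +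
          rnorm1 (theta j.+1) ^+ 2 * urn_exp j (deviation j)).
Proof.
have [K [K0 HK]] := urn_exp_cos_step; exists K; split => // N theta b Ht Hv.
have H n : (n <= N)%N -> `|urn_exp n (fun y => cos (dot y (theta n) + b)) -
    expR (- ((\sum_(0 <= j < n) drawform v1 A (theta j.+1) (theta j.+1)) / 2)) *
      cos (dot x0 (theta 0%N) + b)|
  <= K * \sum_(0 <= j < n) (rnorm1 (theta j.+1) ^+ 3 + rnorm1 (theta j.+1) ^+ 4 +
          rnorm1 (theta j.+1) ^+ 2 * urn_exp j (deviation j)).
  elim: n => [|n IH] nN.
    by rewrite !big_geq// urn_exp0 mul0r oppr0 expR0 mul1r subrr normr0 mulr0.
  rewrite !big_nat_recr//= [(_ + drawform _ _ _ _) / 2]mulrDl opprD expRD.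
  rewrite [K * (\sum_(0 <= j < n) _ + _)]mulrDr.
  have := HK n (theta n.+1) b (Hv _ nN); rewrite -(Ht _ nN).
  have := IH (ltnW nN).
  set S := K * \sum_(0 <= j < n) _; set F := urn_exp n.+1 _.
  set P := urn_exp n _; set E := expR (- ((\sum_(0 <= j < n) _) / 2)).
  set G := expR (- (drawform _ _ _ _ / 2)); set c := cos _; set D := K * _.
  move=> h1 h2.
  have -> : F - E * G * c = (F - G * P) + G * (P - E * c) by ring.
  rewrite (le_trans (ler_normD _ _))// addrC lerD// normrM.
  apply: le_trans h1; rewrite ler_piMl// ger0_norm ?expR_ge0// -expR0 ler_expR.
  by rewrite oppr_le0 divr_ge0// drawform_ge0.
exact: H.
Qed.

Lemma urn_exp_exp_array B : exists K, 0 <= K /\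
  forall N (theta : nat -> 'cV[R]_s), (forall j, (j < N)%N -> theta j = pullback j (theta j.+1)) ->
  (forall j, (j <= N)%N -> rnorm1 (theta j) <= B) ->
  urn_exp N (fun y => expR (dot y (theta N))) <=
  expR (K * \sum_(0 <= j < N) rnorm1 (theta j.+1) ^+ 2) * expR (dot x0 (theta 0%N)).
Proof.
have [K [K0 HK]] := urn_exp_exp_step B; exists K; split => // N theta Ht HB.
have H n : (n <= N)%N -> urn_exp n (fun y => expR (dot y (theta n))) <=
  expR (K * \sum_(0 <= j < n) rnorm1 (theta j.+1) ^+ 2) * expR (dot x0 (theta 0%N)).
  elim: n => [|n IH] nN; first by rewrite big_geq// urn_exp0 mulr0 expR0 mul1r.
  rewrite (le_trans (HK n (theta n.+1) (HB _ nN)))// -(Ht _ nN).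
  rewrite big_nat_recr//= mulrDr expRD.
  rewrite [leRHS](_ : _ = expR (K * rnorm1 (theta n.+1) ^+ 2) *
    (expR (K * \sum_(0 <= j < n) rnorm1 (theta j.+1) ^+ 2) * expR (dot x0 (theta 0%N)))); last by ring.
  by rewrite ler_wpM2l ?expR_ge0// IH// ltnW.
exact: H.
Qed.

End one_step.
End urn.

(** * Cosine transforms of the normalised urn *)

Lemma cvg_near_eq (R : realType) (u v : nat -> R) (l : R) :
  (\forall n \near \oo, u n = v n) -> u n @[n --> \oo] --> l -> v n @[n --> \oo] --> l.
Proof.
move=> uv /cvgrPdist_le ul; apply/cvgrPdist_le => e e0; near=> n.
have <- : u n = v n by near: n.
by near: n; exact: ul.
Unshelve. all: by end_near. Qed.

Section normalisation.
Variables (R : realType) (kappa : R).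
Hypothesis kappa_gt0 : 0 < kappa.

Lemma ln_nat_cvgy : ln (n%:R : R) @[n --> \oo] --> +oo.
Proof.
apply/cvgryPge => B; have /cvgryPge/(_ (expR B)) := @cvgr_idn R.
apply: filterS => n Bn; rewrite -[B]expRK ler_ln ?posrE ?expR_gt0//.
by rewrite (lt_le_trans _ Bn) ?expR_gt0.
Qed.

Lemma ln_nat_gt0_near : \forall n \near \oo, 0 < ln (n%:R : R).
Proof. by have /cvgryPgt/(_ 0) := ln_nat_cvgy. Qed.

Lemma invln_cvg0 : (ln (n%:R : R))^-1 @[n --> \oo] --> (0 : R).
Proof.
apply/cvgrPdist_le => e e0; have /cvgryPge/(_ e^-1) := ln_nat_cvgy.
apply: filterS => n en; rewrite sub0r normrN ger0_norm; last first.
  by rewrite invr_ge0 (le_trans _ en)// invr_ge0 ltW.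
by rewrite -[leRHS]invrK lef_pV2// posrE ?invr_gt0// (lt_le_trans _ en)// invr_gt0.
Qed.

Lemma harm_ln_ratio c : (c + harm kappa 0 n) / ln n%:R @[n --> \oo] --> (1 : R).
Proof.
pose C := `|c| + kappa^-1 + `|ln kappa| + `|ln ((1 + kappa) / kappa)|.
suff H : (c + harm kappa 0 n) / ln n%:R - 1 @[n --> \oo] --> (0 : R).
  have H1 : ((c + harm kappa 0 n) / ln n%:R - 1) + 1 @[n --> \oo] --> (0 + 1 : R).
    by apply: cvgD => //; exact: cvg_cst.
  rewrite add0r in H1; apply: cvg_near_eq H1.
  by apply: nearW => n /=; rewrite subrK.
apply: (@cvg0_norm_le _ _ (fun n => C * (ln n%:R)^-1)); last first.
  by rewrite -[X in _ --> X](mulr0 C); apply: cvgM; [exact: cvg_cst|exact: invln_cvg0].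
near=> n.
have l0 : 0 < ln (n%:R : R) by near: n; exact: ln_nat_gt0_near.
have n0 : (0 < n)%N by near: n; exact: nbhs_infty_gt.
have nr0 : 0 < (n%:R : R) by rewrite ltr0n.
have -> : (c + harm kappa 0 n) / ln n%:R - 1 = (c + (harm kappa 0 n - ln n%:R)) / ln n%:R.
  by field; rewrite gt_eqF.
rewrite normrM [`|_^-1|]gtr0_norm ?invr_gt0// ler_pM2r ?invr_gt0//.
have k1 : 0 < (1 + kappa) / kappa by rewrite divr_gt0// addr_gt0.
have h1 : - ln kappa <= harm kappa 0 n - ln n%:R.
  rewrite lerBrDr; apply: le_trans (ln_le_harm kappa_gt0 n).
  rewrite addrC -ln_div ?posrE// ler_ln ?posrE ?divr_gt0 ?tau_gt0//.
  by rewrite ler_pM2r ?invr_gt0// /tau lerDr ltW.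
have h2 : harm kappa 0 n - ln n%:R <= kappa^-1 + ln ((1 + kappa) / kappa).
  rewrite lerBlDr (le_trans (harm_le_ln kappa_gt0 n))// -addrA lerD2l.
  rewrite -lnM ?posrE// ler_ln ?posrE ?divr_gt0 ?mulr_gt0 ?tau_gt0 ?addr_gt0 ?invr_gt0//.
  rewrite mulrAC ler_pM2r ?invr_gt0// /tau mulrDl mul1r addrC lerD2l.
  by rewrite ler_peMr ?(ltW kappa_gt0)// ler1n.
have ki : 0 <= kappa^-1 by rewrite invr_ge0 ltW.
rewrite (le_trans (ler_normD _ _))// /C -!addrA lerD2l.
have := ler_norm (ln ((1 + kappa) / kappa)).
have := ler_norm (- ln kappa); rewrite normrN.
have := ler_norm (ln kappa).
have := normr_ge0 (ln ((1 + kappa) / kappa)).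
have := normr_ge0 (ln kappa).
move: `|ln kappa| `|ln _| => p q p0 q0 p1 p2 q1.
by rewrite ler_norml; apply/andP; split; lra.
Unshelve. all: by end_near. Qed.

Lemma tau_ratio : tau kappa n / n%:R @[n --> \oo] --> (1 : R).
Proof.
have H : 1 + kappa * (n%:R)^-1 @[n --> \oo] --> (1 + kappa * 0 : R).
  apply: cvgD; first exact: cvg_cst.
  apply: cvgM; first exact: cvg_cst.
  apply/cvgrPdist_le => e e0; have /cvgryPge/(_ e^-1) := @cvgr_idn R.
  apply: filterS => n en; rewrite sub0r normrN ger0_norm ?invr_ge0//.
  by rewrite -[leRHS]invrK lef_pV2// posrE ?invr_gt0// (lt_le_trans _ en)// invr_gt0.
rewrite mulr0 addr0 in H; apply: cvg_near_eq H; near=> n.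
have n0 : (0 < n)%N by near: n; exact: nbhs_infty_gt.
by rewrite /tau mulrDl divff ?pnatr_eq0 -?lt0n// addrC.
Unshelve. all: by end_near. Qed.

Lemma sqrt_inv_harm_cvg0 c : 0 <= c ->
  Num.sqrt (c / (1 + harm kappa 0 N)) @[N --> \oo] --> (0 : R).
Proof.
move=> c0.
have -> : (fun N => Num.sqrt (c / (1 + harm kappa 0 N))) =
    (fun N => Num.sqrt c * Num.sqrt (1 + harm kappa 0 N)^-1).
  by apply/funext => N; rewrite sqrtrM.
rewrite -[X in _ --> X](mulr0 (Num.sqrt c)); apply: cvgM; first exact: cvg_cst.
rewrite -[X in _ --> X]sqrtr0.
apply: (@cvg_comp _ _ _ _ (@Num.sqrt R) _ (nbhs (0 : R))); last exact: sqrt_continuous.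
apply: (@cvg0_norm_le _ _ (fun n => (harm kappa 0 n)^-1)); last exact: inv_harm_cvg0.
near=> N; have h0 : 0 < harm kappa 0 N by near: N; exact: harm_gt0_near.
rewrite ger0_norm ?invr_ge0 ?addr_ge0 ?harm_ge0//.
by rewrite lef_pV2 ?posrE ?addr_gt0// lerDr.
Unshelve. all: by end_near. Qed.

Definition variance_scale (nu n : nat) : R := n%:R * ln n%:R ^+ nu.

Lemma variance_scale_gt0_near nu : \forall n \near \oo, 0 < variance_scale nu n.
Proof.
near=> n.
have l0 : 0 < ln (n%:R : R) by near: n; exact: ln_nat_gt0_near.
have n0 : (0 < n)%N by near: n; exact: nbhs_infty_gt.
by rewrite mulr_gt0 ?ltr0n// exprn_gt0.
Unshelve. all: by end_near. Qed.

Lemma variance_scale_ratio c nu :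
  tau kappa n * (c + harm kappa 0 n) ^+ nu / variance_scale nu n @[n --> \oo] --> (1 : R).
Proof.
have H : tau kappa n / n%:R * ((c + harm kappa 0 n) / ln n%:R) ^+ nu @[n --> \oo] --> (1 * 1 ^+ nu : R).
  apply: cvgM; first exact: tau_ratio.
  apply: (@cvg_comp _ _ _ _ (fun x : R => x ^+ nu) _ _ _ (harm_ln_ratio c)).
  exact: exprn_continuous.
rewrite expr1n mulr1 in H; apply: cvg_near_eq H; apply: nearW => n.
by rewrite /variance_scale expr_div_n invfM mulrACA.
Qed.

Lemma sqrt_variance_scale_tau_cvg0 nu : Num.sqrt (variance_scale nu n) / tau kappa n @[n --> \oo] --> (0 : R).
Proof.
have H : (tau kappa n * (1 + harm kappa 0 n) ^+ nu / variance_scale nu n)^-1 *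
   ((1 + harm kappa 0 n) ^+ nu / tau kappa n) @[n --> \oo] --> (1^-1 * 0 : R).
  apply: cvgM; last exact: pow_harm_tau_cvg0.
  by apply: cvgV; [exact: oner_neq0|exact: variance_scale_ratio].
rewrite mulr0 in H.
apply/cvgrPdist_le => e e0; move/cvgrPdist_le : H => /(_ _ (exprn_gt0 2 e0)) H.
near=> n.
have an0 : 0 < variance_scale nu n by near: n; exact: variance_scale_gt0_near.
have t0 : 0 < tau kappa n by rewrite tau_gt0.
rewrite sub0r normrN ger0_norm ?divr_ge0 ?sqrtr_ge0 ?(ltW t0)//.
rewrite -ler_sqr ?nnegrE ?divr_ge0 ?sqrtr_ge0 ?(ltW t0) ?(ltW e0)//.
rewrite expr_div_n sqr_sqrtr ?(ltW an0)//.
have h0 : 0 < (1 + harm kappa 0 n) ^+ nu by rewrite exprn_gt0// ltr_pwDl ?harm_ge0.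
have : `|0 - (tau kappa n * (1 + harm kappa 0 n) ^+ nu / variance_scale nu n)^-1 *
   ((1 + harm kappa 0 n) ^+ nu / tau kappa n)| <= e ^+ 2 by near: n; exact: H.
rewrite sub0r normrN => /(le_trans (ler_norm _)); apply: le_trans.
by rewrite le_eqVlt; apply/orP; left; apply/eqP; field; rewrite !gt_eqF.
Unshelve. all: by end_near. Qed.

Lemma invsqrt_variance_scale_cvg0 nu : (Num.sqrt (variance_scale nu n))^-1 @[n --> \oo] --> (0 : R).
Proof.
have scy : variance_scale nu n @[n --> \oo] --> +oo.
  apply/cvgryPge => B; near=> n.
  have l1 : 1 <= ln (n%:R : R) by near: n; have /cvgryPge := ln_nat_cvgy; exact.
  have Bn : B <= n%:R by near: n; have /cvgryPge := @cvgr_idn R; exact.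
  by rewrite (le_trans Bn)// ler_peMr// exprn_ege1.
apply/cvgrPdist_le => e e0; have /cvgryPge/(_ (e^-1 ^+ 2)) := scy.
apply: filterS => n en; rewrite sub0r normrN ger0_norm ?invr_ge0 ?sqrtr_ge0//.
have an0 : 0 < variance_scale nu n by rewrite (lt_le_trans _ en)// exprn_gt0// invr_gt0.
rewrite -[leRHS]invrK lef_pV2 ?posrE ?invr_gt0 ?sqrtr_gt0//.
have -> : e^-1 = Num.sqrt (e^-1 ^+ 2) by rewrite sqrtr_sqr gtr0_norm ?invr_gt0.
by rewrite ler_wsqrtr.
Unshelve. all: by end_near. Qed.

End normalisation.

Section clt.
Variables (R : realType) (s : nat) (A : 'M[R]_s) (m : R) (v1 : 'rV[R]_s) (d : nat).
Hypotheses (hm : 0 < m) (hbal : balanced A m) (hirr : irreducible A).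
Hypotheses (hcrit : critically_small A m) (hv1 : normalized_left_eigenvector A m v1).
Hypothesis hd : largest_jordan_block A (m / 2) d.+1.
Variable x0 : 'rV[R]_s.
Hypotheses (hx0 : nonneg_nonzero x0) (hten : tenable A x0).

Local Notation E := (urn_exp A x0).
Local Notation urn_total := (urn_total m x0).
Variable kappa : R.
Hypothesis kappaE : kappa = (\sum_j x0 0 j) / m.
Local Notation nu := (2 * d + 1)%N.
Local Notation a := (@variance_scale R nu).
Local Notation tau := (tau kappa).
Local Notation h := (harm kappa 0).
Local Notation kproj := (kproj v1).
Let offdiag : forall j k, j != k -> 0 <= A k j.
Proof. by case: hten. Qed.

Let kappa_gt0 : 0 < kappa.
Proof. by rewrite kappaE divr_gt0// sum_x0_gt0. Qed.

Lemma urn_total_tau n : urn_total n = m * tau n.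
Proof. by rewrite /urn_total /tau kappaE; field; rewrite gt_eqF. Qed.

(** The statistic [X j *m theta t N j] is the conditional mean at time [j] of
    the normalised and projected statistic of [t] at time [N]. *)
Definition theta (t : 'cV[R]_s) N j : 'cV[R]_s :=
  (Num.sqrt (a N))^-1 *: (rflow A m kappa j N *m (kproj *m t)).

Lemma thetaS t N j : (j < N)%N -> theta t N j = pullback A m x0 j (theta t N j.+1).
Proof.
move=> jN; rewrite /theta /pullback -scalemxAr; congr (_ *: _).
rewrite /rflow flow_recl// -mulmxA; congr (_ *m _); congr (_ + _).
by rewrite urn_total_tau scalerA invfM mulrC.
Qed.

Lemma thetaN t N : theta t N N = (Num.sqrt (a N))^-1 *: (kproj *m t).
Proof. by rewrite /theta /rflow flownn mul1mx. Qed.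

Lemma v1_theta t N j : (j <= N)%N -> v1 *m theta t N j = 0.
Proof.
move=> jN; rewrite /theta -scalemxAr (mulmxA v1).
suff [c ->] : exists c, v1 *m rflow A m kappa j N = c *: v1.
  by rewrite -scalemxAl mulmxA (mulv1_kproj hv1) mul0mx !scaler0.
rewrite -(subnKC jN); elim: (N - j)%N => [|k [c IH]].
  by exists 1; rewrite addn0 /rflow flownn mulmx1 scale1r.
exists (c * (1 + (tau (j + k))^-1)).
rewrite addnS /rflow flowS ?leq_addr// mulmxA IH -scalemxAl mulmxDr mulmx1.
have -> : v1 *m ((tau (j + k))^-1 *: (m^-1 *: A)) = (tau (j + k))^-1 *: v1.
  rewrite -!scalemxAr (mulv1A hv1) !scalerA; congr (_ *: _).
  by rewrite mulfVK// gt_eqF.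
by rewrite scalerDr scalerA -scalerDl mulrDr mulr1.
Qed.

(** The squared flow is of order [exp (harm j N) * h N ^ (2 * d)], that is
    [tau N / tau j * h N ^ (2 * d)]; division by [N * ln N ^ (2 * d + 1)]
    leaves [1 / (tau j * h N)]. *)
Lemma theta_bound t : exists K, 0 <= K /\ \forall N \near \oo, forall j, (j <= N)%N ->
  rnorm1 (theta t N j) ^+ 2 <= K / (tau j * (1 + h N)).
Proof.
have [K0 [K00 HK]] := rflow_growth hm hbal hirr hcrit hv1 hd offdiag t kappa_gt0.
exists (K0 ^+ 2 * expR kappa^-1 * 2); split; first by rewrite !mulr_ge0 ?sqr_ge0 ?expR_ge0.
have /cvgrPdist_le/(_ _ ltr01) H := variance_scale_ratio kappa_gt0 1 nu.
near=> N; move=> j jN.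
have aN0 : 0 < a N by near: N; exact: variance_scale_gt0_near.
have rN : tau N * (1 + h N) ^+ nu <= 2 * a N.
  rewrite -ler_pdivrMr//.
  have : `|1 - tau N * (1 + h N) ^+ nu / a N| <= 1 by near: N; exact: H.
  by rewrite ler_norml => /andP[+ _]; lra.
have h1 : 1 <= 1 + h N by rewrite lerDl harm_ge0.
have h10 : 0 < 1 + h N by rewrite (lt_le_trans _ h1).
have tj := tau_gt0 kappa_gt0 j; have tN := tau_gt0 kappa_gt0 N.
have -> : rnorm1 (theta t N j) = (Num.sqrt (a N))^-1 * rnorm1 (rflow A m kappa j N *m (kproj *m t)).
  rewrite /rnorm1 /theta mulr_sumr; apply: eq_bigr => i _.
  by rewrite mxE normrM ger0_norm// invr_ge0 sqrtr_ge0.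
rewrite exprMn exprVn sqr_sqrtr ?(ltW aN0)//.
set z := rnorm1 _.
have z0 : 0 <= z by exact: rnorm1_ge0.
have Hz : z ^+ 2 <= K0 ^+ 2 * (expR kappa^-1 * (tau N / tau j) * (1 + h N) ^+ (2 * d)).
  apply: (@le_trans _ _ ((K0 * (expR (harm kappa j N / 2) * (1 + harm kappa j N) ^+ d)) ^+ 2)).
    rewrite lerXn2r ?nnegrE ?HK// !mulr_ge0 ?expR_ge0 ?exprn_ge0//.
    by rewrite addr_ge0 ?harm_ge0.
  rewrite !exprMn ler_wpM2l ?sqr_ge0// -exprM [(d * 2)%N]mulnC.
  rewrite expr2 -expRD -splitr.
  apply: ler_pM; rewrite ?expR_ge0 ?exprn_ge0 ?addr_ge0 ?harm_ge0//.
    exact: expR_harm_le.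
  by rewrite lerXn2r ?nnegrE ?addr_ge0 ?harm_ge0// lerD2l harm_le.
rewrite ler_pdivlMr ?mulr_gt0// [(a N)^-1 * _]mulrC mulrAC ler_pdivrMr//.
apply: (@le_trans _ _ (K0 ^+ 2 * expR kappa^-1 * (tau N * (1 + h N) ^+ nu))); last first.
  by rewrite -[leRHS]mulrA ler_wpM2l ?mulr_ge0 ?sqr_ge0 ?expR_ge0.
apply: (le_trans (ler_wpM2r _ Hz)).
  by rewrite mulr_ge0 ?ltW.
rewrite addn1 (exprSr _ (2 * d)).
by rewrite le_eqVlt; apply/orP; left; apply/eqP; field; rewrite gt_eqF.
Unshelve. all: by end_near. Qed.

Lemma sum_invtauS_le N : \sum_(0 <= j < N) (tau j.+1)^-1 <= h N.
Proof.
rewrite /harm big_nat_cond [leRHS]big_nat_cond ler_sum// => i _.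
by rewrite lef_pV2 ?posrE ?tau_gt0// ler_tau.
Qed.

Lemma theta_bounds t : exists K, 0 <= K /\ \forall N \near \oo,
  [/\ forall j, (j <= N)%N -> rnorm1 (theta t N j) ^+ 2 <= K / (tau j * (1 + h N)),
      forall j, (j <= N)%N -> rnorm1 (theta t N j) <= Num.sqrt (K / kappa / (1 + h N)),
      forall j, (j <= N)%N -> rnorm1 (theta t N j) <= Num.sqrt (K / kappa) &
      \sum_(0 <= j < N) rnorm1 (theta t N j.+1) ^+ 2 <= K].
Proof.
have [K [K0 HK]] := theta_bound t; exists K; split => //; near=> N.
have B1 : forall j, (j <= N)%N -> rnorm1 (theta t N j) ^+ 2 <= K / (tau j * (1 + h N)).
  by near: N.
have h1 : 1 <= 1 + h N by rewrite lerDl harm_ge0.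
have h10 : 0 < 1 + h N by rewrite (lt_le_trans _ h1).
have B2 j : (j <= N)%N -> rnorm1 (theta t N j) <= Num.sqrt (K / kappa / (1 + h N)).
  move=> jN; rewrite -(ger0_norm (rnorm1_ge0 _)) -sqrtr_sqr ler_wsqrtr//.
  rewrite (le_trans (B1 j jN))// -mulrA ler_wpM2l// -invfM.
  rewrite lef_pV2 ?posrE ?mulr_gt0 ?tau_gt0//.
  by rewrite ler_wpM2r ?(ltW h10)// tau_ge.
split => // [j jN|].
  rewrite (le_trans (B2 j jN))// ler_wsqrtr//.
  by rewrite ler_pdivrMr// ler_peMr// divr_ge0// ltW.
apply: (@le_trans _ _ (\sum_(0 <= j < N) K / (1 + h N) * (tau j.+1)^-1)).
  rewrite big_nat_cond [leRHS]big_nat_cond ler_sum// => j; rewrite andbT => /andP[_ jN].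
  by rewrite -mulrA -invfM [(1 + h N) * _]mulrC B1.
rewrite -mulr_sumr.
apply: (@le_trans _ _ (K / (1 + h N) * (1 + h N))); last by rewrite divfK ?gt_eqF.
rewrite ler_wpM2l ?divr_ge0 ?(ltW h10)// (le_trans (sum_invtauS_le N))//.
by rewrite lerDr.
Unshelve. all: by end_near. Qed.

Lemma dot_le x (t : 'cV[R]_s) : `|dot x t| <= (\sum_j `|x 0 j|) * rnorm1 t.
Proof.
rewrite /dot mxE (le_trans (ler_norm_sum _ _ _))// mulr_suml ler_sum// => k _.
rewrite normrM ler_wpM2l//.
by rewrite /rnorm1 (bigD1 k)//= lerDl sumr_ge0.
Qed.

Lemma exp_theta_bound t : exists C, \forall N \near \oo,
  E N (fun x => expR (dot x (theta t N N))) <= C.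
Proof.
have [K [K0 HK]] := theta_bounds t.
have [K2 [K20 HK2]] := urn_exp_exp_array hm hbal hx0 hten (Num.sqrt (K / kappa)).
exists (expR (K2 * K) * expR ((\sum_j `|x0 0 j|) * Num.sqrt (K / kappa))).
near=> N.
have [B1 B2 B3 B4] : [/\ forall j, (j <= N)%N -> rnorm1 (theta t N j) ^+ 2 <= K / (tau j * (1 + h N)),
      forall j, (j <= N)%N -> rnorm1 (theta t N j) <= Num.sqrt (K / kappa / (1 + h N)),
      forall j, (j <= N)%N -> rnorm1 (theta t N j) <= Num.sqrt (K / kappa) &
      \sum_(0 <= j < N) rnorm1 (theta t N j.+1) ^+ 2 <= K] by near: N.
rewrite (le_trans (HK2 N (theta t N) (fun j jN => thetaS t jN) B3))//.
apply: ler_pM; rewrite ?expR_ge0// ler_expR; first by rewrite ler_wpM2l.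
rewrite (le_trans (ler_norm _))// (le_trans (dot_le _ _))// ler_wpM2l ?B3//.
by rewrite sumr_ge0.
Unshelve. all: by end_near. Qed.

Lemma dot_kproj n x t : reachable A m x0 n x ->
  dot x (kproj *m t) = dot x t - urn_total n * dot v1 t.
Proof.
case=> _ xs _; rewrite /dot /kproj mulmxBl mul1mx mulmxBr mxE; congr (_ + _).
rewrite mxE !mulmxA -mulmxA [x *m _]mx11_scalar mul_scalar_mx mxE; congr (- (_ * _)).
by rewrite mxE -xs; apply: eq_bigr => j _; rewrite mxE mulr1.
Qed.

(** A law of large numbers for the proportions, deduced from exponential
    moments: [`|y| <= exp y + exp (- y)] for the normalised coordinates [y]
    bounds the mean deviation by a constant times [sqrt (a n) / tau n]. *)
Lemma deviation_cvg0 : E n (deviation m x0 v1 n) @[n --> \oo] --> 0.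
Proof.
have /choice[C HC] : forall q : 'I_s * bool, exists C, \forall N \near \oo,
    E N (fun x => expR (dot x (theta ((-1) ^+ q.2 *: delta_mx q.1 0) N N))) <= C.
  by move=> q; exact: exp_theta_bound.
pose K := \sum_k (C (k, false) + C (k, true)) / m.
apply: (@cvg0_norm_le _ _ (fun n => K * (Num.sqrt (a n) / tau n))); last first.
  rewrite -[X in _ --> X](mulr0 K); apply: cvgM; first exact: cvg_cst.
  exact: sqrt_variance_scale_tau_cvg0.
near=> n.
have an0 : 0 < a n by near: n; exact: variance_scale_gt0_near.
have HCn (q : 'I_s * bool) : E n (fun x => expR (dot x (theta ((-1) ^+ q.2 *: delta_mx q.1 0) n n))) <= C q.
  by move: q; near: n; apply: filter_forall => q; exact: HC.
have s0 : 0 < Num.sqrt (a n) by rewrite sqrtr_gt0.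
have tn := tau_gt0 kappa_gt0 n.
rewrite ger0_norm; last first.
  rewrite -(urn_exp_cst hm hbal hx0 hten n 0); apply: (urn_exp_le hm hbal hx0 hten) => x _.
  by rewrite sumr_ge0.
apply: (@le_trans _ _ (\sum_k (E n (fun x => expR (dot x (theta ((-1) ^+ false *: delta_mx k 0) n n))) +
   E n (fun x => expR (dot x (theta ((-1) ^+ true *: delta_mx k 0) n n)))) / m * (Num.sqrt (a n) / tau n))); last first.
  rewrite /K mulr_suml ler_sum// => k _; rewrite ler_wpM2r ?divr_ge0 ?(ltW s0) ?(ltW tn)//.
  rewrite ler_wpM2r ?invr_ge0 ?(ltW hm)// lerD//.
    exact: (HCn (k, false)).
  exact: (HCn (k, true)).
rewrite (_ : \sum_k _ = E n (fun x => \sum_k (expR (dot x (theta ((-1) ^+ false *: delta_mx k 0) n n)) +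
   expR (dot x (theta ((-1) ^+ true *: delta_mx k 0) n n))) * (m^-1 * (Num.sqrt (a n) / tau n)))); last first.
  rewrite [RHS](_ : _ = \sum_k E n (fun x => (expR (dot x (theta ((-1) ^+ false *: delta_mx k 0) n n)) +
   expR (dot x (theta ((-1) ^+ true *: delta_mx k 0) n n))) * (m^-1 * (Num.sqrt (a n) / tau n)))).
    apply: eq_bigr => k _; rewrite -urn_expD -mulrA [LHS]mulrC -urn_expZ.
    by congr (urn_exp _ _ _ _); apply/funext => x; rewrite mulrC.
  exact: (urn_exp_sum hm hbal hx0 hten).
apply: (urn_exp_le hm hbal hx0 hten) => x xn; rewrite /deviation ler_sum// => k _.
set y := dot x (kproj *m delta_mx k 0) / Num.sqrt (a n).
have yE b : dot x (theta ((-1) ^+ b *: delta_mx k 0) n n) = (-1) ^+ b * y.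
  by rewrite thetaN -!scalemxAr /dot -!scalemxAr !mxE /y /dot mxE mulrCA [_^-1 * _]mulrC.
rewrite !yE expr0 mul1r expr1 mulN1r.
have -> : x 0 k / urn_total n - v1 0 k = y * (m^-1 * (Num.sqrt (a n) / tau n)).
  rewrite /y (dot_kproj _ xn) /dot -!colE !mxE urn_total_tau.
  by field; rewrite !gt_eqF.
rewrite normrM [X in _ * X <= _]ger0_norm; last first.
  by rewrite mulr_ge0 ?invr_ge0 ?(ltW hm)// divr_ge0 ?(ltW s0) ?(ltW tn).
rewrite ler_wpM2r//.
  by rewrite mulr_ge0 ?invr_ge0 ?(ltW hm)// divr_ge0 ?(ltW s0) ?(ltW tn).
rewrite ler_norml; have := expR_ge1Dx y; have := expR_ge1Dx (- y).
have := expR_ge0 y; have := expR_ge0 (- y).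
by move=> *; apply/andP; split; lra.
Unshelve. all: by end_near. Qed.

(** Third and fourth powers are controlled by the bounded sum of squares and
    the vanishing maximum; the last sum is dominated by a Cesaro mean, in the
    clock, of the vanishing mean deviations. *)
Lemma one_step_errors_cvg0 t : \sum_(0 <= j < N) (rnorm1 (theta t N j.+1) ^+ 3 + rnorm1 (theta t N j.+1) ^+ 4 +
    rnorm1 (theta t N j.+1) ^+ 2 * E j (deviation m x0 v1 j)) @[N --> \oo] --> 0.
Proof.
have [K [K0 HK]] := theta_bounds t.
pose e N : R := Num.sqrt (K / kappa / (1 + h N)).
pose W N : R := \sum_(0 <= j < N) (tau j)^-1 * E j (deviation m x0 v1 j).
have e0 : e N @[N --> \oo] --> 0 by apply: (sqrt_inv_harm_cvg0 kappa_gt0); rewrite divr_ge0// ltW.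
have W0 : W N / h N @[N --> \oo] --> 0.
  have := @stolz_harm R kappa kappa_gt0 W (fun j => E j (deviation m x0 v1 j)) 0%N 0.
  rewrite mul0r; apply; first by move=> n; rewrite /W big_nat_recr.
  by under eq_fun do rewrite expr0 divr1; exact: deviation_cvg0.
have C0 : 0 < 1 + kappa^-1 by rewrite addr_gt0// invr_gt0.
apply: (@cvg0_norm_le _ _ (fun N => e N * K + e N * (Num.sqrt (K / kappa) * K) + K * (W N / h N))); last first.
  have -> : (0 : R) = 0 * K + 0 * (Num.sqrt (K / kappa) * K) + K * 0 by rewrite !mul0r mulr0 !addr0.
  apply: cvgD; last by apply: cvgM; [exact: cvg_cst|].
  by apply: cvgD; apply: cvgM => //; exact: cvg_cst.
near=> N.
have [B1 B2 B3 B4] : [/\ forall j, (j <= N)%N -> rnorm1 (theta t N j) ^+ 2 <= K / (tau j * (1 + h N)),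
      forall j, (j <= N)%N -> rnorm1 (theta t N j) <= Num.sqrt (K / kappa / (1 + h N)),
      forall j, (j <= N)%N -> rnorm1 (theta t N j) <= Num.sqrt (K / kappa) &
      \sum_(0 <= j < N) rnorm1 (theta t N j.+1) ^+ 2 <= K] by near: N.
have h0 : 0 < h N by near: N; exact: harm_gt0_near.
have dev0 j : 0 <= E j (deviation m x0 v1 j).
  rewrite -(urn_exp_cst hm hbal hx0 hten j 0); apply: (urn_exp_le hm hbal hx0 hten) => x _.
  by rewrite sumr_ge0.
have nr2 j : 0 <= rnorm1 (theta t N j) ^+ 2 by rewrite exprn_ge0 ?rnorm1_ge0.
rewrite ger0_norm; last first.
  by apply: sumr_ge0 => j _; rewrite !addr_ge0 ?mulr_ge0 ?exprn_ge0 ?rnorm1_ge0.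
rewrite !big_split/=; apply: lerD; first apply: lerD.
- apply: (@le_trans _ _ (e N * \sum_(0 <= j < N) rnorm1 (theta t N j.+1) ^+ 2)); last first.
    by rewrite ler_wpM2l ?sqrtr_ge0.
  rewrite mulr_sumr big_nat_cond [leRHS]big_nat_cond ler_sum// => j; rewrite andbT => /andP[_ jN].
  by rewrite exprS ler_wpM2r ?B2.
- apply: (@le_trans _ _ (e N * (Num.sqrt (K / kappa) * \sum_(0 <= j < N) rnorm1 (theta t N j.+1) ^+ 2))); last first.
    by rewrite ler_wpM2l ?sqrtr_ge0// ler_wpM2l ?sqrtr_ge0.
  rewrite !mulr_sumr big_nat_cond [leRHS]big_nat_cond ler_sum// => j; rewrite andbT => /andP[_ jN].
  rewrite exprS ler_pM ?rnorm1_ge0 ?exprn_ge0 ?rnorm1_ge0 ?B2// exprS.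
  by rewrite ler_wpM2r ?B3.
- rewrite /W mulr_suml mulr_sumr big_nat_cond [leRHS]big_nat_cond ler_sum// => j; rewrite andbT => /andP[_ jN].
  apply: (@le_trans _ _ (K / (tau j.+1 * (1 + h N)) * E j (deviation m x0 v1 j))).
    by rewrite ler_wpM2r// B1.
  rewrite [leRHS](_ : _ = K / (tau j * h N) * E j (deviation m x0 v1 j)); last first.
    by rewrite invfM; ring.
  rewrite ler_wpM2r// ler_wpM2l// lef_pV2 ?posrE ?mulr_gt0 ?tau_gt0 ?addr_gt0//.
  by apply: ler_pM; rewrite ?tau_ge0 ?harm_ge0 ?ler_tau ?lerDr.
Unshelve. all: by end_near. Qed.

Definition normalised N (x : 'rV[R]_s) : 'rV[R]_s :=
  (Num.sqrt (a N))^-1 *: (x - (N%:R * m) *: v1).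

(** The total content is [m * (kappa + N)], whereas the centring subtracts [N
    * m]; this is the effect of the difference on the statistic [t]. *)
Definition centering_shift N (t : 'cV[R]_s) : R :=
  (Num.sqrt (a N))^-1 * ((\sum_j x0 0 j) * dot v1 t).

Lemma dot_normalised N x t : reachable A m x0 N x ->
  dot (normalised N x) t = dot x (theta t N N) + centering_shift N t.
Proof.
move=> xN; rewrite thetaN /centering_shift.
have -> : dot x ((Num.sqrt (a N))^-1 *: (kproj *m t)) =
    (Num.sqrt (a N))^-1 * dot x (kproj *m t).
  by rewrite /dot -scalemxAr mxE.
rewrite (dot_kproj _ xN) /urn_total /normalised /dot -scalemxAl mulmxBl -scalemxAl !mxE.
by ring.
Qed.

Lemma centering_shift_cvg0 t : centering_shift N t @[N --> \oo] --> 0.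
Proof.
rewrite -[X in _ --> X](mul0r ((\sum_j x0 0 j) * dot v1 t)); apply: cvgM; last exact: cvg_cst.
exact: invsqrt_variance_scale_cvg0.
Qed.

Lemma urn_exp_bound t : exists C, \forall N \near \oo,
  E N (fun x => expR (dot (normalised N x) t)) <= C.
Proof.
have [C HC] := exp_theta_bound t; exists (expR 1 * `|C|).
have /cvgrPdist_le/(_ _ ltr01) H := centering_shift_cvg0 t.
near=> N.
rewrite (urn_exp_eq hm hbal hx0 hten (g := fun x => expR (centering_shift N t) * expR (dot x (theta t N N)))); last first.
  by move=> x xN; rewrite (dot_normalised _ xN) addrC expRD.
rewrite urn_expZ.
apply: (@le_trans _ _ (expR 1 * E N (fun x => expR (dot x (theta t N N))))).
  rewrite ler_wpM2r//.
    rewrite -(urn_exp_cst hm hbal hx0 hten N 0); apply: (urn_exp_le hm hbal hx0 hten) => x _.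
    exact: expR_ge0.
  rewrite ler_expR; have : `|0 - centering_shift N t| <= 1 by near: N; exact: H.
  by rewrite sub0r normrN; apply: le_trans; exact: ler_norm.
rewrite ler_wpM2l ?expR_ge0// (le_trans _ (ler_norm _))//.
by near: N.
Unshelve. all: by end_near. Qed.

Variable Sigma : 'M[R]_s.
Hypothesis HSigma : forall (x : 'cV[R]_s),
  (h n ^+ nu)^-1 * ((tau n)^-1 *
     raccum A m v1 kappa n (kproj *m x) (kproj *m x)) @[n --> \oo] -->
  (x^T *m Sigma *m x) 0 0.

(** The variance of the array is the accumulated form of [raccum_limit], up to
    the ratio of [tau n * h n ^ nu] to [n * ln n ^ nu]. *)
Lemma drawform_theta_cvg t :
  \sum_(0 <= j < N) drawform v1 A (theta t N j.+1) (theta t N j.+1) @[N --> \oo] -->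
  (t^T *m Sigma *m t) 0 0.
Proof.
have H : (tau n * (0 + h n) ^+ nu / a n) * ((h n ^+ nu)^-1 * ((tau n)^-1 *
     raccum A m v1 kappa n (kproj *m t) (kproj *m t))) @[n --> \oo] -->
     1 * (t^T *m Sigma *m t) 0 0.
  by apply: cvgM => //; exact: variance_scale_ratio.
rewrite mul1r in H; apply: cvg_near_eq H; near=> n.
have an0 : 0 < a n by near: n; exact: variance_scale_gt0_near.
have h0 : 0 < h n by near: n; exact: harm_gt0_near.
rewrite (_ : \sum_(0 <= j < n) _ = (a n)^-1 * raccum A m v1 kappa n (kproj *m t) (kproj *m t)).
  rewrite add0r; field; rewrite tau_neq0//= expf_neq0 ?(gt_eqF h0)//= ?(gt_eqF an0)//.
rewrite /raccum /accum mulr_sumr; apply: eq_bigr => j _.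
rewrite /theta drawformZl drawformC drawformZl mulrA -invfM -expr2 sqr_sqrtr ?(ltW an0)//.
Unshelve. all: by end_near. Qed.

(** In [urn_exp_cos_array] the variance converges, the errors vanish, and the
    initial state contributes nothing because [theta t N 0] tends to zero. *)
Lemma urn_cos_limit t b :
  E N (fun x => cos (dot (normalised N x) t + b)) @[N --> \oo] -->
  expR (- ((t^T *m Sigma *m t) 0 0 / 2)) * cos b.
Proof.
have [K [K0 HK]] := urn_exp_cos_array hm hbal hx0 hten hv1.
pose f N := expR (- ((\sum_(0 <= j < N) drawform v1 A (theta t N j.+1) (theta t N j.+1)) / 2)) *
      cos (dot x0 (theta t N 0%N) + (centering_shift N t + b)).
have fc : f N @[N --> \oo] --> expR (- ((t^T *m Sigma *m t) 0 0 / 2)) * cos b.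
  apply: cvgM.
    apply: (@cvg_comp _ _ _ _ (@expR R) _ (nbhs (- ((t^T *m Sigma *m t) 0 0 / 2)))); last exact: continuous_expR.
    by apply: cvgN; apply: cvgM; [exact: drawform_theta_cvg|exact: cvg_cst].
  apply: (@cvg_comp _ _ _ _ (@cos R) _ (nbhs b)); last exact: continuous_cos.
  suff d0 : dot x0 (theta t N 0%N) @[N --> \oo] --> (0 : R).
    have H : dot x0 (theta t N 0%N) + (centering_shift N t + b) @[N --> \oo] --> (0 + (0 + b) : R).
      apply: cvgD => //; apply: cvgD; first exact: centering_shift_cvg0.
      exact: cvg_cst.
    by rewrite !add0r in H.
  have [K2 [K20 HK2]] := theta_bounds t.
  apply: (@cvg0_norm_le _ _ (fun N => (\sum_j `|x0 0 j|) * Num.sqrt (K2 / kappa / (1 + h N)))).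
    near=> N; rewrite (le_trans (dot_le _ _))// ler_wpM2l ?sumr_ge0//.
    have [_ B2 _ _] : [/\ forall j, (j <= N)%N -> rnorm1 (theta t N j) ^+ 2 <= K2 / (tau j * (1 + h N)),
      forall j, (j <= N)%N -> rnorm1 (theta t N j) <= Num.sqrt (K2 / kappa / (1 + h N)),
      forall j, (j <= N)%N -> rnorm1 (theta t N j) <= Num.sqrt (K2 / kappa) &
      \sum_(0 <= j < N) rnorm1 (theta t N j.+1) ^+ 2 <= K2] by near: N.
    exact: B2.
  rewrite -[X in _ --> X](mulr0 (\sum_j `|x0 0 j|)); apply: cvgM; first exact: cvg_cst.
  by apply: (sqrt_inv_harm_cvg0 kappa_gt0); rewrite divr_ge0// ltW.
have diff0 : E N (fun x => cos (dot (normalised N x) t + b)) - f N @[N --> \oo] --> 0.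
  apply: (@cvg0_norm_le _ _ (fun N => K * \sum_(0 <= j < N) (rnorm1 (theta t N j.+1) ^+ 3 + rnorm1 (theta t N j.+1) ^+ 4 +
    rnorm1 (theta t N j.+1) ^+ 2 * E j (deviation m x0 v1 j)))); last first.
    by rewrite -[X in _ --> X](mulr0 K); apply: cvgM; [exact: cvg_cst|exact: one_step_errors_cvg0].
  near=> N.
  rewrite (urn_exp_eq hm hbal hx0 hten (g := fun x => cos (dot x (theta t N N) + (centering_shift N t + b)))); last first.
    by move=> x xN; rewrite (dot_normalised _ xN) addrA.
  exact: (HK N (theta t N) _ (fun j jN => thetaS t jN) (fun j jN => v1_theta t jN)).
have H : E N (fun x => cos (dot (normalised N x) t + b)) - f N + f N @[N --> \oo] -->
    0 + expR (- ((t^T *m Sigma *m t) 0 0 / 2)) * cos b by exact: cvgD.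
rewrite add0r in H; apply: cvg_near_eq H.
by apply: nearW => N /=; rewrite subrK.
Unshelve. all: by end_near. Qed.

End clt.

(** * The law of the urn process *)

Section finite_range.
Variables (R : realType) (d : measure_display) (T : measurableType d).
Variables (P : probability T R) (U : eqType) (F : T -> U) (V : seq U).
Hypotheses (uniqV : uniq V) (FV : forall w, F w \in V).
Hypothesis mF : forall y, measurable [set w | F w = y].

Lemma finite_range_sum (g : U -> R) w :
  g (F w) = \sum_(y <- V) g y * \1_[set w | F w = y] w.
Proof.
rewrite (bigD1_seq (F w))//= indicE mem_set// mulr1 big1_seq ?addr0// => y /andP[yF _].
by rewrite indicE memNset ?mulr0// => /= E; rewrite E eqxx in yF.
Qed.

Lemma expectation_finite_range (g : U -> R) :
  expectation P (fun w => g (F w)) =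
  (\sum_(y <- V) (g y)%:E * P [set w | F w = y])%E.
Proof.
rewrite unlock.
under eq_integral do rewrite finite_range_sum -sumEFin.
rewrite integral_sum//=.
  apply: eq_bigr => y _.
  under eq_integral do rewrite EFinM.
  rewrite integralZl//; last by apply/integrable_indic => //; rewrite ?ltey_eq ?fin_num_measure.
  by rewrite integral_indic// setIT.
move=> y; under eq_fun do rewrite EFinM.
by apply: integrableZl => //; apply/integrable_indic => //; rewrite ?ltey_eq ?fin_num_measure.
Qed.

End finite_range.

Section urn_law.
Variables (R : realType) (s : nat) (A : 'M[R]_s) (x0 : 'rV[R]_s).
Variables (d : measure_display) (T : measurableType d) (P : probability T R).
Variable X : nat -> T -> 'rV[R]_s.
Hypothesis hX : polya_urn P A x0 X.

Let hist n w : seq 'rV[R]_s := mkseq (fun i => X i w) n.+1.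

(** All possible pasts up to time [n]; conditioning on the past is a finite
    sum over them. *)
Fixpoint histories n : seq (seq 'rV[R]_s) :=
  if n is n'.+1 then
    [seq rcons xi (last 0 xi + row k A) | xi <- histories n', k <- enum 'I_s]
  else [:: [:: x0]].

Lemma last_hist n w : last 0 (hist n w) = X n w.
Proof. by rewrite /hist -nth_last size_mkseq nth_mkseq. Qed.

Lemma histS n w : hist n.+1 w = rcons (hist n w) (X n.+1 w).
Proof. exact: mkseqS. Qed.

Lemma size_histories n xi : xi \in histories n -> size xi = n.+1.
Proof.
elim: n xi => [|n IH] xi /=; first by rewrite inE => /eqP ->.
by case/allpairsP => -[xi' k] [/= /IH xi'n _ ->]; rewrite size_rcons xi'n.
Qed.

Lemma hist_in n w : hist n w \in histories n.
Proof.
have [K [_ X0 XS _]] := hX.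
elim: n => [|n IH] /=; first by rewrite inE -(X0 w).
rewrite histS; apply/allpairsP; exists (hist n w, K n w); split; first exact: IH.
  by rewrite mem_enum.
by rewrite XS -{1}(last_hist n w).
Qed.

Lemma measurable_X n y : measurable [set w | X n w = y].
Proof.
have [K [mK X0 XS _]] := hX.
elim: n y => [|n IH] y.
  have [<-|yx0] := eqVneq x0 y.
    rewrite (_ : [set _ | _] = setT)//.
    by apply/seteqP; split => // w _ /=; rewrite X0.
  rewrite (_ : [set _ | _] = set0)//.
  apply/seteqP; split => // w /=; rewrite X0 => E.
  by rewrite E eqxx in yx0.
rewrite (_ : [set _ | _] = \bigcup_(k : 'I_s)
    ([set w | X n w = y - row k A] `&` K n @^-1` [set k])).
  apply: fin_bigcup_measurable => // k _; apply: measurableI; [exact: IH|exact: mK].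
apply/seteqP; split => w /=.
  by move=> E; exists (K n w) => //=; split => //; rewrite -E XS addrK.
by case=> k _ [/= E1 E2]; rewrite XS E1 E2 subrK.
Qed.

Lemma hist_fibre n (xi : seq 'rV[R]_s) : size xi = n.+1 ->
  [set w | hist n w = xi] = [set w | forall i, (i <= n)%N -> X i w = nth 0 xi i].
Proof.
move=> sxi; apply/seteqP; split => w /=.
  by move=> <- i iN; rewrite nth_mkseq.
move=> H; apply: (@eq_from_nth _ 0); first by rewrite size_mkseq sxi.
by move=> i; rewrite size_mkseq => iN; rewrite nth_mkseq// H.
Qed.

Lemma measurable_hist n xi : measurable [set w | hist n w = xi].
Proof.
have [sxi|sxi] := eqVneq (size xi) n.+1; last first.
  rewrite (_ : [set _ | _] = set0)//.
  apply/seteqP; split => // w /= E; move/negP: sxi; apply.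
  by rewrite -E size_mkseq.
rewrite hist_fibre// (_ : [set _ | _] = \bigcap_(i in [set i | (i <= n)%N]) [set w | X i w = nth 0 xi i]).
  by apply: bigcap_measurableType => i _; exact: measurable_X.
by apply/seteqP; split => w /= H i; exact: H.
Qed.

Lemma expectation_urn_step n (g : 'rV[R]_s -> R) :
  expectation P (fun w => g (X n.+1 w)) =
  expectation P (fun w => urn_step A g (X n w)).
Proof.
have [K [mK X0 XS law]] := hX.
pose H := undup (histories n).
pose V := [seq (xi, k) | xi <- H, k <- enum 'I_s].
have uV : uniq V by apply: allpairs_uniq; rewrite ?undup_uniq ?enum_uniq// => -[? ?] [].
have FV w : (hist n w, K n w) \in V.
  by apply/allpairsP; exists (hist n w, K n w); rewrite mem_undup hist_in mem_enum.
have mF y : measurable [set w | (hist n w, K n w) = y].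
  rewrite (_ : [set _ | _] = [set w | hist n w = y.1] `&` K n @^-1` [set y.2]).
    by apply: measurableI; [exact: measurable_hist|exact: mK].
  by case: y => a b; apply/seteqP; split => w /= [-> ->].
have -> : (fun w => g (X n.+1 w)) =
    (fun w => (fun q => g (last 0 q.1 + row q.2 A)) (hist n w, K n w)).
  by apply/funext => w; rewrite XS -{1}(last_hist n w).
etransitivity.
  exact: (expectation_finite_range P uV FV mF (fun q => g (last 0 q.1 + row q.2 A))).
have -> : (fun w => urn_step A g (X n w)) = (fun w => urn_step A g (last 0 (hist n w))).
  by apply/funext => w; rewrite last_hist.
have FH w : hist n w \in H by rewrite mem_undup hist_in.
apply/esym; etransitivity.
  exact: (expectation_finite_range P (undup_uniq _) FH (@measurable_hist n)
    (fun xi => urn_step A g (last 0 xi))).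
apply/esym.
rewrite big_allpairs; apply: eq_big_seq => xi; rewrite mem_undup => /size_histories sxi.
have E k : [set w | (hist n w, K n w) = (xi, k)] =
    [set w | forall i, (i <= n)%N -> X i w = nth 0 xi i] `&` K n @^-1` [set k].
  by rewrite -hist_fibre//; apply/seteqP; split => w /= [-> ->].
have mpast := @measurable_hist n xi; rewrite (hist_fibre sxi) in mpast.
rewrite hist_fibre//; set past := [set w | _] in E mpast *.
have := law n (nth 0 xi); rewrite -/past => lawxi.
rewrite big_enum/=; under eq_bigr do rewrite E lawxi.
have pE : P past = (fine (P past))%:E by rewrite fineK// fin_num_measure.
rewrite pE; under eq_bigr do rewrite -!EFinM.
rewrite sumEFin -EFinM; congr EFin.
rewrite /urn_step mulr_suml; apply: eq_bigr => k _ /=.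
by rewrite -(nth_last 0) sxi /= mulrCA mulrA.
Qed.

Lemma expectation_urn n (g : 'rV[R]_s -> R) :
  expectation P (fun w => g (X n w)) = (urn_exp A x0 n g)%:E.
Proof.
elim: n g => [|n IH] g; last by rewrite expectation_urn_step IH urn_expS.
have [K [_ X0 _ _]] := hX.
under eq_fun do rewrite X0.
exact: expectation_cst.
Qed.

End urn_law.

(** * Normal laws under affine maps and convolution *)

Section lebesgue_affine.
Variable R : realType.
Local Notation mu := (@lebesgue_measure R).
Local Open Scope ereal_scope.

(** Both sides are measures that agree on half-open intervals. *)
Lemma lebesgue_measure_shift (c : R) (A : set R) : measurable A ->
  pushforward mu ((fun x => x + c)%R : _ -> measurableTypeR R) A = mu A.
Proof.
move=> mA.
have mc : measurable_fun [set: R] ((fun x => x + c)%R : R -> measurableTypeR R).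
  exact: measurable_funD.
pose phi : {mfun R >-> measurableTypeR R} := HB.pack ((fun x => x + c)%R : R -> measurableTypeR R)
  (isMeasurableFun.Build _ _ _ _ _ mc).
apply/esym; apply: (@lebesgue_measure_unique R (pushforward mu phi)) => // _ [[a b]] _ <- /=.
rewrite [RHS](_ : _ = mu [set` `](a - c)%R, (b - c)%R]]); last first.
  rewrite /pushforward; congr (mu _); apply/seteqP.
  by split=> x /=; rewrite !in_itv/= ltrBlDr lerBrDr.
rewrite !lebesgue_measure_itv/= !lte_fin ltrD2r.
by case: ifP => // _; rewrite -!EFinD; congr (_%:E); ring.
Qed.

Lemma ge0_integral_shift (f : R -> \bar R) (c : R) :
  measurable_fun [set: R] f -> (forall x, 0 <= f x) ->
  \int[mu]_x f (x + c)%R = \int[mu]_x f x.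
Proof.
move=> mf f0.
have mc : measurable_fun [set: R] ((fun x => x + c)%R : R -> measurableTypeR R).
  exact: measurable_funD.
pose phi : {mfun R >-> measurableTypeR R} := HB.pack ((fun x => x + c)%R : R -> measurableTypeR R)
  (isMeasurableFun.Build _ _ _ _ _ mc).
transitivity (\int[pushforward mu phi]_x f x).
  by rewrite ge0_integral_pushforward.
by apply: eq_measure_integral => A mA _; exact: lebesgue_measure_shift.
Qed.

Lemma lebesgue_measure_scale (a : R) (A : set R) : (a != 0)%R -> measurable A ->
  `|a|%R%:E * pushforward mu ((fun x => a * x)%R : _ -> measurableTypeR R) A = mu A.
Proof.
move=> a0 mA.
have ma : measurable_fun [set: R] ((fun x => a * x)%R : R -> measurableTypeR R).
  exact: measurable_funM.
pose phi : {mfun R >-> measurableTypeR R} := HB.pack ((fun x => a * x)%R : R -> measurableTypeR R)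
  (isMeasurableFun.Build _ _ _ _ _ ma).
apply/esym; apply: (@lebesgue_measure_unique R (mscale (`|a|%:nng)%R (pushforward mu phi))) => // _ [[x y]] _ <- /=.
rewrite /mscale/=.
have [agt0|alt0|aeq0] := ltgtP 0%R a; last by rewrite -aeq0 eqxx in a0.
  rewrite (_ : pushforward _ _ _ = mu [set` `](x / a)%R, (y / a)%R]]); last first.
    rewrite /pushforward; congr (mu _); apply/seteqP.
    by split=> z /=; rewrite !in_itv/= (mulrC a) ltr_pdivrMr// ler_pdivlMr.
  rewrite !lebesgue_measure_itv/= !lte_fin ltr_pM2r ?invr_gt0//.
  case: ifP => _; last by rewrite mule0.
  by rewrite gtr0_norm// -EFinD -EFinM -mulrBl mulrC divfK ?gt_eqF.
rewrite (_ : pushforward _ _ _ = mu [set` `[(y / a)%R, (x / a)%R[]); last first.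
  rewrite /pushforward; congr (mu _); apply/seteqP.
  by split=> z /=; rewrite !in_itv/= (mulrC a) ltr_ndivlMr// ler_ndivrMr// andbC.
rewrite !lebesgue_measure_itv/= !lte_fin ltr_nM2r ?invr_lt0//.
case: ifP => _; last by rewrite mule0.
by rewrite ltr0_norm// -EFinD -EFinM -mulrBl mulNr mulrC divfK ?lt_eqF// opprB.
Qed.

Lemma ge0_integral_scale (f : R -> \bar R) (a : R) : (a != 0)%R ->
  measurable_fun [set: R] f -> (forall x, 0 <= f x) ->
  `|a|%R%:E * \int[mu]_x f (a * x)%R = \int[mu]_x f x.
Proof.
move=> a0 mf f0.
have ma : measurable_fun [set: R] ((fun x => a * x)%R : R -> measurableTypeR R).
  exact: measurable_funM.
pose phi : {mfun R >-> measurableTypeR R} := HB.pack ((fun x => a * x)%R : R -> measurableTypeR R)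
  (isMeasurableFun.Build _ _ _ _ _ ma).
transitivity (`|a|%R%:E * \int[pushforward mu phi]_x f x).
  by rewrite ge0_integral_pushforward.
have -> : `|a|%R%:E = (NngNum (normr_ge0 a))%:num%:E by [].
rewrite -ge0_integral_mscale//.
by apply: eq_measure_integral => A mA _; exact: lebesgue_measure_scale.
Qed.

End lebesgue_affine.

Section normal.
Variable R : realType.
Local Notation mu := (@lebesgue_measure R).
Local Open Scope ereal_scope.

(** The Radon-Nikodym derivative of a normal law agrees almost everywhere with
    its density. *)
Lemma ge0_integral_normal_prob (m s : R) (f : R -> \bar R) :
  measurable_fun [set: R] f -> (forall x, 0 <= f x) ->
  \int[normal_prob m s]_x f x = \int[mu]_x (f x * (normal_pdf m s x)%:E).
Proof.
move=> mf f0.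
have dom := normal_prob_dominates m s.
rewrite -(Radon_Nikodym_SigmaFinite.change_of_variables dom f0 measurableT mf).
apply: ae_eq_integral => //.
- apply: emeasurable_funM => //.
  by apply: (measurable_int mu); exact: Radon_Nikodym_SigmaFinite.f_integrable.
- apply: emeasurable_funM => //; apply/measurable_EFinP.
  exact: measurable_normal_pdf.
- apply: ae_eqe_mul2l; apply: integral_ae_eq => //.
  + exact: Radon_Nikodym_SigmaFinite.f_integrable.
  + by apply/measurable_EFinP; exact: measurable_normal_pdf.
  + by move=> E _ mE; rewrite -Radon_Nikodym_SigmaFinite.f_integral.
Qed.

(** Completing the square in the exponent. *)
Lemma normal_pdf_tilt (s h x : R) : (s != 0)%R ->
  (expR (h * x) * normal_pdf 0 s x)%R =
  (expR (h ^+ 2 * s ^+ 2 / 2) * normal_pdf (h * s ^+ 2) s x)%R.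
Proof.
move=> s0; rewrite !normal_pdfE// /normal_fun !(mulrCA (expR _)) -!expRD.
by congr (_ * expR _)%R; field.
Qed.

Lemma normal_mgf (s h : R) : (s != 0)%R ->
  \int[normal_prob 0 s]_x (expR (h * x))%:E = (expR (h ^+ 2 * s ^+ 2 / 2))%:E.
Proof.
move=> s0; rewrite ge0_integral_normal_prob; last 2 first.
- apply/measurable_EFinP; apply: measurableT_comp => //; exact: measurable_funM.
- by move=> x; rewrite lee_fin expR_ge0.
under eq_integral do rewrite -EFinM normal_pdf_tilt// EFinM.
rewrite ge0_integralZl//.
- by rewrite integral_normal_pdf mule1.
- by apply/measurable_EFinP; exact: measurable_normal_pdf.
- by move=> x _; rewrite lee_fin normal_pdf_ge0.
Qed.

Lemma normal_prob_shift (c s : R) (B : set R) : measurable B ->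
  (s != 0)%R -> normal_prob 0 s [set u | B (c + u)%R] = normal_prob c s B.
Proof.
move=> mB s0; rewrite /normal_prob integral_mkcond [RHS]integral_mkcond.
rewrite -[LHS](@ge0_integral_shift R _ (- c)); last 2 first.
- apply/(measurable_restrictT _ _).1; last first.
    by apply: measurable_funTS; apply/measurable_EFinP; exact: measurable_normal_pdf.
  rewrite -[X in measurable X]setTI.
  by apply: (measurable_funD (measurable_cst _) (@measurable_id _ _ _)).
- by move=> x; rewrite erestrict_ge0// => ? _; rewrite lee_fin normal_pdf_ge0.
apply: eq_integral => x _; rewrite !patchE.
have -> : (x - c \in [set u | B (c + u)%R])%R = (x \in B).
  apply/idP/idP; rewrite !inE/= addrC subrK//.
case: ifP => // _; rewrite !normal_pdfE// /normal_fun subr0.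
done.
Qed.

Lemma normal_prob_scale (a : R) (B : set R) : measurable B -> (a != 0)%R ->
  normal_prob 0 1 [set x | B (a * x)%R] = normal_prob 0 `|a|%R B.
Proof.
move=> mB a0; rewrite /normal_prob integral_mkcond [RHS]integral_mkcond.
have na0 : (`|a| != 0)%R by rewrite normr_eq0.
have mpdf s : measurable_fun [set: R] (EFin \o normal_pdf 0 s).
  by apply/measurable_EFinP; exact: measurable_normal_pdf.
rewrite -[RHS](@ge0_integral_scale R _ a)//; last 2 first.
- by apply/(measurable_restrictT _ _).1 => //; exact: measurable_funTS (mpdf _).
- by move=> x; rewrite erestrict_ge0// => ? _; rewrite lee_fin normal_pdf_ge0.
have mBa : measurable [set x | B (a * x)%R].
  rewrite -[X in measurable X]setTI.
  by apply: (measurable_funM (measurable_cst _) (@measurable_id _ _ _)).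
rewrite -ge0_integralZl//; last 2 first.
- have mrB : measurable_fun [set: R] ((EFin \o normal_pdf 0 `|a|) \_ B).
    by apply/(measurable_restrictT _ _).1 => //; exact: measurable_funTS (mpdf _).
  have ma : measurable_fun [set: R] (fun x : R => a * x)%R by exact: measurable_funM.
  exact: (measurableT_comp mrB ma).
- by move=> x _; rewrite erestrict_ge0// => ? _; rewrite lee_fin normal_pdf_ge0.
apply: eq_integral => x _; rewrite !patchE.
have -> : (x \in [set u | B (a * u)%R]) = (a * x \in B)%R by apply/idP/idP; rewrite !inE.
case: ifP => _; last by rewrite mule0.
rewrite -EFinM !normal_pdfE ?oner_eq0// /normal_fun mulrA; congr (_ * expR _)%:E.
  rewrite /normal_peak real_normK ?num_real// expr1n mul1r -[(a ^+ 2 * pi *+ 2)%R]mulrnAr.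
  by rewrite sqrtrM ?sqr_ge0// sqrtr_sqr invfM mulrA divff// mul1r.
by rewrite real_normK ?num_real// !subr0; field.
Qed.

(** The joint density of [x] and of a variable with mean [a * x] and deviation
    [s], factored the other way round: the marginal density of the second one
    times the conditional density of [x]. *)
Lemma normal_pdf_conv (a s c x z : R) : (s != 0)%R -> (0 < c)%R ->
  (c ^+ 2 = a ^+ 2 + s ^+ 2)%R ->
  (normal_pdf 0 1 x * normal_pdf (a * x) s z =
   normal_pdf 0 c z * normal_pdf (a * z / c ^+ 2) (s / c) x)%R.
Proof.
move=> s0 c0 cE.
have cn0 : c != 0%R by rewrite gt_eqF.
have c2n0 : (a ^+ 2 + s ^+ 2 != 0)%R by rewrite -cE sqrf_eq0.
have sc0 : (s / c != 0)%R by rewrite mulf_neq0// invr_neq0.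
rewrite !normal_pdfE ?oner_eq0// /normal_fun.
rewrite mulrACA [RHS]mulrACA -!expRD; congr (_ * expR _)%R.
  rewrite /normal_peak -!invfM -!sqrtrM; last 2 first.
  - by rewrite mulrn_wge0// mulr_ge0 ?sqr_ge0 ?pi_ge0.
  - by rewrite mulrn_wge0// mulr_ge0 ?sqr_ge0 ?pi_ge0.
  by congr ((Num.sqrt _)^-1)%R; field.
rewrite expr_div_n cE; field.
by rewrite c2n0.
Qed.

(** By Tonelli the conditional density of the preceding factorisation is
    integrated first, and it has mass one. *)
Lemma normal_prob_conv (a s c : R) (B : set R) : measurable B ->
  (s != 0)%R -> (0 < c)%R -> (c ^+ 2 = a ^+ 2 + s ^+ 2)%R ->
  \int[normal_prob 0 1]_x normal_prob (a * x) s B = normal_prob 0 c B.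
Proof.
move=> mB s0 c0 cE.
pose f (p : measurableTypeR R * measurableTypeR R) : \bar R :=
  (normal_pdf 0 1 p.1 * (\1_B p.2 * normal_pdf (a * p.1) s p.2))%:E.
have f0 p : 0 <= f p by rewrite lee_fin !mulr_ge0 ?normal_pdf_ge0.
have mpdf : measurable_fun [set: R * R] (fun p : R * R => normal_pdf (a * p.1) s p.2).
  rewrite /= (_ : (fun _ => _) = (fun p : R * R => normal_pdf 0 s (p.2 - a * p.1))%R); last first.
    by apply/funext => p; rewrite !normal_pdfE// /normal_fun subr0.
  apply: measurableT_comp; first exact: measurable_normal_pdf.
  by apply: measurable_funB => //; apply: measurable_funM.
have mf : measurable_fun setT f.
  apply/measurable_EFinP; apply: measurable_funM.
    by apply: measurableT_comp => //; exact: measurable_normal_pdf.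
  apply: measurable_funM => //.
  by apply: (measurableT_comp (measurable_indic _)) => //.
have E x : normal_prob (a * x) s B = \int[mu]_z (\1_B z * normal_pdf (a * x) s z)%:E.
  rewrite /normal_prob integral_mkcond; apply: eq_integral => z _.
  rewrite patchE indicE; case: (z \in B); by rewrite ?mul1r ?mul0r.
have mg : measurable_fun setT (fun p : measurableTypeR R * measurableTypeR R =>
    (\1_B p.2 * normal_pdf (a * p.1) s p.2)%:E).
  apply/measurable_EFinP; apply: measurable_funM => //.
  by apply: (measurableT_comp (measurable_indic _)) => //.
rewrite ge0_integral_normal_prob; last 2 first.
- have := @measurable_fun_fubini_tonelli_F _ _ _ _ R mu _ mg.
  rewrite /fubini_F/=; under [X in _ -> measurable_fun _ X]eq_fun do rewrite E.
  by apply => p; rewrite lee_fin mulr_ge0// normal_pdf_ge0.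
- by move=> x; exact: measure_ge0.
transitivity (\int[mu]_x \int[mu]_z f (x, z)).
  apply: eq_integral => x _; rewrite E muleC -ge0_integralZl//=; last 3 first.
  - exact: (measurable_fun_pair2 x mg).
  - by move=> z _; rewrite lee_fin mulr_ge0// normal_pdf_ge0.
  - by rewrite lee_fin normal_pdf_ge0.
rewrite fubini_tonelli//.
transitivity (\int[mu]_z (\1_B z * normal_pdf 0 c z)%:E).
  apply: eq_integral => z _; rewrite /f/=.
  under eq_integral do rewrite mulrCA (normal_pdf_conv _ _ s0 c0 cE) mulrA EFinM.
  rewrite ge0_integralZl//=; last 3 first.
  - by apply/measurable_EFinP; exact: measurable_normal_pdf.
  - by move=> x _; rewrite lee_fin normal_pdf_ge0.
  - by rewrite lee_fin mulr_ge0// normal_pdf_ge0.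
  by rewrite integral_normal_pdf mule1.
rewrite /normal_prob [RHS]integral_mkcond; apply: eq_integral => z _.
by rewrite patchE indicE; case: (z \in B); rewrite ?mul1r ?mul0r.
Qed.

End normal.

(** * Construction of Gaussian vectors *)

Section gaussian_law.
Variable R : realType.
Local Open Scope ereal_scope.

Definition has_normal_law (d : measure_display) (T : measurableType d) (Q : probability T R)
    (U : T -> R) (v : R) : Prop :=
  measurable_fun setT U /\
  forall B : set R, measurable B -> pushforward Q U B = centered_normal_law v B.

Lemma centered_normal_law_std (a : R) (B : set R) : measurable B ->
  normal_prob 0 1 [set x | B (a * x)%R] = centered_normal_law (a ^+ 2) B.
Proof.
move=> mB; rewrite /centered_normal_law sqrf_eq0.
have [->|a0] := eqVneq a 0%R; last by rewrite sqrtr_sqr; exact: normal_prob_scale.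
have [B0|B0] := pselect (B 0%R).
  have -> : [set x : R | B (0 * x)%R] = setT.
    by apply/seteqP; split => x //= _; rewrite mul0r.
  by rewrite diracE mem_set//; exact: probability_setT.
have -> : [set x : R | B (0 * x)%R] = set0.
  by apply/seteqP; split => x //=; rewrite mul0r.
by rewrite diracE memNset// measure0.
Qed.

Lemma centered_normal_law_conv (a v : R) (B : set R) : (0 <= v)%R -> measurable B ->
  \int[normal_prob 0 1]_x centered_normal_law v [set u | B (a * x + u)%R] =
  centered_normal_law (a ^+ 2 + v) B.
Proof.
move=> v0 mB; have [v_eq0|vn0] := eqVneq v 0%R; last first.
  rewrite /centered_normal_law.
  have vgt0 : (0 < v)%R by rewrite lt_neqAle eq_sym vn0.
  have avgt0 : (0 < a ^+ 2 + v)%R by rewrite ltr_wpDl// sqr_ge0.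
  have sv0 : Num.sqrt v != 0%R by rewrite gt_eqF// sqrtr_gt0.
  rewrite (negbTE vn0) gt_eqF//.
  under eq_integral do rewrite normal_prob_shift//.
  rewrite (@normal_prob_conv _ _ _ (Num.sqrt (a ^+ 2 + v)))// ?sqrtr_gt0//.
  by rewrite !sqr_sqrtr// ltW.
rewrite v_eq0 addr0.
have mBa : measurable [set x | B (a * x)%R].
  rewrite -[X in measurable X]setTI.
  by apply: (measurable_funM (measurable_cst _) (@measurable_id _ _ _)).
transitivity (\int[normal_prob 0 1]_x (\1_[set x | B (a * x)%R] x)%:E).
  apply: eq_integral => x _; rewrite /centered_normal_law eqxx diracE indicE; congr (_%:R%:E).
  by congr nat_of_bool; apply/idP/idP; rewrite !inE/= addr0.
by rewrite integral_indic// setIT; exact: centered_normal_law_std.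
Qed.

Lemma has_normal_law_std (a : R) :
  has_normal_law (normal_prob 0 1 : probability (measurableTypeR R) R) (fun x => a * x)%R (a ^+ 2).
Proof. by split; [exact: measurable_funM|move=> B mB; exact: centered_normal_law_std]. Qed.

(** Independence is realised by the product measure: the section of the event
    at [x] has the probability integrated in [centered_normal_law_conv]. *)
Lemma has_normal_law_add (d : measure_display) (T : measurableType d) (Q : probability T R)
    (U : T -> R) (v a : R) : (0 <= v)%R -> has_normal_law Q U v ->
  has_normal_law (normal_prob 0 1 \x Q : probability (measurableTypeR R * T)%type R)
    (fun p => a * p.1 + U p.2)%R (a ^+ 2 + v).
Proof.
move=> v0 [mU lawU].
have mV : measurable_fun setT (fun p : measurableTypeR R * T => a * p.1 + U p.2)%R.
  apply: measurable_funD; first exact: measurable_funM.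
  exact: measurableT_comp.
split; first exact: mV.
move=> B mB.
transitivity (\int[normal_prob 0 1]_x centered_normal_law v [set u | B (a * x + u)%R]);
  last exact: centered_normal_law_conv.
rewrite /pushforward/= /product_measure1; apply: eq_integral => x _ /=.
rewrite -lawU; last first.
  rewrite -[X in measurable X]setTI.
  by apply: (measurable_funD (measurable_cst _) (@measurable_id _ _ _)).
congr (Q _); apply/seteqP; split => w; rewrite /xsection/= ?inE//.
Qed.

Lemma integral_has_normal_law d (T : measurableType d) (Q : probability T R) U
    d' (T' : measurableType d') (Q' : probability T' R) U' v (f : R -> \bar R) :
  has_normal_law Q U v -> has_normal_law Q' U' v -> measurable_fun setT f ->
  \int[Q]_w f (U w) = \int[Q']_w f (U' w).
Proof.
move=> [mU lawU] [mU' lawU'].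
have ge0 (g : R -> \bar R) : measurable_fun setT g -> (forall x, 0 <= g x) ->
    \int[Q]_w g (U w) = \int[Q']_w g (U' w).
  move=> mg g0; transitivity (\int[pushforward Q U]_x g x).
    by rewrite ge0_integral_pushforward.
  transitivity (\int[pushforward Q' U']_x g x); last first.
    by rewrite ge0_integral_pushforward.
  by apply: eq_measure_integral => B mB _; rewrite [LHS]lawU// [RHS]lawU'.
move=> mf; rewrite integralE [RHS]integralE.
have pos S (V : S -> R) : (fun x => f (V x))^\+ = (fun x => f^\+ (V x)).
  by apply/funext => x; rewrite !funeposE.
have neg S (V : S -> R) : (fun x => f (V x))^\- = (fun x => f^\- (V x)).
  by apply/funext => x; rewrite !funenegE.
rewrite !(pos _ U) !(neg _ U) !(pos _ U') !(neg _ U') (ge0 f^\+ (measurable_funepos mf) (funepos_ge0 f)).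
by rewrite (ge0 f^\- (measurable_funeneg mf) (funeneg_ge0 f)).
Qed.

(** Independence of the variables enters only through the law of their linear
    combinations, which is what a Gaussian vector is made of; coordinates are
    added one at a time by [has_normal_law_add]. *)
Lemma iid_normal n : exists (d : measure_display) (T : measurableType d) (Q : probability T R)
    (N : 'I_n -> T -> R), (forall i, measurable_fun setT (N i)) /\
  forall t : 'I_n -> R, has_normal_law Q (fun w => \sum_i t i * N i w)%R (\sum_i t i ^+ 2).
Proof.
elim: n => [|n [d [T [Q [N [mN lawN]]]]]].
  exists _, (measurableTypeR R), (dirac (0%R : measurableTypeR R) : probability _ R), (fun _ _ => 0%R); split => // t.
  rewrite !big_ord0.
  split; first exact: measurable_cst.
  move=> B mB; rewrite /centered_normal_law eqxx /pushforward.
  by rewrite [LHS]diracE [RHS]diracE; congr (_%:R%:E); congr nat_of_bool; apply/idP/idP; rewrite !inE.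
exists _, (measurableTypeR R * T)%type, (normal_prob 0 1 \x Q : probability (measurableTypeR R * T)%type R).
exists (fun i p => if unlift ord0 i is Some j then N j p.2 else p.1); split.
  move=> i; case: unliftP => [j _|_]; last exact: measurable_fst.
  exact: measurableT_comp.
move=> t; rewrite big_ord_recl.
pose f i (p : measurableTypeR R * T) := if unlift ord0 i is Some j then N j p.2 else p.1.
have -> : (fun w => \sum_(i < n.+1) t i * f i w)%R =
          (fun p => t ord0 * p.1 + \sum_(i < n) t (lift ord0 i) * N i p.2)%R.
  apply/funext => p; rewrite big_ord_recl /f unlift_none; congr +%R.
  by apply: eq_bigr => i _; rewrite liftK.
apply: (has_normal_law_add _ _ (lawN (fun i => t (lift ord0 i)))).
by apply: sumr_ge0 => i _; exact: sqr_ge0.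
Qed.

End gaussian_law.

(** Complete the square on the first coordinate and recurse on the Schur
    complement. If the corner [a] is zero, positivity forces its row to
    vanish, and the convention [0^-1 = 0] lets the same formula cover that
    case. *)
Lemma psd_factor (R : realType) s (Sigma : 'M[R]_s) : covariance_matrix Sigma ->
  exists B : 'M[R]_s, Sigma = B *m B^T.
Proof.
elim: s Sigma => [|s IH] Sigma [symS posS].
  by exists 0; apply/matrixP => -[].
rewrite -[s.+1]/(1 + s)%N in Sigma symS posS *.
pose a : R := ulsubmx Sigma 0 0; pose b : 'rV[R]_s := ursubmx Sigma.
pose D : 'M[R]_s := drsubmx Sigma.
have SE : Sigma = block_mx a%:M b b^T D.
  by rewrite -[LHS]submxK -mx11_scalar /b trmx_ursub symS.
have quad u (w : 'rV[R]_s) :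
    (row_mx u%:M w *m Sigma *m (row_mx u%:M w)^T) 0 0 =
    u ^+ 2 * a + 2 * u * (b *m w^T) 0 0 + (w *m D *m w^T) 0 0.
  rewrite SE mul_row_block tr_row_mx mul_row_col tr_scalar_mx.
  rewrite !mulmxDl -!scalar_mxM !mul_scalar_mx !mul_mx_scalar -!scalemxAl.
  have -> : w *m b^T = (b *m w^T)^T by rewrite trmx_mul trmxK.
  rewrite !mxE eqxx mulr1n; ring.
have sum_entries_ge0 : 0 <= a.
  by have := posS (row_mx 1%:M 0); rewrite quad trmx0 !mulmx0 [X in _ + X]mxE [X in 2 * _ * X]mxE mulr0 !addr0 expr1n mul1r.
have ab0 : a = 0 -> b = 0.
  move=> a0; apply/rowP => j; rewrite [RHS]mxE.
  have bj : (b *m (delta_mx 0 j : 'rV[R]_s)^T) 0 0 = b 0 j by rewrite trmx_delta -colE mxE.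
  have [//|bj0] := eqVneq (b 0 j) 0.
  pose q : R := ((delta_mx 0 j : 'rV[R]_s) *m D *m (delta_mx 0 j : 'rV[R]_s)^T) 0 0.
  have := posS (row_mx (- (q + 1) / (2 * b 0 j))%:M (delta_mx 0 j : 'rV[R]_s)).
  rewrite quad bj a0 -/q mulr0 add0r.
  have -> : 2 * (- (q + 1) / (2 * b 0 j)) * b 0 j + q = -1 by field.
  by rewrite lerNr oppr0 ler10.
have [B' schurE] : exists B' : 'M[R]_s, D - a^-1 *: (b^T *m b) = B' *m B'^T.
  apply: IH; split.
    rewrite linearB linearZ /= trmx_mul trmxK; congr (_ - _).
    by rewrite /D trmx_drsub symS.
  move=> w; have [a0|an0] := eqVneq a 0.
    rewrite a0 invr0 scale0r subr0.
    by have := posS (row_mx 0%:M w); rewrite quad expr0n mul0r mulr0 mul0r !add0r.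
  have := posS (row_mx (- (b *m w^T) 0 0 / a)%:M w); rewrite quad.
  congr (0 <= _).
  rewrite mulmxBr mulmxBl mxE; set q := (w *m D *m w^T) 0 0.
  have -> : w *m (a^-1 *: (b^T *m b)) *m w^T = a^-1 *: ((b *m w^T)^T *m (b *m w^T)).
    by rewrite -scalemxAr -scalemxAl trmx_mul trmxK !mulmxA.
  rewrite !mxE big_ord1 !mxE; set p := \sum_j _.
  have -> : \sum_j (w *m D) 0 j * w^T j 0 = q by rewrite /q [RHS]mxE.
  by field.
exists (block_mx (Num.sqrt a)%:M 0 ((Num.sqrt a)^-1 *: b^T) B').
rewrite tr_block_mx mulmx_block SE tr_scalar_mx linearZ/= trmxK !trmx0 !mulmx0 !mul0mx !addr0.
rewrite -scalar_mxM -expr2 sqr_sqrtr// mul_scalar_mx mul_mx_scalar !scalerA.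
rewrite -scalemxAl -scalemxAr scalerA -expr2 exprVn sqr_sqrtr// -schurE addrC subrK.
have [a0|an0] := eqVneq a 0; first by rewrite a0 ab0// trmx0 !scaler0.
by rewrite divff ?mulVf ?scale1r// sqrtr_eq0 -ltNge lt_neqAle eq_sym an0.
Qed.

Lemma gaussian_exists (R : realType) s (Sigma : 'M[R]_s) : covariance_matrix Sigma ->
  exists (d : measure_display) (T : measurableType d) (Q : probability T R)
    (Z : T -> 'rV[R]_s), centered_gaussian Q Sigma Z.
Proof.
move=> /psd_factor[B ->].
have [d [T [Q [N [mN lawN]]]]] := iid_normal R s.
exists d, T, Q, (fun w => \row_j \sum_k B j k * N k w); split.
  move=> i; under eq_fun do rewrite mxE.
  by apply: measurable_sum => k; exact: measurable_funM.
move=> t C mC.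
have -> : (t *m (B *m B^T) *m t^T) 0 0 = \sum_k (\sum_j t 0 j * B j k) ^+ 2.
  rewrite mulmxA -mulmxA -trmx_mul mxE; apply: eq_bigr => k _.
  by rewrite !mxE expr2.
have [_ law] := lawN (fun k => \sum_j t 0 j * B j k).
rewrite -law//; rewrite (_ : (fun w => _) =
    (fun w => \sum_k (\sum_j t 0 j * B j k) * N k w))//.
apply/funext => w; under eq_bigr do rewrite mxE mulr_sumr.
rewrite exchange_big/=; apply: eq_bigr => k _.
by rewrite mulr_suml; apply: eq_bigr => j _; rewrite mulrA.
Qed.

(** * Moments and cosine transform of normal laws *)

Section two_cosh.
Variable R : realType.
Implicit Types y : R.

(** Twice the hyperbolic cosine. It dominates all powers, and its expectation
    under a centred normal law has a closed form. *)
Definition cosh2 y : R := expR y + expR (- y).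

Lemma cosh2N y : cosh2 (- y) = cosh2 y.
Proof. by rewrite /cosh2 opprK addrC. Qed.

Lemma cosh2_double y : cosh2 (2 * y) = cosh2 y ^+ 2 - 2.
Proof.
rewrite /cosh2 mulr_natl mulr2n opprD !expRD expRN.
have : expR y != 0 by rewrite gt_eqF ?expR_gt0.
by move: (expR y) => e e0; field.
Qed.

Lemma cosh2_half y : cosh2 y - 2 = (expR (y / 2) - expR (- (y / 2))) ^+ 2.
Proof.
have {1}-> : y = y / 2 + y / 2 by field.
rewrite /cosh2 opprD !expRD expRN.
have : expR (y / 2) != 0 by rewrite gt_eqF ?expR_gt0.
by move: (expR (y / 2)) => e e0; field.
Qed.

Lemma sinh_ge y : 0 <= y -> 0 <= expR y - expR (- y) - 2 * y.
Proof.
apply: (@ge0_of_derive _ (fun y => expR y - expR (- y) - 2 * y) (fun y => cosh2 y - 2)).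
- by move=> z; apply: is_derive_eq; rewrite /GRing.scale/= /cosh2; ring.
- by move=> z _; rewrite cosh2_half sqr_ge0.
- by rewrite oppr0 subrr mulr0 subrr.
Qed.

Lemma tanh_le y : 0 <= y -> 0 <= y * cosh2 y - (expR y - expR (- y)).
Proof.
apply: (@ge0_of_derive _ (fun y => y * cosh2 y - (expR y - expR (- y)))
  (fun y => y * (expR y - expR (- y)))).
- by move=> z; rewrite /cosh2; apply: is_derive_eq; rewrite /GRing.scale/=; ring.
- by move=> z z0; rewrite mulr_ge0// subr_ge0 ler_expR; lra.
- by rewrite oppr0 subrr mul0r subrr.
Qed.

Lemma cosh2_ge y : 2 + y ^+ 2 <= cosh2 y.
Proof.
wlog y0 : y / 0 <= y.
  move=> H; have [/H//|y0] := leP 0 y.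
  by have := H (- y); rewrite oppr_ge0 cosh2N sqrrN; apply; exact: ltW.
have := cosh2_half y; have := @sinh_ge (y / 2).
rewrite divr_ge0// => /(_ isT); set e := expR _ - expR _ => e1 e2.
have : (2 * (y / 2)) ^+ 2 <= e ^+ 2 by rewrite ler_sqr ?nnegrE; lra.
by have -> : 2 * (y / 2) = y by [field]; lra.
Qed.

Lemma cosh2_ge4 y : y ^+ 4 <= 16 * cosh2 y.
Proof.
have -> : y = 2 * (y / 2) by field.
rewrite cosh2_double; have := cosh2_ge (y / 2); move: (y / 2) => z H.
have : (2 + z ^+ 2) ^+ 2 <= cosh2 z ^+ 2.
  by have z2 := sqr_ge0 z; rewrite ler_sqr ?nnegrE; lra.
have := sqr_ge0 z; nra.
Qed.

(** By [tanh x <= x] at [y / 2], [cosh2 y - 2] is at most [y ^+ 2 / 4 * (cosh2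
    y + 2)]; the bound is then inserted once into itself. *)
Lemma cosh2_le y : cosh2 y <= 2 + y ^+ 2 + y ^+ 4 / 16 * (cosh2 y + 2).
Proof.
have H : cosh2 y - 2 <= y ^+ 2 / 4 * (cosh2 y + 2).
  wlog y0 : y / 0 <= y.
    move=> H; have [/H//|y0] := leP 0 y.
    by have := H (- y); rewrite oppr_ge0 cosh2N sqrrN; apply; exact: ltW.
  have H1 := @tanh_le (y / 2); rewrite divr_ge0// in H1; have {H1} := H1 isT.
  have := @sinh_ge (y / 2); rewrite divr_ge0// => /(_ isT).
  have -> : cosh2 y + 2 = cosh2 (y / 2) ^+ 2.
    by rewrite -[cosh2 (y / 2) ^+ 2](subrK 2) -cosh2_double; congr (cosh2 _ + _); field.
  rewrite cosh2_half; set e := expR _ - expR _ => e1 e2.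
  have -> : y ^+ 2 / 4 * cosh2 (y / 2) ^+ 2 = (y / 2 * cosh2 (y / 2)) ^+ 2 by field.
  by rewrite ler_sqr ?nnegrE; lra.
have := cosh2_ge y; have := sqr_ge0 y.
have -> : y ^+ 4 = (y ^+ 2) ^+ 2 by ring.
by move: (y ^+ 2) (cosh2 y) H => a c; nra.
Qed.

Lemma cosh2_mono x y : `|x| <= `|y| -> cosh2 x <= cosh2 y.
Proof.
have abs (z : R) : cosh2 `|z| = cosh2 z.
  by have [|] := ger0P z; rewrite ?cosh2N.
rewrite -(abs x) -(abs y); move: `|x| (normr_ge0 x) => a a0; move: `|y| => b ab.
rewrite -subr_ge0 /cosh2 !expRN; set p := expR a; set q := expR b.
have p1 : 1 <= p by rewrite /p -expR0 ler_expR.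
have pq : p <= q by rewrite ler_expR.
have -> : q + q^-1 - (p + p^-1) = (q - p) * (1 - (p * q)^-1).
  by field; rewrite !gt_eqF ?expR_gt0.
by rewrite mulr_ge0 ?subr_ge0// invf_le1 ?mulr_gt0 ?expR_gt0//; nra.
Qed.

Lemma cosh2_ge2 y : 2 <= cosh2 y.
Proof. by have := cosh2_ge y; have := sqr_ge0 y; lra. Qed.

Lemma cosh2_mul y z : cosh2 y * cosh2 z = cosh2 (y + z) + cosh2 (y - z).
Proof. by rewrite /cosh2 !opprD opprK !expRD; ring. Qed.

End two_cosh.

Section integrability.
Variables (d : measure_display) (T : measurableType d) (R : realType).
Variable mu : probability T R.

Lemma integrable_dominated (f g : T -> R) (C : R) : measurable_fun setT f ->
  (forall x, `|f x| <= C * g x) ->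
  mu.-integrable setT (EFin \o g) -> mu.-integrable setT (EFin \o f).
Proof.
move=> mf fg ig.
apply: (@le_integrable _ _ _ mu setT measurableT _ (EFin \o (fun x => C * g x))).
- exact/measurable_EFinP.
- move=> x _ /=; rewrite lee_fin.
  exact: le_trans (fg x) (ler_norm _).
- rewrite (_ : EFin \o _ = (fun x => C%:E * (EFin \o g) x)%E); last by apply/funext => x /=.
  exact: integrableZl.
Qed.

Lemma integrable_bounded (f : T -> R) (C : R) : measurable_fun setT f ->
  (forall x, `|f x| <= C) -> mu.-integrable setT (EFin \o f).
Proof.
move=> mf fC; apply: (integrable_dominated (g := fun=> 1) (C := C)) => //.
  by move=> x; rewrite mulr1.
by apply: finite_measure_integrable_cst.
Qed.

Lemma integrableD_fun (f g : T -> R) : mu.-integrable setT (EFin \o f) ->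
  mu.-integrable setT (EFin \o g) -> mu.-integrable setT (EFin \o (fun x => f x + g x)).
Proof.
move=> fi gi; rewrite (_ : EFin \o _ = ((EFin \o f) \+ (EFin \o g))%E)//.
exact: integrableD.
Qed.

Lemma integrableZ_fun (f : T -> R) (c : R) : mu.-integrable setT (EFin \o f) ->
  mu.-integrable setT (EFin \o (fun x => c * f x)).
Proof.
move=> fi; rewrite (_ : EFin \o _ = (fun x => c%:E * (EFin \o f) x)%E)//.
exact: integrableZl.
Qed.

Lemma integrable_cst_fun (c : R) : mu.-integrable setT (EFin \o (fun=> c)).
Proof. exact: finite_measure_integrable_cst. Qed.

Lemma integrable_sum_fun (I : Type) (r : seq I) (f : I -> T -> R) :
  (forall i, mu.-integrable setT (EFin \o f i)) ->
  mu.-integrable setT (EFin \o (fun x => \sum_(i <- r) f i x)).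
Proof.
move=> fi; rewrite (_ : EFin \o _ = (fun x => \sum_(i <- r) (EFin \o f i) x)%E).
  by apply: integrable_sum.
by apply/funext => x /=; rewrite sumEFin.
Qed.

Lemma Rintegral_sum (I : Type) (r : seq I) (f : I -> T -> R) :
  (forall i, mu.-integrable setT (EFin \o f i)) ->
  \int[mu]_x (\sum_(i <- r) f i x) = \sum_(i <- r) \int[mu]_x f i x.
Proof.
move=> fi; elim: r => [|i r IH].
  by rewrite big_nil; under eq_Rintegral do rewrite big_nil; rewrite Rintegral_cst// mul0r.
rewrite big_cons -IH -RintegralD//; last exact: integrable_sum_fun.
by apply: eq_Rintegral => x _; rewrite big_cons.
Qed.

Lemma Rintegral_prob_cst (c : R) : \int[mu]_x c = c.
Proof.
rewrite Rintegral_cst//; transitivity (c * fine 1%E); last exact: mulr1.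
by congr (_ * fine _); exact: probability_setT.
Qed.

End integrability.

Lemma le_of_le_add_small (R : realFieldType) (x y K : R) :
  (forall z, 0 < z -> z <= 1 -> x <= y + z * K) -> x <= y.
Proof.
move=> H; have [//|yx] := leP x y.
have K0 : 0 < K by have := H 1 ltr01 (lexx 1); lra.
have [z1|z1] := leP ((x - y) / (2 * K)) 1.
  have := H _ _ z1; rewrite divr_gt0 ?subr_gt0 ?mulr_gt0// => /(_ isT).
  have -> : (x - y) / (2 * K) * K = (x - y) / 2 by field; rewrite gt_eqF.
  lra.
have := H 1 ltr01 (lexx 1).
rewrite ltr_pdivlMr ?mulr_gt0// in z1; lra.
Qed.

Lemma measurable_cos (R : realType) : measurable_fun setT (cos : R -> R).
Proof. by apply: continuous_measurable_fun; exact: continuous_cos. Qed.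

Lemma measurable_sin (R : realType) : measurable_fun setT (sin : R -> R).
Proof. by apply: continuous_measurable_fun; exact: continuous_sin. Qed.

Lemma expr_diff_le (R : realDomainType) (x y : R) n : `|x| <= 1 -> `|y| <= 1 ->
  `|x ^+ n - y ^+ n| <= n%:R * `|x - y|.
Proof.
move=> x1 y1; elim: n => [|n IH]; first by rewrite !expr0 subrr normr0 mul0r.
have -> : x ^+ n.+1 - y ^+ n.+1 = x * (x ^+ n - y ^+ n) + (x - y) * y ^+ n.
  by rewrite !exprS; ring.
rewrite -(natr1 n) [leRHS]mulrDl mul1r; apply: le_trans (ler_normD _ _) _; apply: lerD.
  by rewrite normrM; apply: le_trans IH; rewrite ler_piMl.
by rewrite normrM ler_piMr// normrX exprn_ile1.
Qed.

Lemma le0_of_le_inv (R : realType) (x K : R) : (forall n : nat, x <= K / n.+1%:R) -> x <= 0.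
Proof.
move=> H; have [//|x0] := leP x 0.
have := H (Num.truncn (K / x)); rewrite ler_pdivlMr ?ltr0n// => xK.
have := Num.Theory.truncnS_gt (K / x); rewrite ltr_pdivrMr// => Kx.
by move: xK; rewrite leNgt mulrC Kx.
Qed.

Section standard_normal.
Variable R : realType.
Local Notation G := (normal_prob 0 1 : probability (measurableTypeR R) R).

Lemma measurable_scale (h : R) : measurable_fun [set: measurableTypeR R] (fun x : measurableTypeR R => h * x : R).
Proof. exact: measurable_funM. Qed.

Lemma std_integral_exp h : (\int[G]_x (expR (h * x))%:E = (expR (h ^+ 2 / 2))%:E)%E.
Proof. by rewrite normal_mgf ?oner_eq0// expr1n mulr1. Qed.

Lemma std_integrable_exp h : G.-integrable setT (EFin \o (fun x => expR (h * x))).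
Proof.
apply/integrableP; split.
  by apply/measurable_EFinP; apply: measurableT_comp => //; exact: measurable_scale.
rewrite (_ : (fun x => _) = (fun x => (expR (h * x))%:E)).
  by rewrite std_integral_exp ltry.
by apply/funext => x /=; rewrite ger0_norm// expR_ge0.
Qed.

Lemma std_integrable_cosh2 h : G.-integrable setT (EFin \o (fun x => cosh2 (h * x))).
Proof.
rewrite (_ : EFin \o _ = ((EFin \o (fun x => expR (h * x))) \+ (EFin \o (fun x => expR ((- h) * x))))%E).
  by apply: integrableD => //; exact: std_integrable_exp.
by apply/funext => x /=; rewrite /cosh2 mulNr.
Qed.

Lemma std_cosh2 h : \int[G]_x cosh2 (h * x) = 2 * expR (h ^+ 2 / 2).
Proof.
rewrite /cosh2; under eq_Rintegral do rewrite -mulNr.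
rewrite RintegralD//; [|exact: std_integrable_exp..].
by rewrite /Rintegral !std_integral_exp /= sqrrN; ring.
Qed.

Lemma std_integrable_pow k : (k <= 4)%N -> G.-integrable setT (EFin \o (fun x => x ^+ k)).
Proof.
move=> k4; 
apply: (@integrable_dominated _ _ _ G (fun x : R => x ^+ k) (fun x : R => cosh2 (1 * x)) 16).
- exact: measurable_funX.
- move=> x; rewrite mul1r normrX.
  have [x1|x1] := leP `|x| 1.
    apply: (@le_trans _ _ (1 : R)); first exact: exprn_ile1.
    by have := cosh2_ge x; have := sqr_ge0 x; lra.
  apply: le_trans (cosh2_ge4 x).
  have E (u : R) : u ^+ 4 = (u ^+ 2) ^+ 2 by rewrite -exprM.
  rewrite E -(@real_normK _ x) ?num_real// -E.
  by rewrite ler_eXn2l.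
- exact: std_integrable_cosh2.
Qed.

(** The expectation [2 * exp (h ^ 2 / 2)] of [cosh2 (h * x)] is compared with
    the second order expansion of [cosh2]; as [h] tends to zero this isolates
    the second moment. *)
Lemma std_second_moment : \int[G]_x (x ^+ 2) = 1.
Proof.
set M := \int[G]_x _.
have i2 : G.-integrable setT (EFin \o (fun x => x ^+ 2)) by exact: std_integrable_pow.
have M0 : 0 <= M by apply: Rintegral_ge0 => x _; exact: sqr_ge0.
(* [K] bounds the expectation of the fourth order remainder for [h <= 1]. *)
pose K : R := 4 * expR 2 + 4 * expR 1.
have bounds (h : R) : 0 < h -> h <= 1 -> 2 + h ^+ 2 * M <= 2 * expR (h ^+ 2 / 2) /\
    2 * expR (h ^+ 2 / 2) <= 2 + h ^+ 2 * M + h ^+ 4 * K.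
  move=> h0 h1.
  have ilow : G.-integrable setT (EFin \o (fun x => 2 + h ^+ 2 * x ^+ 2)).
    by apply: integrableD_fun; [exact: integrable_cst_fun|exact: integrableZ_fun].
  have low : \int[G]_x (2 + h ^+ 2 * x ^+ 2) = 2 + h ^+ 2 * M.
    rewrite RintegralD//; [|exact: integrable_cst_fun|exact: integrableZ_fun].
    by rewrite RintegralZl// Rintegral_prob_cst.
  split.
    rewrite -std_cosh2 -low; apply: le_Rintegral => //; first exact: std_integrable_cosh2.
    by move=> x _; rewrite -exprMn cosh2_ge.
  pose B (x : R) : R := cosh2 ((1 + h) * x) + cosh2 ((1 - h) * x) + 2 * cosh2 (1 * x).
  have iB : G.-integrable setT (EFin \o B).
    apply: integrableD_fun; first apply: integrableD_fun; try exact: std_integrable_cosh2.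
    by apply: integrableZ_fun; exact: std_integrable_cosh2.
  have intB : \int[G]_x B x =
      2 * expR ((1 + h) ^+ 2 / 2) + 2 * expR ((1 - h) ^+ 2 / 2) + 2 * (2 * expR (1 ^+ 2 / 2)).
    rewrite RintegralD//; last 2 first.
    - by apply: integrableD_fun; exact: std_integrable_cosh2.
    - by apply: integrableZ_fun; exact: std_integrable_cosh2.
    rewrite RintegralD//; try exact: std_integrable_cosh2.
    by rewrite RintegralZl ?std_cosh2//; exact: std_integrable_cosh2.
  have intBK : \int[G]_x B x <= K.
    rewrite intB expr1n /K.
    have : expR ((1 + h) ^+ 2 / 2) <= expR 2 by rewrite ler_expR; nra.
    have : expR ((1 - h) ^+ 2 / 2) <= expR 2 by rewrite ler_expR; nra.
    have : expR (1 / 2 : R) <= expR 1 by rewrite ler_expR; lra.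
    lra.
  have h40 : 0 <= h ^+ 4 by rewrite exprn_ge0// ltW.
  apply: (@le_trans _ _ (2 + h ^+ 2 * M + h ^+ 4 * \int[G]_x B x)); last first.
    by rewrite lerD2l ler_wpM2l.
  rewrite -low -std_cosh2 -RintegralZl// -RintegralD//; last exact: integrableZ_fun.
  apply: le_Rintegral => //; first exact: std_integrable_cosh2.
    by apply: integrableD_fun => //; exact: integrableZ_fun.
  move=> x _; rewrite -exprMn; apply: le_trans (cosh2_le _) _.
  rewrite lerD2l.
  have -> : B x = cosh2 x * (cosh2 (h * x) + 2).
    rewrite mulrDr cosh2_mul /B mulrDl mulrBl !mul1r; congr (_ + _); exact: mulrC.
  have := cosh2_ge4 x; have := cosh2_ge (h * x); have := sqr_ge0 (h * x).
  move: (cosh2 (h * x)) (cosh2 x) => p q hx2 p2 q4.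
  have -> : (h * x) ^+ 4 / 16 * (p + 2) = h ^+ 4 * (x ^+ 4 / 16 * (p + 2)) by rewrite exprMn; ring.
  rewrite ler_wpM2l// ler_wpM2r//; lra.
have zbounds (z : R) : 0 < z -> z <= 1 -> M <= 1 + z * expR 1 /\ 1 <= M + z * K.
  move=> z0 z1; have := bounds (Num.sqrt z).
  have sz1 : Num.sqrt z <= 1 by rewrite -(@sqrtr1 R) ler_sqrt.
  rewrite sqrtr_gt0 z0 => /(_ isT sz1).
  have -> : Num.sqrt z ^+ 4 = z ^+ 2 by rewrite -[in RHS](@sqr_sqrtr _ z) ?ltW// -exprM.
  rewrite sqr_sqrtr ?(ltW z0)// => -[u1 u2].
  have e1 := expR_ge1Dx (z / 2).
  have := expR_le_quad (z / 2); rewrite ger0_norm ?divr_ge0 ?(ltW z0)// => e2.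
  have e3 : expR (z / 2) <= expR 1 by rewrite ler_expR; lra.
  have e4 : (z / 2) ^+ 2 * expR (z / 2) <= (z / 2) ^+ 2 * expR 1 by rewrite ler_wpM2l ?sqr_ge0.
  have e0 := expR_gt0 (1 : R).
  split; rewrite -(ler_pM2l z0).
    by move: (expR 1) (expR (z / 2)) e0 e1 e2 e3 e4 u1 => a b; nra.
  by move: (expR (z / 2)) e1 u2 => b; nra.
apply/eqP; rewrite eq_le; apply/andP; split.
  by apply: (@le_of_le_add_small _ _ _ (expR 1)) => z z0 z1; case: (zbounds z).
by apply: (@le_of_le_add_small _ _ _ K) => z z0 z1; case: (zbounds z).
Qed.

Lemma Rintegral_has_normal_law d (T : measurableType d) (Q : probability T R) U
    d' (T' : measurableType d') (Q' : probability T' R) U' v (f : R -> R) :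
  has_normal_law Q U v -> has_normal_law Q' U' v -> measurable_fun setT f ->
  \int[Q]_w f (U w) = \int[Q']_w f (U' w).
Proof.
move=> lU lU' mf; congr fine; apply: (integral_has_normal_law (f := EFin \o f) lU lU').
exact/measurable_EFinP.
Qed.

(** The variables [a * x] and [- a * x] have the same law. *)
Lemma std_odd (f : R -> R) a : measurable_fun setT f -> (forall x, f (- x) = - f x) ->
  G.-integrable setT (EFin \o (fun x => f (a * x))) -> \int[G]_x f (a * x) = 0.
Proof.
move=> mf fN fi.
have lN := has_normal_law_std (- a); rewrite sqrrN in lN.
have := Rintegral_has_normal_law (has_normal_law_std a) lN mf.
under [X in _ = X -> _]eq_Rintegral do rewrite mulNr fN -mulN1r.
by rewrite RintegralZl// mulN1r => E; lra.
Qed.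

Lemma std_integrable_cos a b : G.-integrable setT (EFin \o (fun x => cos (a * x + b))).
Proof.
apply: (@integrable_bounded _ _ _ _ _ 1).
  apply: measurableT_comp; first exact: measurable_cos.
  by apply: measurable_funD => //; exact: measurable_scale.
by move=> x; rewrite ler_norml cos_le1 cos_geN1.
Qed.

Lemma std_integrable_sin a : G.-integrable setT (EFin \o (fun x => sin (a * x))).
Proof.
apply: (@integrable_bounded _ _ _ _ _ 1).
  by apply: measurableT_comp; [exact: measurable_sin|exact: measurable_scale].
by move=> x; rewrite ler_norml sin_le1 sin_geN1.
Qed.

Definition std_cos (a : R) : R := \int[G]_x cos (a * x).

Lemma std_cosD a b : \int[G]_x cos (a * x + b) = std_cos a * cos b.
Proof.
under eq_Rintegral do rewrite cosD [X in X - _]mulrC [X in _ - X]mulrC.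
have ic : G.-integrable setT (EFin \o (fun x => cos (a * x))).
  by have := std_integrable_cos a 0; under eq_fun do rewrite addr0.
rewrite RintegralB//; last 2 first.
- exact: integrableZ_fun.
- by apply: integrableZ_fun; exact: std_integrable_sin.
rewrite !RintegralZl//; last exact: std_integrable_sin.
rewrite (std_odd (@measurable_sin R) (@sinN R) (std_integrable_sin a)).
by rewrite mulr0 subr0 mulrC.
Qed.

(** For independent [x] and [y], [a * x + b * y] has the law of [c * x], and
    in the addition formula the sines integrate to zero. *)
Lemma std_cos_pythagoras a b c : c ^+ 2 = a ^+ 2 + b ^+ 2 -> std_cos c = std_cos a * std_cos b.
Proof.
move=> cE.
have lc := has_normal_law_std c; rewrite cE in lc.
have lab := has_normal_law_add a (sqr_ge0 b) (has_normal_law_std b).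
rewrite {1}/std_cos (Rintegral_has_normal_law lc lab); last exact: measurable_cos.
have mf : measurable_fun setT (fun p : measurableTypeR R * measurableTypeR R => cos (a * p.1 + b * p.2) : R).
  apply: measurableT_comp; first exact: measurable_cos.
  by apply: measurable_funD; apply: measurable_funM.
rewrite /Rintegral -integral12_prod_meas1; last first.
  apply: (@integrable_bounded _ _ _ ((G \x G)%E : probability _ R) _ 1) => //.
  by move=> x; rewrite ler_norml cos_le1 cos_geN1.
transitivity (\int[G]_x (std_cos b * cos (a * x))).
  congr fine; apply: eq_integral => x _; rewrite /fubini_F /=.
  under eq_integral do rewrite addrC.
  have fin := integrable_fin_num measurableT (std_integrable_cos b (a * x)).
  rewrite -[LHS](fineK fin); congr (_%:E); rewrite mulrC; exact: std_cosD.
rewrite RintegralZl// 1?mulrC//.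
by have := std_integrable_cos a 0; under eq_fun do rewrite addr0.
Qed.

Lemma std_integrable_cos0 a : G.-integrable setT (EFin \o (fun x => cos (a * x))).
Proof. by have := std_integrable_cos a 0; under eq_fun do rewrite addr0. Qed.

Lemma std_cos_bound a : `|std_cos a| <= 1.
Proof.
apply: le_trans (le_normr_Rintegral _ _) _ => //; first exact: std_integrable_cos0.
rewrite -[leRHS](Rintegral_prob_cst G); apply: le_Rintegral => //.
- exact: integrable_norm (std_integrable_cos0 a).
- exact: integrable_cst_fun.
- by move=> x _; rewrite ler_norml cos_le1 cos_geN1.
Qed.

Lemma std_cos_taylor : exists K, forall a, `|std_cos a - (1 - a ^+ 2 / 2)| <= K * a ^+ 4.
Proof.
exists (\int[G]_x (x ^+ 4)) => a.
have ic := std_integrable_cos0 a.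
have i2 : G.-integrable setT (EFin \o (fun x => x ^+ 2)) by exact: std_integrable_pow.
have i4 : G.-integrable setT (EFin \o (fun x => x ^+ 4)) by exact: std_integrable_pow.
have iq : G.-integrable setT (EFin \o (fun x => - 1 + a ^+ 2 / 2 * x ^+ 2)).
  by apply: integrableD_fun; [exact: integrable_cst_fun|exact: integrableZ_fun].
have -> : std_cos a - (1 - a ^+ 2 / 2) =
    \int[G]_x (cos (a * x) + (- 1 + a ^+ 2 / 2 * x ^+ 2)).
  rewrite RintegralD// RintegralD//; [|exact: integrable_cst_fun|exact: integrableZ_fun].
  by rewrite RintegralZl// std_second_moment Rintegral_prob_cst /std_cos; ring.
apply: le_trans (le_normr_Rintegral _ _) _ => //; first exact: integrableD_fun.
have <- : \int[G]_x (a ^+ 4 * x ^+ 4) = (\int[G]_x (x ^+ 4)) * a ^+ 4 by rewrite RintegralZl// mulrC.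
apply: le_Rintegral => //.
- exact: integrable_norm (integrableD_fun ic iq).
- exact: integrableZ_fun.
move=> x _; rewrite addrA -exprMn.
have -> : a ^+ 2 / 2 * x ^+ 2 = (a * x) ^+ 2 / 2 by rewrite exprMn; ring.
apply: le_trans (cos_taylor4 _) _.
have : 0 <= (a * x) ^+ 4 by rewrite (exprM _ 2 2) sqr_ge0.
lra.
Qed.

Lemma std_cos_pow n c : std_cos (Num.sqrt n%:R * c) = std_cos c ^+ n.
Proof.
elim: n => [|n IH].
  rewrite sqrtr0 mul0r expr0 /std_cos; under eq_Rintegral do rewrite mul0r cos0.
  exact: Rintegral_prob_cst.
rewrite exprS -IH; apply: std_cos_pythagoras.
by rewrite !exprMn !sqr_sqrtr// -(natr1 n); ring.
Qed.

(** The cosine transform takes the value [std_cos c ^+ n] at [sqrt n * c] and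
    is [1 - c ^+ 2 / 2] up to fourth order; with [c = a / sqrt n] this forces
    the exponential. *)
Lemma std_cosE a : std_cos a = expR (- (a ^+ 2 / 2)).
Proof.
have [K HK] := std_cos_taylor.
apply/eqP; rewrite -subr_eq0 -normr_le0; apply: (@le0_of_le_inv _ _ ((K + 1) * a ^+ 4)) => n.
pose c := a / Num.sqrt n.+1%:R.
have n0 : n.+1%:R != 0 :> R by rewrite pnatr_eq0.
have sn0 : Num.sqrt n.+1%:R != 0 :> R by rewrite sqrtr_eq0 -ltNge ltr0n.
have c2 : c ^+ 2 = a ^+ 2 / n.+1%:R by rewrite /c expr_div_n sqr_sqrtr.
have -> : std_cos a = std_cos c ^+ n.+1 by rewrite -std_cos_pow mulrC divfK.
have -> : expR (- (a ^+ 2 / 2)) = expR (- (c ^+ 2 / 2)) ^+ n.+1.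
  by rewrite -expRM_natl c2; congr expR; field.
apply: le_trans (expr_diff_le _ _ _) _; first exact: std_cos_bound.
  rewrite ger0_norm ?expR_ge0// -expR0 ler_expR oppr_le0.
  by rewrite divr_ge0 ?sqr_ge0.
have -> : (K + 1) * a ^+ 4 / n.+1%:R = n.+1%:R * (K * c ^+ 4 + c ^+ 4).
  have -> : c ^+ 4 = (c ^+ 2) ^+ 2 by rewrite -exprM.
  by rewrite c2; field.
rewrite ler_wpM2l//.
have -> : std_cos c - expR (- (c ^+ 2 / 2)) =
  (std_cos c - (1 - c ^+ 2 / 2)) + (1 - c ^+ 2 / 2 - expR (- (c ^+ 2 / 2))) by ring.
apply: le_trans (ler_normD _ _) _; apply: lerD; first exact: HK.
apply: le_trans (expRN_taylor1 _) _; first by rewrite divr_ge0 ?sqr_ge0.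
rewrite expr_div_n -exprM; have : 0 <= c ^+ 4 by rewrite (exprM _ 2 2) sqr_ge0.
lra.
Qed.

End standard_normal.

Section normal_law_moments.
Variables (R : realType) (d : measure_display) (T : measurableType d).
Variables (Q : probability T R) (U : T -> R) (v : R).
Hypotheses (v0 : 0 <= v) (lU : has_normal_law Q U v).
Local Notation G := (normal_prob 0 1 : probability (measurableTypeR R) R).

Let lG : has_normal_law G (fun x => Num.sqrt v * x) v.
Proof. by have := has_normal_law_std (Num.sqrt v); rewrite sqr_sqrtr. Qed.

Lemma normal_law_integrable (f : R -> R) : measurable_fun setT f ->
  G.-integrable setT (EFin \o (fun x => f (Num.sqrt v * x))) ->
  Q.-integrable setT (EFin \o (fun w => f (U w))).
Proof.
move=> mf /integrableP[_ fi]; apply/integrableP; split.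
  by apply/measurable_EFinP; apply: measurableT_comp => //; case: lU.
have mg : measurable_fun setT (fun x : R => `|(f x)%:E|%E).
  by apply: measurableT_comp => //; exact/measurable_EFinP.
by rewrite (integral_has_normal_law lU lG mg).
Qed.

Lemma normal_law_cos b : \int[Q]_w cos (U w + b) = expR (- (v / 2)) * cos b.
Proof.
have mc : measurable_fun setT (fun x : R => cos (x + b)).
  by apply: measurableT_comp; [exact: measurable_cos|exact: measurable_funD].
rewrite (Rintegral_has_normal_law lU lG mc).
by rewrite std_cosD std_cosE sqr_sqrtr.
Qed.

Lemma normal_law_mean : \int[Q]_w U w = 0.
Proof.
have mi : measurable_fun setT (fun x : R => x) by exact: measurable_id.
rewrite (Rintegral_has_normal_law lU lG mi).
apply: (std_odd mi) => //.
by apply: integrableZ_fun; exact: (@std_integrable_pow R 1).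
Qed.

Lemma normal_law_variance : \int[Q]_w (U w ^+ 2) = v.
Proof.
have mi : measurable_fun setT (fun x : R => x ^+ 2) by exact: measurable_funX.
rewrite (Rintegral_has_normal_law lU lG mi).
under eq_Rintegral do rewrite exprMn sqr_sqrtr//.
rewrite RintegralZl//; last exact: std_integrable_pow.
by rewrite std_second_moment mulr1.
Qed.

Lemma normal_law_integrable_cosh2 : Q.-integrable setT (EFin \o (fun w => cosh2 (U w))).
Proof.
apply: normal_law_integrable; last exact: std_integrable_cosh2.
apply: measurable_funD; first exact: measurable_expR.
by apply: measurableT_comp => //; exact: measurable_expR.
Qed.

End normal_law_moments.

(** * Approximation by trigonometric sums *)

Section trigonometric_functions.
Variables (R : realType) (s : nat).
Implicit Types (f g h : 'rV[R]_s -> R).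

Definition trig_eval (l : seq (R * ('cV[R]_s * R))) (x : 'rV[R]_s) : R :=
  \sum_(p <- l) p.1 * cos (dot x p.2.1 + p.2.2).

Definition trigonometric h : Prop := exists l, forall x, h x = trig_eval l x.

Lemma trigonometric_cos a t b : trigonometric (fun x => a * cos (dot x t + b)).
Proof. by exists [:: (a, (t, b))] => x; rewrite /trig_eval big_seq1. Qed.

Lemma trigonometric_cst a : trigonometric (fun=> a).
Proof.
exists [:: (a, (0, 0))] => x; rewrite /trig_eval big_seq1 /=.
by rewrite /dot mulmx0 mxE addr0 cos0 mulr1.
Qed.

Lemma trigonometricD f g : trigonometric f -> trigonometric g -> trigonometric (fun x => f x + g x).
Proof.
by move=> [l fl] [k gk]; exists (l ++ k) => x; rewrite /trig_eval big_cat/= fl gk.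
Qed.

Lemma trigonometric_mulcos f a t b : trigonometric f ->
  trigonometric (fun x => a * cos (dot x t + b) * f x).
Proof.
move=> [l fl].
exists (flatten [seq [:: (a * p.1 / 2, (t + p.2.1, b + p.2.2));
                        (a * p.1 / 2, (t - p.2.1, b - p.2.2))] | p <- l]) => x.
rewrite fl /trig_eval big_flatten/= big_map mulr_sumr; apply: eq_bigr => p _.
have dD v : dot x (t + v) = dot x t + dot x v by rewrite /dot mulmxDr mxE.
have dN v : dot x (- v) = - dot x v by rewrite /dot mulmxN mxE.
rewrite big_cons big_seq1 /= !dD dN; set u := dot x t; set w := dot x _.
have -> : u + w + (b + p.2.2) = (u + b) + (w + p.2.2) by ring.
have -> : u - w + (b - p.2.2) = (u + b) - (w + p.2.2) by ring.
by rewrite (cosD (u + b)) (cosB (u + b)); field.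
Qed.

Lemma trigonometricM f g : trigonometric f -> trigonometric g -> trigonometric (fun x => f x * g x).
Proof.
move=> [l fl] gt; have -> : (fun x => f x * g x) = (fun x => trig_eval l x * g x).
  by apply/funext => x; rewrite fl.
elim: l {fl} => [|[a [t b]] l IH].
  rewrite (_ : (fun x => _) = (fun=> 0)); first exact: trigonometric_cst.
  by apply/funext => x; rewrite /trig_eval big_nil mul0r.
rewrite (_ : (fun x => _) = (fun x => a * cos (dot x t + b) * g x + trig_eval l x * g x)).
  by apply: trigonometricD => //; exact: trigonometric_mulcos.
by apply/funext => x; rewrite /trig_eval big_cons mulrDl.
Qed.

Lemma trigonometric_sin c i : trigonometric (fun x => sin (c * x 0 i)).
Proof.
have := @trigonometric_cos 1 (c *: delta_mx i 0) (- (pi / 2)).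
rewrite (_ : (fun x : 'rV[R]_s => _) = (fun x => sin (c * x 0 i)))//; apply/funext => x.
rewrite mul1r /dot -scalemxAr -colE !mxE.
by rewrite cosB cos_pihalf sin_pihalf mulr0 add0r mulr1.
Qed.

End trigonometric_functions.

Section walk.
Variables (R : realType) (s : nat) (delta : R).
Implicit Types (u : 'I_s -> R) (y : 'rV[R]_s) (g : 'rV[R]_s -> R).

(** A random walk on [R^s] that, for each [i] of [l] in turn, moves by [delta]
    in direction [i] with probability [u i]. With [n] steps of length [1 / n]
    in every direction, the law of its position is the product of the
    Bernstein weights at [u]. *)
Fixpoint walk (l : seq 'I_s) u g y : R :=
  if l is i :: l' then
    u i * walk l' u g (y + delta *: delta_mx 0 i) + (1 - u i) * walk l' u g y
  else g y.

Lemma walk_lin l u a b f g y :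
  walk l u (fun y => a * f y + b * g y) y = a * walk l u f y + b * walk l u g y.
Proof. by elim: l y => [|i l IH] y //=; rewrite !IH; ring. Qed.

Lemma walk_cst l u c y : walk l u (fun=> c) y = c.
Proof. by elim: l y => [|i l IH] y //=; rewrite !IH; ring. Qed.

Lemma walk_sum l u (I : Type) (r : seq I) (f : I -> 'rV[R]_s -> R) y :
  walk l u (fun y => \sum_(i <- r) f i y) y = \sum_(i <- r) walk l u (f i) y.
Proof.
elim: l y => [|i l IH] y //=; rewrite !IH !mulr_sumr -big_split/=.
by apply: eq_bigr.
Qed.

Lemma walk_le l u f g y : (forall i, 0 <= u i <= 1) -> (forall y, f y <= g y) ->
  walk l u f y <= walk l u g y.
Proof.
move=> u01 fg; elim: l y => [|i l IH] y //=.
by have /andP[u0 u1] := u01 i; apply: lerD; rewrite ler_wpM2l// subr_ge0.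
Qed.

(** Mean and variance add up along independent steps. *)
Lemma walk_second_moment l u b j y :
  walk l u (fun y => (y 0 j - b) ^+ 2) y =
  (y 0 j + delta * (count_mem j l)%:R * u j - b) ^+ 2 +
  delta ^+ 2 * (count_mem j l)%:R * (u j * (1 - u j)).
Proof.
elim: l y => [|i l IH] y /=; first by rewrite !mulr0 !mul0r !addr0.
rewrite !IH !mxE eqxx /= natrD [j == i]eq_sym.
have [->|ij] := eqVneq i j; rewrite ?mulr1n ?mulr0n; ring.
Qed.

Lemma walk_concentrates n u : (0 < n)%N -> delta = n%:R^-1 -> (forall i, 0 <= u i <= 1) ->
  walk (flatten (nseq n (enum 'I_s))) u (fun y => \sum_j (y 0 j - u j) ^+ 2) 0 <= s%:R / n%:R.
Proof.
move=> n0 dE u01; rewrite walk_sum.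
have -> : s%:R / n%:R = \sum_(j < s) (n%:R^-1 : R).
  by rewrite sumr_const card_ord mulr_natl.
apply: ler_sum => j _; rewrite walk_second_moment.
have -> : count_mem j (flatten (nseq n (enum 'I_s))) = n.
  rewrite count_flatten map_nseq sumn_nseq count_uniq_mem ?enum_uniq// mem_enum/=.
  by rewrite mul1n.
have nn0 : n%:R != 0 :> R by rewrite pnatr_eq0 -lt0n.
have /andP[u0 u1] := u01 j.
rewrite mxE dE mulVf// mul1r add0r subrr expr0n add0r.
rewrite expr2 divfK// ler_piMr ?invr_ge0//; nra.
Qed.

End walk.

(** The walk is a polynomial in the probabilities, which are trigonometric
    here. *)
Lemma trigonometric_walk (R : realType) s (delta c : R) l g (y : 'rV[R]_s) :
  trigonometric (fun x => walk delta l (fun i => (1 + sin (c * x 0 i)) / 2) g y).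
Proof.
elim: l y => [|i l IH] y /=; first exact: trigonometric_cst.
have up : trigonometric (fun x : 'rV[R]_s => (1 + sin (c * x 0 i)) / 2).
  apply: trigonometricM; last exact: trigonometric_cst.
  apply: trigonometricD; [exact: trigonometric_cst|exact: trigonometric_sin].
apply: trigonometricD; apply: trigonometricM => //.
rewrite (_ : (fun x => _) = (fun x : 'rV[R]_s => 1 + (-1) * ((1 + sin (c * x 0 i)) / 2))).
  by apply: trigonometricD; [exact: trigonometric_cst|apply: trigonometricM => //; exact: trigonometric_cst].
by apply/funext => x; rewrite mulN1r.
Qed.

Section approximation.
Variables (R : realType) (s : nat).
Implicit Types (f F : 'rV[R]_s -> R).

(** Heine-Cantor, where the second point may leave the cube. *)
Lemma uniform_on_cube F e : continuous F -> 0 < e ->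
  exists2 delta : R, 0 < delta & forall u y : 'rV[R]_s, (forall i, 0 <= u 0 i <= 1) ->
    (forall i, `|u 0 i - y 0 i| < delta) -> `|F y - F u| <= e.
Proof.
move=> cF e0.
have K : compact [set u : 'rV[R]_s | forall i, `[0, 1]%classic (u ord0 i)].
  exact (@rV_compact R s (fun=> `[(0 : R), 1]%classic) (fun=> @segment_compact R 0 1)).
rewrite compact_near_coveringP in K.
pose P (delta : R) (u : 'rV[R]_s) := forall y, ball u delta y -> `|F y - F u| <= e.
have : \forall delta \near (0 : R)^'+,
    [set u : 'rV[R]_s | forall i, `[0, 1]%classic (u ord0 i)] `<=` P delta.
  apply: K => x _.
  have [r r0 rF] : exists2 r : R, 0 < r & forall y, ball x r y -> `|F x - F y| < e / 2.
    have := cF x; move/cvgrPdist_lt => /(_ (e / 2)); rewrite divr_gt0// => /(_ isT).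
    by move=> /nbhs_ballP[r r0 rF]; exists r.
  exists (ball x (r / 2), [set i | 0 < i < r / 2]).
    split; first by apply: nbhsx_ballx; rewrite divr_gt0.
    near=> i; apply/andP; split=> //.
    by near: i; apply: nbhs_right_lt; rewrite divr_gt0.
  move=> [u i] /= [xu /andP[i0 ir]] y uy.
  have Fu : `|F x - F u| < e / 2.
    by apply: rF; apply: le_ball xu; rewrite ler_pdivrMr// ler_peMr ?ltW//; lra.
  have Fy : `|F x - F y| < e / 2.
    apply: rF; rewrite (_ : r = r / 2 + r / 2); last by field.
    apply: ball_triangle xu _; exact: le_ball (ltW ir) _ uy.
  have -> : F y - F u = (F x - F u) - (F x - F y) by ring.
  apply: le_trans (ler_normB _ _) _; lra.
move=> near0; have [delta [d0 Pd]] : exists delta : R, 0 < delta /\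
    [set u : 'rV[R]_s | forall i, `[0, 1]%classic (u ord0 i)] `<=` P delta.
  have := filter_ex (filterI (nbhs_right_gt (0 : R)) near0).
  by case=> delta [/= ? ?]; exists delta.
exists delta => // u y u01 uy; apply: Pd; first by move=> i; rewrite /= in_itv/= u01.
by split=> // i j; rewrite !ord1; exact: uy.
Unshelve. all: by end_near.
Qed.

(** Bernstein's proof of the approximation theorem: the walk ends near its
    mean [u], and the quadratic bound on [F y - F u] contains Chebyshev's
    inequality. *)
Lemma bernstein_trigonometric F (M c e : R) : continuous F -> (forall y, `|F y| <= M) -> 0 < e ->
  exists2 h, trigonometric h & forall x, `|h x - F (\row_i ((1 + sin (c * x 0 i)) / 2))| <= e.
Proof.
move=> cF FM e0; have [delta d0 uF] := uniform_on_cube cF (divr_gt0 e0 (ltr0n R 2)).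
have M0 : 0 <= M by apply: le_trans (FM 0); exact: normr_ge0.
pose n := (Num.truncn (4 * M * s%:R / (delta ^+ 2 * e))).+1.
exists (fun x => walk n%:R^-1 (flatten (nseq n (enum 'I_s)))
    (fun i => (1 + sin (c * x 0 i)) / 2) F 0); first exact: trigonometric_walk.
move=> x; set u := fun i => (1 + sin (c * x 0 i)) / 2.
have u01 i : 0 <= u i <= 1.
  by have := sin_le1 (c * x 0 i); have := sin_geN1 (c * x 0 i); rewrite /u; lra.
have pt y : `|F y - F (\row_i u i)| <= e / 2 + 2 * M / delta ^+ 2 * \sum_j (y 0 j - u j) ^+ 2.
  have sum0 : 0 <= \sum_j (y 0 j - u j) ^+ 2 by apply: sumr_ge0 => j _; exact: sqr_ge0.
  have d20 : 0 < delta ^+ 2 by rewrite exprn_gt0.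
  have [/forallP small|/forallPn[j big]] := boolP [forall j, `|u j - y 0 j| < delta].
    apply: (@le_trans _ _ (e / 2)).
      by apply: uF => i; rewrite mxE.
    by rewrite lerDl mulr_ge0// divr_ge0 ?mulr_ge0// ltW.
  rewrite -leNgt in big.
  have : delta ^+ 2 <= \sum_j (y 0 j - u j) ^+ 2.
    rewrite (bigD1 j)//=; apply: (@le_trans _ _ ((y 0 j - u j) ^+ 2)).
      rewrite -[leRHS]real_normK ?num_real// distrC ler_sqr ?nnegrE//; exact: ltW.
    by rewrite lerDl; apply: sumr_ge0 => i _; exact: sqr_ge0.
  move=> dsum; apply: (@le_trans _ _ (2 * M)).
    by apply: le_trans (ler_normB _ _) _; have := FM y; have := FM (\row_i u i); lra.
  rewrite -[leLHS]addr0 addrC; apply: lerD; first by rewrite divr_ge0// ltW.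
  by rewrite -mulrA ler_peMr ?mulr_ge0// mulrC ler_pdivlMr// mul1r.
have n0 : (0 < n)%N by [].
have conc := walk_concentrates n0 erefl u01.
set w := walk _ _ _ F 0.
have bound (sg : R) : `|sg| <= 1 -> sg * (w - F (\row_i u i)) <= e.
  move=> sg1.
  have -> : sg * (w - F (\row_i u i)) = walk n%:R^-1 (flatten (nseq n (enum 'I_s))) u
      (fun y => sg * F y + (- sg * F (\row_i u i)) * 1) 0.
    by rewrite walk_lin walk_cst /w; ring.
  apply: le_trans (walk_le _ _ _ u01 (g := fun y => 2 * M / delta ^+ 2 *
     \sum_j (y 0 j - u j) ^+ 2 + e / 2 * 1) _) _.
    move=> y; rewrite [e / 2 * 1]mulr1 [leRHS]addrC; apply: le_trans (pt y).
    have -> : sg * F y + - sg * F (\row_i u i) * 1 = sg * (F y - F (\row_i u i)) by ring.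
    apply: le_trans (ler_norm _) _; by rewrite normrM ler_piMl.
  rewrite walk_lin walk_cst mulr1.
  have : 2 * M / delta ^+ 2 * (s%:R / n%:R) <= e / 2.
    have := Num.Theory.truncnS_gt (4 * M * s%:R / (delta ^+ 2 * e)); rewrite -/n.
    rewrite ltr_pdivrMr ?mulr_gt0 ?exprn_gt0// => nK.
    rewrite mulrACA -invfM ler_pdivrMr ?mulr_gt0 ?exprn_gt0 ?ltr0n//.
    by move: (s%:R) (n%:R) nK => a b; lra.
  have : 2 * M / delta ^+ 2 * walk n%:R^-1 (flatten (nseq n (enum 'I_s))) u
     (fun y => \sum_j (y 0 j - u j) ^+ 2) 0 <= 2 * M / delta ^+ 2 * (s%:R / n%:R).
    apply: ler_wpM2l conc; apply: divr_ge0; [exact: mulr_ge0|exact: sqr_ge0].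
  lra.
rewrite ler_norml; apply/andP; split.
  by have := bound (-1); rewrite normrN1 lexx => /(_ isT); rewrite mulN1r; lra.
by have := bound 1; rewrite normr1 lexx mul1r => /(_ isT).
Qed.

End approximation.

Section folding.
Variable R : realType.
Implicit Types t : R.

(** An inverse of [sin] near zero; the truncation keeps the argument of [asin]
    away from the end points, where [asin] is not smooth. *)
Definition fold_angle (t : R) : R :=
  asin (Num.max (- sin (pi / 4)) (Num.min (sin (pi / 4)) t)).

Lemma sin_pi4_itv : 0 < sin (pi / 4 : R) < 1.
Proof.
have p0 := pi_gt0 R.
apply/andP; split; first by apply: sin_gt0_pi; lra.
rewrite -[ltRHS]sin_pihalf ltr_sin ?in_itv/=; lra.
Qed.

Lemma continuous_fold_angle : continuous fold_angle.
Proof.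
move=> t; have /andP[s0 s1] := sin_pi4_itv.
pose cl t := Num.max (- sin (pi / 4 : R)) (Num.min (sin (pi / 4)) t).
apply: (@continuous_comp _ _ _ cl asin).
  apply: (@continuous_max R R (fun=> - sin (pi / 4)) (fun t => Num.min (sin (pi / 4)) t)); first exact: cvg_cst.
  by apply: (@continuous_min R R (fun=> sin (pi / 4)) id); [exact: cvg_cst|exact: cvg_id].
apply: continuous_asin; rewrite /cl lt_max gt_max lt_min gt_min; lra.
Qed.

Lemma fold_angle_bound t : `|fold_angle t| <= pi / 4.
Proof.
have /andP[s0 s1] := sin_pi4_itv; have p0 := pi_gt0 R.
rewrite /fold_angle; set r := Num.max _ _.
have r1 : - sin (pi / 4) <= r <= sin (pi / 4).
  by rewrite /r le_max ge_max le_min ge_min !lexx/= ; lra.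
have [] := @asin_def _ r; first lra.
move=> /andP[a1 a2] ar; rewrite ler_norml; apply/andP; split; rewrite leNgt.
  apply/negP => lt; have : sin (asin r) < sin (- (pi / 4)) by rewrite ltr_sin ?in_itv/=; lra.
  rewrite ar sinN; lra.
apply/negP => lt; have : sin (pi / 4) < sin (asin r) by rewrite ltr_sin ?in_itv/=; lra.
rewrite ar; lra.
Qed.

Lemma fold_angle_sin t : `|t| <= pi / 4 -> fold_angle (sin t) = t.
Proof.
rewrite ler_norml => /andP[t1 t2]; have p0 := pi_gt0 R.
have mono : {in `[(- (pi / 2)), pi / 2] &, {mono sin : x y / x <= y :> R}}.
  by apply: le_mono_in; move=> x y xi yi; rewrite ltr_sin.
rewrite /fold_angle min_r; last by rewrite mono ?in_itv/=; lra.
rewrite max_r; last by rewrite -sinN mono ?in_itv/=; lra.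
by rewrite sinK// in_itv/=; lra.
Qed.

Lemma fold_angle_sin_le t : `|fold_angle (sin t)| <= `|t|.
Proof.
have [/fold_angle_sin ->//|/ltW] := leP `|t| (pi / 4).
exact: le_trans (fold_angle_bound _).
Qed.

End folding.

Section approximation_unbounded.
Variables (R : realType) (s : nat).

Implicit Types x : 'rV[R]_s.

(** A weight that dominates all polynomials and has bounded expectation under
    the normalised urn and under Gaussian laws. *)
Definition expweight (x : 'rV[R]_s) : R := 1 + \sum_i cosh2 (x 0 i).

Lemma expweight_ge1 x : 1 <= expweight x.
Proof.
rewrite lerDl; apply: sumr_ge0 => i _; apply: le_trans (cosh2_ge2 _) => //.
Qed.

Lemma cosh2_le_expweight (x : 'rV[R]_s) i : cosh2 (x 0 i) <= expweight x.
Proof.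
rewrite /expweight (bigD1 i)//= addrCA lerDl addr_ge0// sumr_ge0// => j _.
by apply: le_trans (cosh2_ge2 _).
Qed.

Lemma continuous_row (Phi : 'I_s -> 'rV[R]_s -> R) : (forall i, continuous (Phi i)) ->
  continuous (fun u : 'rV[R]_s => \row_i Phi i u).
Proof.
move=> cPhi u; have FF : Filter (nbhs u) by exact: nbhs_filter.
apply/cvg_ballP => e e0.
have H : \forall v \near u, forall i, ball (Phi i u) e (Phi i v).
  apply: (@filter_forall _ _ (fun i v => ball (Phi i u) e (Phi i v)) (nbhs u)) => i.
  by have /cvg_ballP := cPhi i u; apply.
near=> v; split => // i j; rewrite !mxE.
by have := near H v; apply.
Unshelve. all: by end_near.
Qed.

(** Approximation relative to the weight. On a large box, [f] is a continuous
    function of the sines of small multiples of the coordinates, and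
    Bernstein's approximation applies. Outside, the approximating sum follows
    the value of [f] at a point folded back towards the origin, where the
    weight is smaller; both this value and that of [f] are there negligible
    against the weight. *)
Lemma trigonometric_approx (f : 'rV[R]_s -> R) (C e : R) : continuous f ->
  (forall x, f x ^+ 2 <= C * expweight x) -> 0 < e ->
  exists2 h, trigonometric h & forall x, `|h x - f x| <= 3 * e * expweight x.
Proof.
move=> cf fC e0.
have C0 : 0 <= C.
  have := le_trans (sqr_ge0 _) (fC 0); rewrite pmulr_lge0//.
  exact: lt_le_trans (expweight_ge1 _).
(* Outside the box of half-width [L] the weight exceeds [C / e ^+ 2], so
   that [f] is at most [e] times the weight; [c] maps the box into the range
   where [fold_angle] inverts [sin]. *)
pose L := 1 + C / e ^+ 2; pose c := pi / (4 * L).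
have L1 : 1 <= L by rewrite lerDl divr_ge0 ?sqr_ge0.
have L0 : 0 < L by lra.
have p0 := pi_gt0 R.
have c0 : 0 < c by rewrite divr_gt0// mulr_gt0.
pose Psi (u : 'rV[R]_s) : 'rV[R]_s := \row_i (fold_angle (2 * u 0 i - 1) / c).
have cPsi : continuous Psi.
  apply: (@continuous_row (fun i u => fold_angle (2 * u 0 i - 1) / c)) => i.
  have ck : continuous (fun t : R => fold_angle (2 * t - 1) / c).
    have ca : continuous (fun t : R => fold_angle (2 * t - 1)).
      move=> t; apply: (@continuous_comp _ _ _ (fun t : R => 2 * t - 1) (@fold_angle R)).
        apply: continuousB; last exact: cvg_cst.
        by apply: continuousM; [exact: cvg_cst|exact: cvg_id].
      exact: continuous_fold_angle.
    have cc : continuous (fun z : R => z / c).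
      exact: mulrr_continuous.
    move=> t; apply: (@continuous_comp _ _ _ (fun t : R => fold_angle (2 * t - 1)) (fun z : R => z / c)).
      exact: ca.
    exact: cc.
  move=> u; apply: (@continuous_comp _ _ _ (fun u : 'rV[R]_s => u 0 i)
    (fun t : R => fold_angle (2 * t - 1) / c)); first exact: coord_continuous.
  exact: ck.
have PsiL u i : `|Psi u 0 i| <= L.
  rewrite mxE normrM (gtr0_norm (_ : 0 < c^-1)) ?invr_gt0// ler_pdivrMr//.
  apply: le_trans (fold_angle_bound _) _; rewrite /c.
  by have -> : L * (pi / (4 * L)) = pi / 4 by field; rewrite gt_eqF.
have Psiu (x : 'rV[R]_s) : Psi (\row_i ((1 + sin (c * x 0 i)) / 2)) = \row_i (fold_angle (sin (c * x 0 i)) / c).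
  apply/rowP => i; rewrite !mxE; by congr (fold_angle _ / c); field.
have fD (x y : 'rV[R]_s) : expweight y <= expweight x -> C / e ^+ 2 <= expweight x ->
    `|f y| <= e * expweight x.
  move=> Dy Dx; have D1 := expweight_ge1 x.
  have eD0 : 0 <= e * expweight x by rewrite mulr_ge0//; [exact: ltW|lra].
  rewrite -ler_sqr ?nnegrE// real_normK ?num_real//.
  apply: le_trans (fC y) _; apply: (@le_trans _ _ (C * expweight x)); first exact: ler_wpM2l.
  rewrite exprMn [expweight x ^+ 2]expr2 mulrA ler_wpM2r//; first lra.
  by move: Dx; rewrite ler_pdivrMr ?exprn_gt0// mulrC.
pose B := 1 + s%:R * cosh2 L.
have FM u : `|f (Psi u)| <= 1 + C * B.
  have DB : expweight (Psi u) <= B.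
    rewrite lerD2l; have -> : s%:R * cosh2 L = \sum_(i < s) cosh2 L.
      by rewrite sumr_const card_ord mulr_natl.
    apply: ler_sum => i _; apply: cosh2_mono.
    by rewrite (gtr0_norm L0); exact: PsiL.
  have : f (Psi u) ^+ 2 <= C * B by apply: le_trans (fC _) _; exact: ler_wpM2l.
  rewrite -real_normK ?num_real//; have := normr_ge0 (f (Psi u)).
  by move: `|_| (C * B) => a b; nra.
have cF : continuous (f \o Psi).
  by move=> u; apply: continuous_comp; [exact: cPsi|exact: cf].
have [h ht hF] := bernstein_trigonometric c cF FM e0.
exists h => // x; have D1 := expweight_ge1 x.
have eD : e <= e * expweight x by rewrite ler_peMr// ltW.
have := hF x; rewrite /= Psiu; set y := \row_i _ => hy.
have [/forallP box|/forallPn[i xL]] := boolP [forall i, `|x 0 i| <= L].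
  have yx : y = x.
    apply/rowP => i; rewrite mxE fold_angle_sin; first by field; rewrite gt_eqF.
    rewrite normrM (gtr0_norm c0); apply: (@le_trans _ _ (c * L)); first by rewrite ler_pM2l.
    by have -> : c * L = pi / 4 by rewrite /c; field; rewrite gt_eqF.
  by rewrite yx in hy; lra.
rewrite -ltNge in xL.
have DxL : C / e ^+ 2 <= expweight x.
  apply: le_trans (cosh2_le_expweight x i); apply: le_trans (cosh2_ge _).
  rewrite -[x 0 i ^+ 2]real_normK ?num_real//.
  have : L <= `|x 0 i| ^+ 2 by move: `|_| xL => a; nra.
  have -> : C / e ^+ 2 = L - 1 by rewrite /L addrAC subrr add0r.
  move: (`|_| ^+ 2) => a; lra.
have fx := fD x x (lexx _) DxL.
have fy : `|f y| <= e * expweight x.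
  apply: fD => //; rewrite lerD2l; apply: ler_sum => j _; apply: cosh2_mono.
  rewrite mxE normrM (gtr0_norm (_ : 0 < c^-1)) ?invr_gt0// ler_pdivrMr//.
  by apply: le_trans (fold_angle_sin_le _) _; rewrite normrM (gtr0_norm c0) mulrC.
have -> : h x - f x = (h x - f y) + f y - f x by ring.
apply: le_trans (ler_normB _ _) _.
have := ler_normD (h x - f y) (f y); lra.
Qed.

End approximation_unbounded.

(** * From cosine transforms to unbounded continuous functions *)

Section gaussian_vector.
Variables (R : realType) (s : nat) (d : measure_display) (T : measurableType d).
Variables (Q : probability T R) (Z : T -> 'rV[R]_s) (Sigma : 'M[R]_s).
Hypotheses (covS : covariance_matrix Sigma) (gZ : centered_gaussian Q Sigma Z).

Let qf (t : 'cV[R]_s) : R := (t^T *m Sigma *m t) 0 0.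

Lemma gaussian_dot_law t : has_normal_law Q (fun w => dot (Z w) t) (qf t).
Proof.
have [mZ law] := gZ.
have -> : (fun w => dot (Z w) t) = (fun w => \sum_i t^T 0 i * Z w 0 i).
  by apply/funext => w; rewrite /dot mxE; apply: eq_bigr => i _; rewrite mxE mulrC.
split; first by apply: measurable_sum => i; exact: measurable_funM.
by move=> B mB; have := law t^T B mB; rewrite trmxK.
Qed.

Lemma qf_ge0 t : 0 <= qf t.
Proof. by have [_ /(_ t^T)] := covS; rewrite trmxK. Qed.

Lemma dot_delta (x : 'rV[R]_s) i : dot x (delta_mx i 0) = x 0 i.
Proof. by rewrite /dot -colE mxE. Qed.

Lemma gaussian_integrable_cosh2 i : Q.-integrable setT (EFin \o (fun w => cosh2 (Z w 0 i))).
Proof.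
have := normal_law_integrable_cosh2 (qf_ge0 (delta_mx i 0)) (gaussian_dot_law _).
by under eq_fun do rewrite /= dot_delta.
Qed.

Lemma gaussian_integrable_expweight : Q.-integrable setT (EFin \o (fun w => expweight (Z w))).
Proof.
apply: integrableD_fun; first exact: integrable_cst_fun.
exact: (@integrable_sum_fun _ _ _ Q _ _ (fun i w => cosh2 (Z w 0 i)) gaussian_integrable_cosh2).
Qed.

Lemma gaussian_cos t b : \int[Q]_w cos (dot (Z w) t + b) = expR (- (qf t / 2)) * cos b.
Proof. exact: normal_law_cos (qf_ge0 t) (gaussian_dot_law t) b. Qed.

Lemma gaussian_integrable_cos t b : Q.-integrable setT (EFin \o (fun w => cos (dot (Z w) t + b))).
Proof.
apply: (@integrable_bounded _ _ _ _ _ 1).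
  apply: measurableT_comp; first exact: measurable_cos.
  by apply: measurable_funD => //; case: (gaussian_dot_law t).
by move=> w; rewrite ler_norml cos_le1 cos_geN1.
Qed.

Lemma gaussian_integrable_trig l : Q.-integrable setT (EFin \o (fun w => trig_eval l (Z w))).
Proof.
apply: (@integrable_sum_fun _ _ _ Q _ _ (fun p w => p.1 * cos (dot (Z w) p.2.1 + p.2.2))) => p.
by apply: integrableZ_fun; exact: gaussian_integrable_cos.
Qed.

Lemma gaussian_mean i : \int[Q]_w Z w 0 i = 0.
Proof.
rewrite -(normal_law_mean (qf_ge0 (delta_mx i 0)) (gaussian_dot_law _)).
by apply: eq_Rintegral => w _; rewrite dot_delta.
Qed.

(** Measurability is known for the coordinates of [Z], hence for trigonometric
    sums, and passes to their pointwise limits. *)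
Lemma measurable_continuous_gaussian (f : 'rV[R]_s -> R) (C : R) : continuous f ->
  (forall x, f x ^+ 2 <= C * expweight x) -> measurable_fun setT (fun w => f (Z w)).
Proof.
move=> cf fC.
have /choice[h hP] (n : nat) : exists l, forall x,
    `|trig_eval l x - f x| <= 3 * n.+1%:R^-1 * expweight x.
  have [|h [l hl] hf] := trigonometric_approx cf fC (_ : 0 < n.+1%:R^-1); first by rewrite invr_gt0.
  by exists l => x; rewrite -hl.
apply: (@measurable_fun_cvg _ _ _ _ (fun n w => trig_eval (h n) (Z w))).
  move=> n; apply/measurable_EFinP; apply: (measurable_int Q).
  exact: gaussian_integrable_trig.
move=> w _; apply/cvgrPdist_le => e e0.
exists (Num.truncn (3 * expweight (Z w) / e)) => // n /= kn.
rewrite distrC; apply: le_trans (hP n _) _.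
have k1 := ltW (Num.Theory.truncnS_gt (3 * expweight (Z w) / e)).
have : 3 * expweight (Z w) / e <= n.+1%:R by apply: (le_trans k1); rewrite ler_nat.
by rewrite ler_pdivrMr// mulrAC (ler_pdivrMr _ _ (ltr0Sn _ _)) [e * _]mulrC.
Qed.

Lemma gaussian_integrable_continuous (f : 'rV[R]_s -> R) (C : R) : continuous f ->
  (forall x, f x ^+ 2 <= C * expweight x) ->
  Q.-integrable setT (EFin \o (fun w => f (Z w))).
Proof.
move=> cf fC.
apply: (@integrable_dominated _ _ _ _ _ (fun w => expweight (Z w)) (1 + C)).
- exact: measurable_continuous_gaussian cf fC.
- move=> w; have := fC (Z w); rewrite -real_normK ?num_real//.
  have := expweight_ge1 (Z w); have := normr_ge0 (f (Z w)).
  have C0 : 0 <= C.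
    have := le_trans (sqr_ge0 _) (fC (Z w)); rewrite pmulr_lge0//.
    exact: lt_le_trans (expweight_ge1 _).
  by move: `|_| (expweight _) => a b; nra.
- exact: gaussian_integrable_expweight.
Qed.

Lemma gaussian_square t : \int[Q]_w (dot (Z w) t ^+ 2) = qf t.
Proof. exact: normal_law_variance (qf_ge0 t) (gaussian_dot_law t). Qed.

Lemma gaussian_integrable_square t : Q.-integrable setT (EFin \o (fun w => dot (Z w) t ^+ 2)).
Proof.
apply: (@integrable_dominated _ _ _ _ _ (fun w => cosh2 (dot (Z w) t)) 1).
- by apply: measurable_funX; case: (gaussian_dot_law t).
- move=> w; rewrite mul1r ger0_norm ?sqr_ge0//.
  by apply: le_trans (cosh2_ge _); rewrite lerDr.
- exact: normal_law_integrable_cosh2 (qf_ge0 t) (gaussian_dot_law t).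
Qed.

(** Polarisation of the variance of linear combinations. *)
Lemma gaussian_covariance i j : \int[Q]_w (Z w 0 i * Z w 0 j) = Sigma i j.
Proof.
pose di : 'cV[R]_s := delta_mx i 0; pose dj : 'cV[R]_s := delta_mx j 0.
have entry k l : ((delta_mx k 0 : 'cV[R]_s)^T *m Sigma *m (delta_mx l 0 : 'cV[R]_s)) 0 0 = Sigma k l.
  by rewrite trmx_delta -rowE -colE !mxE.
have symS : Sigma j i = Sigma i j by rewrite -{1}covS.1 mxE.
have qfE : qf (di + dj) = qf di + qf dj + 2 * Sigma i j.
  have -> : qf (di + dj) = (di^T *m Sigma *m di + dj^T *m Sigma *m di +
      (di^T *m Sigma *m dj + dj^T *m Sigma *m dj)) 0 0.
    by rewrite /qf [(di + dj)^T]linearD /= mulmxDr !mulmxDl.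
  rewrite /qf [LHS]mxE [X in X + _]mxE [X in _ + X]mxE !entry symS.
  by rewrite -!addrA; congr (_ + _); rewrite addrA mulr_natl mulr2n addrC.
transitivity (\int[Q]_w (2^-1 * (dot (Z w) (di + dj) ^+ 2) +
    ((- 2^-1) * (dot (Z w) di ^+ 2) + (- 2^-1) * (dot (Z w) dj ^+ 2)))).
  apply: eq_Rintegral => w _.
  rewrite (_ : dot (Z w) (di + dj) = dot (Z w) di + dot (Z w) dj); last by rewrite /dot mulmxDr mxE.
  by rewrite !dot_delta; field.
have iS c t : Q.-integrable setT (EFin \o (fun w => c * dot (Z w) t ^+ 2)).
  by apply: integrableZ_fun; exact: gaussian_integrable_square.
rewrite RintegralD//; last exact: integrableD_fun.
rewrite RintegralD// !RintegralZl//; try exact: gaussian_integrable_square.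
by rewrite !gaussian_square qfE; field.
Qed.

End gaussian_vector.

Section weak_convergence.
Variables (R : realType) (s : nat) (d : measure_display) (T : measurableType d).
Variables (Q : probability T R) (Z : T -> 'rV[R]_s) (Sigma : 'M[R]_s).
Hypotheses (covS : covariance_matrix Sigma) (gZ : centered_gaussian Q Sigma Z).
Variables (A : 'M[R]_s) (m : R) (x0 : 'rV[R]_s).
Hypotheses (hm : 0 < m) (hbal : balanced A m) (hx0 : nonneg_nonzero x0) (hten : tenable A x0).
Variable y : nat -> 'rV[R]_s -> 'rV[R]_s.
Local Notation E n f := (urn_exp A x0 n (fun x => f (y n x))).
Hypothesis cos_limit : forall t b,
  E n (fun z => cos (dot z t + b)) @[n --> \oo] --> expR (- ((t^T *m Sigma *m t) 0 0 / 2)) * cos b.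
Hypothesis exp_bound : forall t, exists C, \forall n \near \oo, E n (fun z => expR (dot z t)) <= C.

Lemma expweight_bound : exists K, \forall n \near \oo, E n (@expweight R s) <= K.
Proof.
have /choice[C HC] (i : 'I_s) : exists C, \forall n \near \oo, E n (fun z => cosh2 (z 0 i)) <= C.
  have [C1 H1] := exp_bound (delta_mx i 0); have [C2 H2] := exp_bound (- delta_mx i 0).
  exists (C1 + C2); near=> n.
  rewrite urn_expD; apply: lerD.
    have : E n (fun z => expR (dot z (delta_mx i 0))) <= C1 by near: n.
    by under eq_fun do rewrite dot_delta.
  have : E n (fun z => expR (dot z (- delta_mx i 0))) <= C2 by near: n.
  by under eq_fun do rewrite /dot mulmxN mxE -/(dot _ _) dot_delta.
have {}HC : \forall n \near \oo, forall i, E n (fun z => cosh2 (z 0 i)) <= C i.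
  exact: filter_forall.
exists (1 + \sum_i C i); near=> n.
rewrite urn_expD (urn_exp_cst hm hbal hx0 hten) lerD2l.
rewrite (urn_exp_sum hm hbal hx0 hten); apply: ler_sum => i _.
by move: i; near: n.
Unshelve. all: by end_near.
Qed.

Lemma trig_limit h : trigonometric h -> E n h @[n --> \oo] --> \int[Q]_w h (Z w).
Proof.
move=> [l hl]; have -> : h = trig_eval l by apply/funext.
have -> : (fun n => E n (trig_eval l)) =
    (fun n => \sum_(p <- l) p.1 * E n (fun z => cos (dot z p.2.1 + p.2.2))).
  apply/funext => n; rewrite (urn_exp_sum hm hbal hx0 hten).
  by apply: eq_bigr => p _; rewrite urn_expZ.
have -> : \int[Q]_w trig_eval l (Z w) = \sum_(p <- l)
    p.1 * (expR (- ((p.2.1^T *m Sigma *m p.2.1) 0 0 / 2)) * cos p.2.2).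
  rewrite (@Rintegral_sum _ _ _ Q _ l (fun p w => p.1 * cos (dot (Z w) p.2.1 + p.2.2))).
    apply: eq_bigr => p _; rewrite RintegralZl//; last exact: gaussian_integrable_cos gZ _ _.
    by rewrite (gaussian_cos covS gZ).
  by move=> p; apply: integrableZ_fun; exact: gaussian_integrable_cos gZ _ _.
apply: (cvg_sum_seq (f := fun p n => p.1 * E n (fun z => cos (dot z p.2.1 + p.2.2)))) => p.
by apply: cvgMr; exact: cos_limit.
Qed.

(** The two errors of the trigonometric approximation are [c] times
    expectations of the weight, which stay bounded, and trigonometric sums
    converge by hypothesis. *)
Lemma continuous_limit (f : 'rV[R]_s -> R) (C : R) : continuous f ->
  (forall x, f x ^+ 2 <= C * expweight x) -> E n f @[n --> \oo] --> \int[Q]_w f (Z w).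
Proof.
move=> cf fC; apply/cvgrPdist_le => e e0.
have [K HK] := expweight_bound.
set KZ := \int[Q]_w expweight (Z w).
have KZ0 : 0 <= KZ.
  by apply: Rintegral_ge0 => w _; exact: le_trans (expweight_ge1 _).
pose B := 1 + `|K| + KZ.
have B0 : 0 < B by rewrite /B; have := normr_ge0 K; lra.
have [|h ht hf] := trigonometric_approx cf fC (_ : 0 < e / (9 * B)).
  by rewrite divr_gt0// mulr_gt0.
have HB : 3 * (e / (9 * B)) * B = e / 3 by field; rewrite gt_eqF.
have c0 : 0 < 3 * (e / (9 * B)) by rewrite mulr_gt0// divr_gt0// mulr_gt0.
move: (3 * (e / (9 * B))) HB c0 hf => c HB c0 hf.
have fi := gaussian_integrable_continuous covS gZ cf fC.
have hi : Q.-integrable setT (EFin \o (fun w => h (Z w))).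
  case: ht => l hl; rewrite (_ : h = trig_eval l); last exact/funext.
  exact: gaussian_integrable_trig gZ l.
have di := gaussian_integrable_expweight covS gZ.
have gauss_err : `|\int[Q]_w f (Z w) - \int[Q]_w h (Z w)| <= c * KZ.
  rewrite -RintegralB//; apply: le_trans (le_normr_Rintegral _ _) _ => //.
    by rewrite (_ : EFin \o _ = ((EFin \o (fun w => f (Z w))) \- (EFin \o (fun w => h (Z w))))%E)//; exact: integrableB.
  rewrite -RintegralZl//; apply: le_Rintegral => //.
  - apply: (@integrable_dominated _ _ _ _ _ (fun w => expweight (Z w)) c) di => //.
      apply/measurable_EFinP/(measurable_int Q)/integrable_norm => //.
      by rewrite (_ : EFin \o _ = ((EFin \o (fun w => f (Z w))) \- (EFin \o (fun w => h (Z w))))%E)//; exact: integrableB.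
    by move=> w; rewrite normr_id distrC.
  - exact: integrableZ_fun.
  - by move=> w _; rewrite distrC.
have hlim := trig_limit ht; move/cvgrPdist_le : hlim => /(_ (e / 3)).
rewrite divr_gt0// => /(_ isT) hlim.
near=> n.
have En : E n (@expweight R s) <= K by near: n.
have hn : `|\int[Q]_w h (Z w) - E n h| <= e / 3 by near: n.
have urn_err : `|E n h - E n f| <= c * K.
  rewrite -urn_expB.
  apply: le_trans (urn_exp_norm hm hbal hx0 hten _ _) _.
  apply: (@le_trans _ _ (c * E n (@expweight R s))); last by rewrite ler_pM2l.
  by rewrite -urn_expZ; apply: (urn_exp_le hm hbal hx0 hten) => x _.
have -> : \int[Q]_w f (Z w) - E n f = (\int[Q]_w f (Z w) - \int[Q]_w h (Z w)) +
   (\int[Q]_w h (Z w) - E n h) + (E n h - E n f) by ring.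
apply: le_trans (ler_normD _ _) _.
have := ler_normD (\int[Q]_w f (Z w) - \int[Q]_w h (Z w)) (\int[Q]_w h (Z w) - E n h).
have : c * K <= c * `|K| by rewrite ler_pM2l// ler_norm.
have : c * `|K| + c * KZ <= e / 3 by rewrite -HB /B; nra.
lra.
Unshelve. all: by end_near.
Qed.

End weak_convergence.

(** * Convergence in law with all moments *)

Section monomials.
Variables (R : realType) (s : nat).

Definition monomial (alpha : 'I_s -> nat) (x : 'rV[R]_s) : R := \prod_i x 0 i ^+ alpha i.

Lemma continuous_monomial alpha : continuous (monomial alpha).
Proof.
suff cr r : continuous (fun z : 'rV[R]_s => \prod_(j <- r) z 0 j ^+ alpha j) by exact: cr.
elim: r => [|i r IH] x.
  have -> : (fun z : 'rV[R]_s => \prod_(j <- [::]) z 0 j ^+ alpha j) = fun=> 1.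
    by apply/funext => z; rewrite big_nil.
  exact: cst_continuous.
have -> : (fun z : 'rV[R]_s => \prod_(j <- i :: r) z 0 j ^+ alpha j) =
    (fun z : 'rV[R]_s => z 0 i ^+ alpha i * \prod_(j <- r) z 0 j ^+ alpha j).
  by apply/funext => z; rewrite big_cons.
have ci : continuous (fun z : 'rV[R]_s => z 0 i ^+ alpha i).
  move=> z; apply: (@continuous_comp _ _ _ (fun z : 'rV[R]_s => z 0 i) (fun t : R => t ^+ alpha i)).
    exact: coord_continuous.
  exact: exprn_continuous.
exact: (continuousM (ci x) (IH x)).
Qed.

Lemma pow_le_expR (y : R) n : 0 <= y -> y ^+ n <= n`!%:R * expR y.
Proof.
move=> y0; case: n => [|n]; first by rewrite expr0 fact0 mul1r -expR0 ler_expR.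
have := expR_ge1Dxn n y0; rewrite -ler_pdivrMl ?ltr0n ?fact_gt0// mulrC.
lra.
Qed.

(** Every coordinate is at most [ln (expweight x)] in absolute value, and [y
    ^+ n] is at most [n! * exp y]. *)
Lemma monomial_expweight alpha x :
  monomial alpha x ^+ 2 <= (2 * \sum_i alpha i)`!%:R * expweight x.
Proof.
have D1 := expweight_ge1 x; have D0 : 0 < expweight x by lra.
have xl i : `|x 0 i| <= ln (expweight x).
  rewrite -ler_expR lnK// ?posrE//; apply: le_trans (cosh2_le_expweight x i).
  by have [x0|x0] := ger0P (x 0 i); rewrite /cosh2 ?lerDl ?lerDr expR_ge0.
have l0 : 0 <= ln (expweight x) by rewrite ln_ge0.
rewrite -[X in _ <= _ * X]lnK ?posrE//.
apply: le_trans (pow_le_expR _ l0).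
rewrite mulnC exprM -[leLHS]real_normK ?num_real// ler_sqr ?nnegrE ?exprn_ge0//.
rewrite normr_prod expr_sum; apply: ler_prod => i _.
by rewrite normrX exprn_ge0//= lerXn2r// nnegrE.
Qed.

End monomials.

Theorem theorem1p2 (R : realType) (s : nat) (A : 'M[R]_s) (m : R)
    (v1 : 'rV[R]_s) (d nu : nat)
    (hm : 0 < m)
    (hbal : balanced A m)
    (hirr : irreducible A)
    (hcrit : critically_small A m)
    (hv1 : normalized_left_eigenvector A m v1)
    (hd : largest_jordan_block A (m / 2) d.+1)
    (hnu : nu = (2 * d + 1)%N) :
  exists Sigma : 'M[R]_s,
    covariance_matrix Sigma /\
    exists (dZ : measure_display) (TZ : measurableType dZ)
           (Q : probability TZ R) (Z : TZ -> 'rV[R]_s),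
      centered_gaussian Q Sigma Z /\
      forall (x0 : 'rV[R]_s) (dX : measure_display) (T : measurableType dX)
             (P : probability T R) (X : nat -> T -> 'rV[R]_s),
        nonneg_nonzero x0 -> tenable A x0 -> polya_urn P A x0 X ->
        let a := fun n : nat => n%:R * ln n%:R ^+ nu : R in
        let Y := fun (n : nat) (w : T) =>
          (Num.sqrt (a n))^-1 *: (X n w - (n%:R * m) *: v1) in
        [/\ cvg_in_distribution P Y Q Z,
            forall alpha : 'I_s -> nat,
              moment P alpha (Y n) @[n --> \oo] --> moment Q alpha Z,
            forall i : 'I_s,
              (fun n => mean P (X n) i) =
              (fun n => n%:R * m * v1 0 i) +o_\oo (fun n => Num.sqrt (a n))
          & forall i j : 'I_s,
              (fun n => cov P (X n) i j) =
              (fun n => a n * Sigma i j) +o_\oo a].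
Proof.
subst nu.
have [offdiag|noffdiag] := pselect (forall j k, j != k -> 0 <= A k j); last first.
  (* With a negative off-diagonal entry no initial state is tenable, and
     every Gaussian vector qualifies. *)
  have c0 : covariance_matrix (0 : 'M[R]_s).
    by split; [exact: trmx0|move=> t; rewrite mulmx0 mul0mx mxE].
  exists 0; split => //; have [dZ [TZ [Q [Z gZ]]]] := gaussian_exists c0.
  exists dZ, TZ, Q, Z; split => // x0 dX T P X _ [offd _] _.
  by case: noffdiag.
have [Sigma [covS HS]] := raccum_limit hm hbal hirr hcrit hv1 hd offdiag.
exists Sigma; split => //; have [dZ [TZ [Q [Z gZ]]]] := gaussian_exists covS.
exists dZ, TZ, Q, Z; split => // x0 dX T P X hx0 hten hX a Y.
pose kappa := (\sum_j x0 0 j) / m.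
have kappa0 : 0 < kappa by rewrite divr_gt0// (sum_x0_gt0 hx0).
pose y := fun n => normalised m v1 d n.
have clim t b : urn_exp A x0 n (fun x => cos (dot (y n x) t + b)) @[n --> \oo] -->
    expR (- ((t^T *m Sigma *m t) 0 0 / 2)) * cos b.
  exact: (urn_cos_limit hm hbal hirr hcrit hv1 hd hx0 hten erefl (fun x => HS kappa x kappa0)).
have elim t : exists C, \forall n \near \oo, urn_exp A x0 n (fun x => expR (dot (y n x) t)) <= C.
  exact: (urn_exp_bound hm hbal hirr hcrit hv1 hd hx0 hten (erefl kappa)).
have lim (f : 'rV[R]_s -> R) C : continuous f -> (forall x, f x ^+ 2 <= C * expweight x) ->
    urn_exp A x0 n (fun x => f (y n x)) @[n --> \oo] --> \int[Q]_w f (Z w).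
  exact: (continuous_limit covS gZ hm hbal hx0 hten clim elim).
have limE (f : 'rV[R]_s -> R) C : continuous f -> (forall x, f x ^+ 2 <= C * expweight x) ->
    expectation P (fun w => f (Y n w)) @[n --> \oo] --> expectation Q (fun w => f (Z w)).
  move=> cf fC; have fi := gaussian_integrable_continuous covS gZ cf fC.
  rewrite unlock -[X in _ --> X]fineK; last exact: integrable_fin_num.
  have -> : (fun n => \int[P]_w (f (Y n w))%:E)%E =
      (fun n => (urn_exp A x0 n (fun x => f (y n x)))%:E).
    by apply/funext => n; rewrite -(expectation_urn hX) unlock.
  by apply: cvg_EFin; [exact: nearW|exact: lim cf fC].
pose coord i (z : 'rV[R]_s) := z 0 i.
have coord_lim i : urn_exp A x0 n (fun x => y n x 0 i) @[n --> \oo] --> (0 : R).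
  rewrite -(gaussian_mean covS gZ i); apply: (lim (coord i) 1); first exact: coord_continuous.
  move=> x; rewrite mul1r; apply: le_trans (cosh2_le_expweight x i).
  by apply: le_trans (cosh2_ge _); rewrite lerDr.
have prod_lim i j : urn_exp A x0 n (fun x => y n x 0 i * y n x 0 j) @[n --> \oo] --> Sigma i j.
  rewrite -(gaussian_covariance covS gZ i j).
  apply: (lim (fun z => coord i z * coord j z) 16).
    by move=> z; apply: continuousM; exact: coord_continuous.
  move=> x; rewrite /coord.
  have := cosh2_ge4 (x 0 i); have := cosh2_ge4 (x 0 j).
  have := cosh2_le_expweight x i; have := cosh2_le_expweight x j.
  move: (cosh2 _) (cosh2 _) (expweight _) => p q D pD qD q4 p4.
  have := sqr_ge0 (x 0 i ^+ 2 - x 0 j ^+ 2).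
  rewrite exprMn; nra.
have scale_gt0 : \forall n \near \oo, 0 < a n by exact: variance_scale_gt0_near.
have coordE n (x : 'rV[R]_s) i : 0 < a n ->
    x 0 i = n%:R * m * v1 0 i + Num.sqrt (a n) * y n x 0 i.
  move=> an; have sn : Num.sqrt (a n) != 0 by rewrite gt_eqF// sqrtr_gt0.
  rewrite /y /normalised !mxE -/(variance_scale _ _ _) -/(a n) mulrA divff// mul1r.
  by ring.
have meanE n i : mean P (X n) i = urn_exp A x0 n (fun x => x 0 i).
  by rewrite /mean (expectation_urn hX n (fun x => x 0 i)).
have mean_near n i : 0 < a n -> mean P (X n) i =
    n%:R * m * v1 0 i + Num.sqrt (a n) * urn_exp A x0 n (fun x => y n x 0 i).
  move=> an; rewrite meanE; under eq_fun do rewrite (coordE n _ i an).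
  by rewrite urn_expD (urn_exp_cst hm hbal hx0 hten) urn_expZ.
split.
- move=> f cf [M fM]; apply: (limE f (M ^+ 2)) => // x.
  have D1 := expweight_ge1 x; have := fM x; have := normr_ge0 (f x).
  rewrite -real_normK ?num_real//; move: `|f x| => b b0 bM.
  have : b ^+ 2 <= M ^+ 2 by rewrite ler_sqr ?nnegrE//; lra.
  have := sqr_ge0 M; nra.
- move=> alpha; apply: (limE (monomial alpha)); first exact: continuous_monomial.
  exact: monomial_expweight.
- move=> i; apply/eqaddoP => e e0.
  have small : \forall n \near \oo, `|urn_exp A x0 n (fun x => y n x 0 i)| <= e.
    by have /cvgr0Pnorm_le := coord_lim i; apply.
  near=> n; have an : 0 < a n by near: n.
  rewrite /= !fctE mean_near// addrAC subrr add0r normrM mulrC ler_wpM2r//.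
  by near: n.
- move=> i j; apply/eqaddoP => e e0.
  pose p i n := urn_exp A x0 n (fun x => y n x 0 i).
  have covE n : 0 < a n -> cov P (X n) i j =
      a n * (urn_exp A x0 n (fun x => y n x 0 i * y n x 0 j) - p i n * p j n).
    move=> an.
    pose g (x : 'rV[R]_s) := (x 0 i - mean P (X n) i) * (x 0 j - mean P (X n) j).
    have -> : cov P (X n) i j = fine (expectation P (fun w => g (X n w))).
      by rewrite /cov covariance.unlock.
    rewrite (expectation_urn hX n g) /=.
    have -> : g = (fun x => a n * (y n x 0 i * y n x 0 j +
        ((- p j n) * y n x 0 i + ((- p i n) * y n x 0 j + p i n * p j n)))).
      apply/funext => x; rewrite /g !mean_near// !(coordE n x)// -/(p i n) -/(p j n).
      rewrite -[X in X * (y n x 0 i * _ + _)](@sqr_sqrtr _ (a n)) ?ltW//.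
      move: (Num.sqrt _) => r; ring.
    rewrite urn_expZ !urn_expD (urn_exp_cst hm hbal hx0 hten) !urn_expZ -/(p i n) -/(p j n).
    by congr (_ * _); ring.
  have small : \forall n \near \oo,
      `|urn_exp A x0 n (fun x => y n x 0 i * y n x 0 j) - p i n * p j n - Sigma i j| <= e.
    have : urn_exp A x0 n (fun x => y n x 0 i * y n x 0 j) - p i n * p j n @[n --> \oo] -->
       (Sigma i j - 0 * 0 : R).
      apply: cvgB; first exact: prod_lim.
      by apply: cvgM; exact: coord_lim.
    rewrite mul0r subr0 => /cvgrPdist_le /(_ e e0); apply: filterS => n.
    by rewrite distrC.
  near=> n; have an : 0 < a n by near: n.
  rewrite /= !fctE covE// -mulrBr normrM mulrC ler_wpM2r//.
  by near: n.
Unshelve. all: by end_near.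
Qed.
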